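(* Let $\Omega \subset \mathbb{R}^N$ be a domain, let $p,q>0$ with $pq>1$, and let $f,g:\Omega\times\mathbb{R}^2\to\mathbb{R}$ be Carath\'eodory functions such that for any compact set $K_1\times K_2\subset\subset \Omega\times\mathbb{R}^2$ there exists $C>0$ with $$|f(x,u,v)|\le C|v|^q,\qquad |g(x,u,v)|\le C|u|^p\qquad \text{for a.e. } x\in K_1 \text{ and every } (u,v)\in K_2.$$ Let $m>N$ and let $u,v\in W^{2,m}_{\mathrm{loc}}(\Omega)$ be a solution of $$\Delta u+f(x,u,v)=0,\qquad \Delta v+g(x,u,v)=0\qquad\text{in }\Omega .$$ If both $u$ and $v$ vanish with infinite order at some point $x_0\in\Omega$, then $u\equiv v\equiv 0$ in $\Omega$.
   Context: A function $f:\Omega\times\mathbb{R}^2\to\mathbb{R}$ is Carath\'eodory if it is continuous in $(u,v)\in\mathbb{R}^2$ for a.e. $x\in\Omega$ and measurable in $x$ for every $(u,v)\in\mathbb{R}^2$. Solutions are understood in the strong $W^{2,m}_{\mathrm{loc}}(\Omega)$ sense with $m>N$, i.e. the equations hold at almost every point of $\Omega$. A measurable function $u$ defined in $\Omega$ vanishes with infinite order at the point $x_0\in\Omega$ provided that for some $\varepsilon>0$ one has $\int_{B_r(x_0)}|u|^{\varepsilon}\,dx=o(r^k)$ as $r\to0^+$, for every $k>0$. *)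

(* Defs.v *)
From HB Require Import structures.
From mathcomp Require Import all_boot all_order all_algebra.
From mathcomp Require Import all_classical all_reals all_analysis.

Set Implicit Arguments.
Unset Strict Implicit.
Unset Printing Implicit Defensive.

Import Order.TTheory GRing.Theory Num.Theory.
Import numFieldNormedType.Exports.

Local Open Scope classical_set_scope.
Local Open Scope ring_scope.

(* Lebesgue measure on R^N: the completion of the N-fold product of the
   one-dimensional Lebesgue measure. The product is built by recursion on
   n.-tuple R (Borel sigma-algebra); the space R^N itself is 'rV[R]_N, which
   carries the topology and the differential calculus of the library. *)

Lemma product_measure_sigma_finite d1 d2 (T1 : measurableType d1)
    (T2 : measurableType d2) (R : realType)
    (m1 : {sigma_finite_measure set T1 -> \bar R})
    (m2 : {sigma_finite_measure set T2 -> \bar R}) :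
  sigma_finite setT (m1 \x m2)%E.
Proof.
have /sigma_finiteP[F [TF ndF Foo]] := sigma_finiteT m1.
have /sigma_finiteP[G [TG ndG Goo]] := sigma_finiteT m2.
exists (fun n => F n `*` G n).
  rewrite -setXTT TF TG predeqE => -[x y]; split.
    move=> [/= [n _ Fnx] [k _ Gky]]; exists (maxn n k) => //; split.
    - by move: x Fnx; exact/subsetPset/ndF/leq_maxl.
    - by move: y Gky; exact/subsetPset/ndG/leq_maxr.
  by move=> [n _ []/= ? ?]; split; exists n.
move=> k; have [? ?] := Foo k; have [? ?] := Goo k.
split; first exact: measurableX.
by rewrite product_measure1E// lte_mul_pinfty// ge0_fin_numE.
Qed.

Definition tcons (T : Type) n (z : T * n.-tuple T) : n.+1.-tuple T :=
  [tuple of z.1 :: z.2].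

Section tuple_measureS.
Context d (T : measurableType d) (R : realType) (n : nat).
Context (m : {sigma_finite_measure set T -> \bar R}).
Context (mu : {sigma_finite_measure set (n.-tuple T) -> \bar R}).

Definition tuple_measureS : set (n.+1.-tuple T) -> \bar R :=
  pushforward (m \x mu)%E (@tcons T n).
Let nu := tuple_measureS.

Let measurable_preimage_tcons (A : set (n.+1.-tuple T)) :
  measurable A -> measurable (@tcons T n @^-1` A).
Proof.
move=> mA; rewrite -[X in measurable X]setTI.
exact: (measurable_cons measurable_fst measurable_snd).
Qed.

Let nu0 : nu set0 = 0%E.
Proof. by rewrite /nu /tuple_measureS /pushforward preimage_set0 measure0. Qed.

Let nu_ge0 A : (0 <= nu A)%E.
Proof. by rewrite /nu /tuple_measureS /pushforward measure_ge0. Qed.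

Let nu_sigma_additive : semi_sigma_additive nu.
Proof.
move=> F mF tF mUF; rewrite /nu /tuple_measureS /pushforward preimage_bigcup.
apply: measure_semi_sigma_additive.
- by move=> k; exact: measurable_preimage_tcons.
- apply/trivIsetP => /= i j _ _ ij; rewrite -preimage_setI.
  by move/trivIsetP : tF => /(_ _ _ _ _ ij) ->//; rewrite preimage_set0.
- by rewrite -preimage_bigcup; exact: measurable_preimage_tcons.
Qed.

HB.instance Definition _ := isMeasure.Build _ _ _ tuple_measureS nu0 nu_ge0
  nu_sigma_additive.

Let nu_sigma_finite : sigma_finite setT nu.
Proof.
have [F TF mF] := product_measure_sigma_finite m mu.
pose h (t : n.+1.-tuple T) : T * n.-tuple T := (thead t, [tuple of behead t]).
have hK : cancel (@tcons T n) h.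
  by move=> [x t]; rewrite /h /tcons/= theadE; congr (_, _); exact/val_inj.
have mh : measurable_fun setT h.
  apply/measurable_fun_pair => /=; last exact: measurable_behead.
  exact: measurable_tnth.
exists (fun k => h @^-1` F k).
  by rewrite -preimage_bigcup -TF preimage_setT.
move=> k; split.
  by rewrite -[X in measurable X]setTI; apply: mh => //; exact: (mF k).1.
rewrite /nu /tuple_measureS /pushforward -comp_preimage.
rewrite (_ : h \o _ = id) ?preimage_id; first exact: (mF k).2.
by apply/funext => z; exact: hK.
Qed.

HB.instance Definition _ := Measure_isSigmaFinite.Build _ _ _ tuple_measureS
  nu_sigma_finite.

End tuple_measureS.

Fixpoint tuple_measure d (T : measurableType d) (R : realType)
    (m : {sigma_finite_measure set T -> \bar R}) (n : nat) :
    {sigma_finite_measure set (n.-tuple T) -> \bar R} :=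
  if n is k.+1 then tuple_measureS m (tuple_measure m k) else \d_[tuple].

Definition row_of_tuple (R : realType) n (t : n.-tuple (measurableTypeR R)) :
  'rV[R]_n := \row_i tnth t i.

Definition lebesgue_outer (R : realType) n (A : set 'rV[R]_n) : \bar R :=
  ((tuple_measure (@lebesgue_measure R) n)^*)%mu (@row_of_tuple R n @^-1` A).

Section lebesgue_outer_measure.
Context (R : realType) (n : nat).
Let nu := @lebesgue_outer R n.

Let nu0 : nu set0 = 0%E.
Proof. by rewrite /nu /lebesgue_outer preimage_set0 outer_measure0. Qed.

Let nu_ge0 A : (0 <= nu A)%E.
Proof. exact: outer_measure_ge0. Qed.

Let le_nu : {homo nu : A B / A `<=` B >-> (A <= B)%E}.
Proof. by move=> A B AB; apply: le_outer_measure => x; exact: AB. Qed.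

Let nu_sigma_subadditive : sigma_subadditive nu.
Proof.
move=> F; rewrite /nu /lebesgue_outer preimage_bigcup.
exact: outer_measure_sigma_subadditive.
Qed.

HB.instance Definition _ := isOuterMeasure.Build R 'rV[R]_n (@lebesgue_outer R n)
  nu0 nu_ge0 le_nu nu_sigma_subadditive.

End lebesgue_outer_measure.

Definition leb_outer (R : realType) n : {outer_measure set 'rV[R]_n -> \bar R} :=
  @lebesgue_outer R n.

(* The measurable sets of Rn R n are all the Lebesgue measurable sets. *)
Notation Rn R n := (caratheodory_type (leb_outer R n)).

Definition leb (R : realType) n : {measure set (Rn R n) -> \bar R} :=
  leb_outer R n : set (Rn R n) -> \bar R.

Definition is_domain (R : realType) n (Omega : set 'rV[R]_n) : Prop :=
  [/\ open Omega, connected Omega & Omega !=set0].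

(* The library norm of 'rV[R]_n is the sup norm, hence an explicit ball. *)
Definition eball (R : realType) n (x0 : 'rV[R]_n) (r : R) : set 'rV[R]_n :=
  [set x | Num.sqrt (\sum_i (x ord0 i - x0 ord0 i) ^+ 2) < r].

Definition Lloc (R : realType) n (Omega : set 'rV[R]_n) (m : R)
    (w : 'rV[R]_n -> R) : Prop :=
  measurable_fun (Omega : set (Rn R n)) w /\
  forall K : set 'rV[R]_n, compact K -> K `<=` Omega ->
    finite_norm (leb R n) m%:E (w \_ K).

(* A multi-index is given as the list s of the directions of differentiation,
   so that its order is size s. *)
Definition pderiv (R : realType) n (s : seq 'I_n) (phi : 'rV[R]_n -> R) :
    'rV[R]_n -> R :=
  foldr (fun i psi => 'D_(delta_mx ord0 i) psi) phi s.

Definition smooth (R : realType) n (phi : 'rV[R]_n -> R) : Prop :=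
  forall s : seq 'I_n, continuous (pderiv s phi) /\
    forall i x, derivable (pderiv s phi) x (delta_mx ord0 i).

Definition test_function (R : realType) n (Omega : set 'rV[R]_n)
    (phi : 'rV[R]_n -> R) : Prop :=
  [/\ smooth phi, compact (closure [set x | phi x != 0])
    & closure [set x | phi x != 0] `<=` Omega].

Definition weak_deriv (R : realType) n (Omega : set 'rV[R]_n) (s : seq 'I_n)
    (u w : 'rV[R]_n -> R) : Prop :=
  [/\ Lloc Omega 1 u, Lloc Omega 1 w
    & forall phi, test_function Omega phi ->
      \int[leb R n]_(x in Omega) (u x * pderiv s phi x) =
      (- 1) ^+ size s * \int[leb R n]_(x in Omega) (w x * phi x)].

Definition sobolev_loc (R : realType) n (Omega : set 'rV[R]_n) (k : nat) (m : R)
    (u : 'rV[R]_n -> R) : Prop :=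
  Lloc Omega m u /\
  forall s : seq 'I_n, (size s <= k)%N ->
    exists w, weak_deriv Omega s u w /\ Lloc Omega m w.

Definition weak_laplacian (R : realType) n (Omega : set 'rV[R]_n)
    (u L : 'rV[R]_n -> R) : Prop :=
  exists w : 'I_n -> 'rV[R]_n -> R,
    (forall i, weak_deriv Omega [:: i; i] u (w i)) /\
    forall x, L x = \sum_i w i x.

Definition caratheodory_fun (R : realType) n (Omega : set 'rV[R]_n)
    (f : 'rV[R]_n -> R * R -> R) : Prop :=
  {ae leb R n, forall x, Omega x -> continuous (f x)} /\
  forall z : R * R, measurable_fun (Omega : set (Rn R n)) (f ^~ z).

Definition strong_solution (R : realType) n (Omega : set 'rV[R]_n)
    (f g : 'rV[R]_n -> R * R -> R) (u v : 'rV[R]_n -> R) : Prop :=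
  exists Lu Lv, [/\ weak_laplacian Omega u Lu, weak_laplacian Omega v Lv,
    {ae leb R n, forall x, Omega x -> Lu x + f x (u x, v x) = 0}
    & {ae leb R n, forall x, Omega x -> Lv x + g x (u x, v x) = 0}].

(* The little-o is spelled out on extended reals: a real-valued integral would
   be 0 when the integral is infinite. *)
Definition vanishes_infinite_order (R : realType) n (x0 : 'rV[R]_n)
    (u : 'rV[R]_n -> R) : Prop :=
  exists2 eps : R, 0 < eps & forall k : R, 0 < k -> forall c : R, 0 < c ->
    \forall r \near 0^'+,
      (\int[leb R n]_(x in eball x0 r) (`|u x| `^ eps)%:E
         <= (c * r `^ k)%:E)%E.

(* Main.v *)
(* Mollification turns the equation into pointwise statements: if [Delta u = L]
   weakly, the mollified [u] at scale [t] has [t]-derivative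
   [t^(1-n) * integral of L(y) Pk((y-x)/t)], so it converges to a continuous
   representative [ut u], at distance [O(t^2 sup |L|)].

   A Carleman inequality with the weights [|x|^(-2a)], obtained by completing
   squares in the divergence of an explicit vector field, shows that a solution
   with [|L| <= A (|x|/r)^(a-1)] which vanishes to high order at the origin obeys
   [|u| <= c (a+1)^n (r^2 A + M) (|x|/r)^(a-n)], with [c] independent of [a].

   Since [p q > 1], this bound can be iterated through [|Lu| <= C |v|^q] and
   [|Lv| <= C |u|^p]: the exponents grow geometrically, the constants only like
   [Th^((p q)^i)], and so [u] and [v] vanish near every point where they decay to
   all orders. Vanishing in the integral sense gives such a decay at [x0]; on the
   boundary of a ball where [u = v = 0], it follows from the same bound applied
   at centres inside that ball, with [a] large. Hence the set of points near
   which [u = v = 0] is open, closed in [Omega] and nonempty. *)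

From HB Require Import structures.
Require Import Defs.
From mathcomp Require Import all_boot all_order all_algebra.
From mathcomp Require Import all_classical all_reals all_analysis.
From mathcomp Require Import measurable_realfun.
From mathcomp Require Import ring lra.

Set Implicit Arguments.
Unset Strict Implicit.
Unset Printing Implicit Defensive.

Import Order.TTheory GRing.Theory Num.Theory.
Import numFieldNormedType.Exports.

Local Open Scope classical_set_scope.
Local Open Scope ring_scope.

(** * Lebesgue measure on row vectors *)

(** Since [p] or [q] may be below 1, [|Lu| <= C |v|^q] is not dominated by a multiple of the
    solution, and the Carleman inequality cannot absorb its right-hand side in the classical way. It
    serves to exchange orders of vanishing: order [k] of [v] gives order [q k - n] of [u], so that a
    round trip multiplies the order by [p q] and loses [(p + 1) n]. That the constant is polynomial
    in [a] matters: losses of the form [c^a] would add up to [c^(i (p q)^i)] after [i] round trips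
    and defeat the decay.

    The unknowns have only weak derivatives, so the Carleman identity is applied to mollifications,
    at a scale tied to the radius of the hole cut out around the pole. All kernels belong to a
    syntactic class of smooth expressions, which supplies test functions, derivatives and their
    symmetry at once; the only integration by parts is that a derivative of a compactly supported
    function has integral 0.

    Vanishing at [x0] and contact with a ball of zeros both enter through the property [improves],
    from which decay of every order follows by descending through scales of ratio 18. *)

Section tuple_shift.
Context (R : realType).
Let lambda := @lebesgue_measure R.

Lemma lebesgue_measure_shift (a : R) (A : set (measurableTypeR R)) :
  measurable A -> lambda ((+%R^~ a) @^-1` A) = lambda A.
Proof.
move=> mA.
pose f := (+%R^~ a) : measurableTypeR R -> measurableTypeR R.
have mf : measurable_fun setT f by apply: measurable_funD.
rewrite -[LHS]/(pushforward lambda f A).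
apply/esym; apply: lebesgue_measure_unique mA => //.
move=> _ [[x y]] _ <-.
transitivity (lambda (f @^-1` `]x, y]%classic)) => //.
have -> : f @^-1` `]x, y]%classic = `]x - a, y - a]%classic.
  by apply/seteqP; rewrite /f; split => z /=; rewrite !in_itv/= => /andP[? ?];
    apply/andP; split; lra.
rewrite /lambda !lebesgue_measure_itv/= !lte_fin ltrD2r; case: ifPn => // _.
by rewrite -!EFinB; congr (_%:E); lra.
Qed.

(** The shift is a sequence rather than a tuple, so that an induction on [n] can pass to the tail
    with [a \o S]. *)
Definition tshift n (a : nat -> R) (t : n.-tuple (measurableTypeR R)) :
    n.-tuple (measurableTypeR R) := [tuple tnth t i + a i | i < n].

Lemma measurable_tshift n (a : nat -> R) : measurable_fun setT (@tshift n a).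
Proof.
apply/measurable_fun_tnthP => i; rewrite (_ : _ \o _ = (fun t => tnth t i + a i)).
  by apply: measurable_funD => //; exact: measurable_tnth.
by apply/funext => t /=; rewrite tnth_mktuple.
Qed.

Lemma tuple_measure_shift n (a : nat -> R) A : measurable A ->
  tuple_measure lambda n (@tshift n a @^-1` A) = tuple_measure lambda n A.
Proof.
elim: n a A => [|n ih] a A mA.
  by congr (_ _); apply/seteqP; split => t /=; rewrite (tuple0 (tshift a t)) (tuple0 t).
have mt : measurable_fun setT (@tcons (measurableTypeR R) n).
  exact: (measurable_cons measurable_fst measurable_snd).
(* [g] is the same shift seen through head and tail. By uniqueness of the product measure it is
   enough to compare the two sides on products of measurable sets. *)
pose g (z : measurableTypeR R * n.-tuple (measurableTypeR R)) :
  measurableTypeR R * n.-tuple (measurableTypeR R) :=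
  (z.1 + a 0%N, @tshift n (a \o S) z.2).
have mg : measurable_fun setT g.
  apply/measurable_fun_pair => /=.
    by apply: measurable_funD => //; exact: measurable_fst.
  by apply: measurableT_comp; [exact: measurable_tshift|exact: measurable_snd].
rewrite /= /tuple_measureS /pushforward.
have -> : @tcons _ n @^-1` (@tshift n.+1 a @^-1` A) = g @^-1` (@tcons _ n @^-1` A).
  apply/seteqP; rewrite /preimage/=.
  suff E z : tshift a (tcons z) = tcons (g z) by split=> z /=; rewrite E.
  apply: eq_from_tnth => i; rewrite tnth_mktuple.
  case: (unliftP ord0 i) => [j ->|->]; last by rewrite /tcons /= !tnth0.
  by rewrite /tcons !tnthS tnth_mktuple.
have mB : measurable (@tcons _ n @^-1` A) by rewrite -[X in measurable X]setTI; exact: mt.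
rewrite -[LHS]/(pushforward (lambda \x tuple_measure lambda n)%E g _).
apply/esym; apply: product_measure_unique => // B C mBb mC.
transitivity ((lambda \x tuple_measure lambda n)%E
  (((+%R^~ (a 0%N)) @^-1` B) `*` (@tshift n (a \o S) @^-1` C))) => //.
rewrite product_measure1E.
- by congr (_ * _)%E; [exact: lebesgue_measure_shift|exact: ih].
- by rewrite -[X in measurable X]setTI; apply: measurable_funD.
- by rewrite -[X in measurable X]setTI; exact: measurable_tshift.
Qed.

End tuple_shift.


Section measure_preserving.
Context d (T : measurableType d) (R : realType) (mu : {measure set T -> \bar R}).
Variable phi : T -> T.
Hypothesis mphi : measurable_fun setT phi.
Hypothesis mu_phi : forall A, measurable A -> mu (phi @^-1` A) = mu A.

Lemma integrable_comp_preserving (f : T -> \bar R) :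
  mu.-integrable setT f -> mu.-integrable setT (fun x => f (phi x)).
Proof.
move=> /integrableP[mf foo]; apply/integrableP; split.
  exact: (measurableT_comp mf).
apply: le_lt_trans foo.
rewrite -[X in (_ <= X)%E](_ : \int[pushforward mu phi]_x `|f x| = _)%E.
  rewrite ge0_integral_pushforward//.
  by apply: measurableT_comp.
by apply: eq_measure_integral => A mA _; exact: mu_phi.
Qed.

Lemma Rintegral_comp_preserving (f : T -> R) : mu.-integrable setT (EFin \o f) ->
  \int[mu]_x f (phi x) = \int[mu]_x f x.
Proof.
move=> intf; rewrite /Rintegral; congr fine.
rewrite -[RHS](_ : \int[pushforward mu phi]_x (f x)%:E = _)%E.
  rewrite integral_pushforward//.
  - by case/integrableP : intf.
  - exact: (integrable_comp_preserving intf).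
by apply: eq_measure_integral => A mA _; exact: mu_phi.
Qed.

End measure_preserving.

(** * Borel hulls and translation invariance of Lebesgue measure *)

Section leb_basics.
Context (R : realType) (n : nat).
Let mu := tuple_measure (@lebesgue_measure R) n.
Local Notation T := (n.-tuple (measurableTypeR R)).

Definition tuple_of_row (x : 'rV[R]_n) : T := [tuple x ord0 i | i < n].

Lemma tuple_of_rowK : cancel tuple_of_row (@row_of_tuple R n).
Proof. by move=> x; apply/rowP => i; rewrite mxE tnth_mktuple. Qed.

Lemma row_of_tupleK : cancel (@row_of_tuple R n) tuple_of_row.
Proof. by move=> t; apply: eq_from_tnth => i; rewrite tnth_mktuple mxE. Qed.

Lemma row_of_tuple_preimageK (B : set T) :
  @row_of_tuple R n @^-1` (tuple_of_row @^-1` B) = B.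
Proof. by apply/seteqP; split=> t; rewrite /preimage/= row_of_tupleK. Qed.

Lemma measurable_row (B : set T) : measurable B ->
  measurable (tuple_of_row @^-1` B : set (Rn R n)).
Proof.
move=> mB; rewrite /measurable/= => X.
rewrite /leb_outer/= /lebesgue_outer !preimage_setI preimage_setC.
rewrite !row_of_tuple_preimageK.
by apply: (@sub_caratheodory _ _ R mu B); exact: sub_sigma_algebra.
Qed.

Lemma leb_row (B : set T) : measurable B ->
  leb R n (tuple_of_row @^-1` B) = mu B.
Proof.
move=> mB; rewrite /leb/= /leb_outer/= /lebesgue_outer row_of_tuple_preimageK.
exact: measurable_mu_extE.
Qed.

Lemma measurable_coord (i : 'I_n) :
  measurable_fun (setT : set (Rn R n)) (fun x : 'rV[R]_n => x ord0 i).
Proof.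
move=> _ B mB; rewrite setTI.
rewrite (_ : _ @^-1` _ = tuple_of_row @^-1` ((fun t => tnth t i) @^-1` B)).
  apply: measurable_row; rewrite -[X in measurable X]setTI.
  exact: measurable_tnth.
by apply/seteqP; split => x; rewrite /preimage/= tnth_mktuple.
Qed.

(** Intersecting countable covers whose mass is within [1 / (k + 1)] of the outer measure gives a
    Borel hull. It carries statements about Borel sets over to all the measurable sets of [Rn]. *)
Lemma leb_hull (A : set 'rV[R]_n) : (leb_outer R n A < +oo)%E ->
  exists2 B : set T, measurable B &
    A `<=` tuple_of_row @^-1` B /\ mu B = leb_outer R n A.
Proof.
set a := leb_outer R n A => aoo.
have a0 : (0 <= a)%E by exact: outer_measure_ge0.
have afin : a \is a fin_num by rewrite ge0_fin_numE.
have H k : exists B : set T, [/\ measurable B, A `<=` tuple_of_row @^-1` B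
    & (mu B <= a + (k.+1%:R^-1)%:E)%E].
  have : (a < a + (k.+1%:R^-1)%:E)%E by rewrite lteDl// lte_fin invr_gt0.
  rewrite {1}/a /leb_outer/= /lebesgue_outer => /ereal_inf_lt[_ [F [mF cF] <-]] lt.
  exists (\bigcup_k F k); split.
  - exact: bigcupT_measurable.
  - by move=> x Ax; apply: cF; rewrite /preimage/= tuple_of_rowK.
  - apply: le_trans (ltW lt).
    by apply: measure_sigma_subadditive => //; exact: bigcupT_measurable.
pose B k := projT1 (cid (H k)).
have BP k : [/\ measurable (B k), A `<=` tuple_of_row @^-1` (B k)
    & (mu (B k) <= a + (k.+1%:R^-1)%:E)%E] by exact: projT2 (cid (H k)).
have mB : measurable (\bigcap_k B k).
  by apply: bigcapT_measurable => k; case: (BP k).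
exists (\bigcap_k B k) => //; split.
  by move=> x Ax k _; case: (BP k) => _ + _; exact.
apply/eqP; rewrite eq_le; apply/andP; split.
  apply/lee_addgt0Pr => e e0.
  have [k ke] : exists k, k.+1%:R^-1 < e.
    by exists (Num.truncn e^-1); rewrite invf_plt ?posrE// truncnS_gt.
  case: (BP k) => mBk _ leB; apply: le_trans (le_trans leB _).
    by apply: le_measure; rewrite ?inE//; exact: bigcap_inf.
  by rewrite leeD2l// lee_fin ltW.
rewrite -(leb_row mB) /leb/=; apply: le_outer_measure => x Ax k _.
by case: (BP k) => _ + _; exact.
Qed.

Let shift_row (a : 'rV[R]_n) (t : T) : T := tuple_of_row (row_of_tuple t + a).

Let shift_rowE (a : 'rV[R]_n) :
  shift_row a = tshift (fun k => if insub k is Some i then a ord0 i else 0).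
Proof.
apply/funext => t; apply: eq_from_tnth => i.
by rewrite !tnth_mktuple !mxE valK.
Qed.

Let mu_ext_shift_le (a : 'rV[R]_n) (X : set T) :
  ((mu^*)%mu (shift_row a @^-1` X) <= (mu^*)%mu X)%E.
Proof.
apply: le_ereal_inf_tmp => _ [F [mF XF] <-].
apply: ereal_inf_lbound; exists (fun k => shift_row a @^-1` F k).
  split; first by move=> k; rewrite shift_rowE -[X in measurable X]setTI;
    exact: measurable_tshift.
  by move=> t /XF [k _ Fk]; exists k.
by apply: eq_eseriesr => k _; rewrite shift_rowE tuple_measure_shift.
Qed.

(** A cover is translated to a cover of the same mass, which gives one inequality; translating back
    gives the other. As the invariance holds for arbitrary sets, the Caratheodory condition itself
    can be translated. *)
Lemma leb_outer_shift (a : 'rV[R]_n) (A : set 'rV[R]_n) :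
  leb_outer R n ((+%R^~ a) @^-1` A) = leb_outer R n A.
Proof.
rewrite /leb_outer/= /lebesgue_outer.
have E b (B : set 'rV[R]_n) : @row_of_tuple R n @^-1` ((+%R^~ b) @^-1` B) =
    shift_row b @^-1` (@row_of_tuple R n @^-1` B).
  by apply/seteqP; split => t; rewrite /preimage/= tuple_of_rowK.
apply/eqP; rewrite eq_le; apply/andP; split.
  by rewrite E mu_ext_shift_le.
rewrite -[X in ((mu ^*)%mu (_ @^-1` X) <= _)%E](_ : (+%R^~ (-a)) @^-1` ((+%R^~ a) @^-1` A) = A).
  by rewrite [X in ((mu ^*)%mu X <= _)%E]E mu_ext_shift_le.
by apply/seteqP; split => x; rewrite /preimage/= subrK.
Qed.

Lemma measurable_shift (a : 'rV[R]_n) :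
  measurable_fun (setT : set (Rn R n)) ((+%R^~ a) : Rn R n -> Rn R n).
Proof.
move=> _ B mB; rewrite setTI; rewrite /measurable/= in mB *; move=> X.
rewrite -(leb_outer_shift (-a) X) -(leb_outer_shift (-a) (X `&` _)).
rewrite -(leb_outer_shift (-a) (X `&` ~` _)) !preimage_setI preimage_setC.
have E C : (+%R^~ (-a)) @^-1` ((+%R^~ a) @^-1` C) = C :> set 'rV[R]_n.
  by apply/seteqP; split => x; rewrite /preimage/= subrK.
by rewrite !E; exact: mB.
Qed.

Lemma leb_shift (a : 'rV[R]_n) (A : set 'rV[R]_n) :
  leb R n ((+%R^~ a) @^-1` A) = leb R n A.
Proof. exact: leb_outer_shift. Qed.

Lemma integrable_shift (a : 'rV[R]_n) (f : 'rV[R]_n -> \bar R) :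
  (leb R n).-integrable setT f -> (leb R n).-integrable setT (fun x => f (x + a)).
Proof.
apply: (integrable_comp_preserving (measurable_shift a)) => A _.
exact: leb_shift.
Qed.

Lemma Rintegral_shift (a : 'rV[R]_n) (f : 'rV[R]_n -> R) :
  (leb R n).-integrable setT (EFin \o f) ->
  \int[leb R n]_x f (x + a) = \int[leb R n]_x f x.
Proof.
apply: (Rintegral_comp_preserving (measurable_shift a)) => A _.
exact: leb_shift.
Qed.

End leb_basics.


(** * Cubes, and measurability of open sets and continuous functions *)

Section leb_topology.
Context (R : realType) (n : nat).
Local Notation T := (n.-tuple (measurableTypeR R)).
Local Notation V := 'rV[R]_n.

Definition cube (c : V) (r : R) : set V :=
  [set x | forall i, `|x ord0 i - c ord0 i| <= r].

Lemma ball_rowP (x y : V) (e : R) : 0 < e ->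
  ball x e y <-> forall i, `|y ord0 i - x ord0 i| < e.
Proof.
move=> e0; split=> [[_ H] i|H].
  by have := H ord0 i; rewrite /ball/= distrC.
by split=> // i j; rewrite (ord1 i) /ball/= distrC.
Qed.

Lemma norm_rowP (x : V) (e : R) : 0 <= e ->
  `|x| <= e <-> forall i, `|x ord0 i| <= e.
Proof.
move=> e0; rewrite [`|x|]/Num.norm/= mx_normrE; split=> [H i|H].
  by apply: le_trans H; apply/bigmax_geP; right => /=; exists (ord0, i).
by apply/bigmax_leP; split => // -[i j] _ /=; rewrite (ord1 i).
Qed.

Lemma tuple_measure_box k (A : nat -> set (measurableTypeR R)) (v : R) :
  0 <= v -> (forall i, measurable (A i)) ->
  (forall i, lebesgue_measure (A i) = v%:E) ->
  tuple_measure (@lebesgue_measure R) k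
    [set t | forall i : 'I_k, A i (tnth t i)] = (v ^+ k)%:E.
Proof.
elim: k A => [|k ih] A v0 mA lA.
  by rewrite /= diracE mem_set ?expr0//=; case.
rewrite /= /tuple_measureS /pushforward.
set X := _ @^-1` _.
have -> : X = A 0%N `*` [set t : k.-tuple (measurableTypeR R) |
   forall i : 'I_k, (A \o S) i (tnth t i)].
  apply/seteqP; rewrite /X; split => -[x t] /= H.
    split; first by have := H ord0; rewrite /tcons/= tnth0.
    by move=> i; have := H (lift ord0 i); rewrite /tcons/= tnthS.
  by case: H => H1 H2 i; case: (unliftP ord0 i) => [j ->|->];
    rewrite /tcons ?tnthS ?tnth0 //; exact: H2.
rewrite product_measure1E//.
  rewrite [X in (X * _ = _)%E](lA 0%N) [X in (_ * X = _)%E](ih (A \o S)) //.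
  - by rewrite exprS EFinM.
  - by move=> i; exact: mA.
  - by move=> i; exact: lA.
have -> : [set t : k.-tuple (measurableTypeR R) | forall i : 'I_k, (A \o S) i (tnth t i)] =
  \bigcap_(i in [set: 'I_k]) ((fun t => tnth t i) @^-1` A i.+1).
  by apply/seteqP; split => [t H i _|t H i]; [exact: H|exact: (H i I)].
apply: fin_bigcap_measurable => [|i _]; first exact: finite_finset.
by rewrite -[X in measurable X]setTI; exact: measurable_tnth.
Qed.

Lemma measurable_cube (c : V) (r : R) : measurable (cube c r : set (Rn R n)).
Proof.
have -> : cube c r = \bigcap_(i in [set: 'I_n])
    ((fun x : V => x ord0 i) @^-1` `[c ord0 i - r, c ord0 i + r]%classic).
  apply/seteqP; split => [x H i _|x H i].
    by have := H i; rewrite /= in_itv/= ler_distl.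
  by have := H i I; rewrite /= in_itv/= ler_distl.
apply: fin_bigcap_measurable => [|i _]; first exact: finite_finset.
by rewrite -[X in measurable X]setTI; exact: measurable_coord.
Qed.

Lemma leb_cube (c : V) (r : R) : 0 <= r -> leb R n (cube c r) = ((2 * r) ^+ n)%:E.
Proof.
move=> r0.
pose A k : set (measurableTypeR R) := let a := if insub k is Some i then c ord0 i else 0 in
   `[a - r, a + r]%classic.
have mA k : measurable (A k) by exact: measurable_itv.
have lA k : lebesgue_measure (A k) = (2 * r)%:E.
  rewrite /A lebesgue_measure_itv/= lte_fin; case: ifPn => h.
    by rewrite -EFinB; congr (_%:E); lra.
  by congr (_%:E); lra.
have r20 : 0 <= 2 * r by lra.
rewrite -(tuple_measure_box n r20 mA lA) -leb_row; last first.
  have -> : [set t : T | forall i : 'I_n, A i (tnth t i)] =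
  \bigcap_(i in [set: 'I_n]) ((fun t => tnth t i) @^-1` A i).
  by apply/seteqP; split => [t H i _|t H i]; [exact: H|exact: (H i I)].
  apply: fin_bigcap_measurable => [|i _]; first exact: finite_finset.
  by rewrite -[X in measurable X]setTI; exact: measurable_tnth.
congr (_ _); apply/seteqP; split => x /= H i; have := H i;
  by rewrite tnth_mktuple /A valK/= in_itv/= ler_distl.
Qed.

Lemma closed_cube (c : V) (r : R) : closed (cube c r).
Proof.
have -> : cube c r = \bigcap_(i in [set: 'I_n])
    ((fun x : V => x ord0 i) @^-1` `[c ord0 i - r, c ord0 i + r]%classic).
  apply/seteqP; split => [x H i _|x H i].
    by have := H i; rewrite /= in_itv/= ler_distl.
  by have := H i I; rewrite /= in_itv/= ler_distl.
apply: closed_bigI => i _; apply: closed_comp; last exact: itv_closed.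
by move=> x _; exact: coord_continuous.
Qed.

Lemma compact_cube (c : V) (r : R) : compact (cube c r).
Proof.
apply: bounded_closed_compact; last exact: closed_cube.
exists (`|c| + `|r|); split; first exact: num_real.
move=> M ltM x cx; apply/norm_rowP.
  by apply: ltW; apply: le_lt_trans ltM; rewrite addr_ge0.
move=> i; apply: ltW; apply: le_lt_trans ltM.
rewrite -(subrK (c ord0 i) (x ord0 i)) addrC (le_trans (ler_normD _ _))//.
rewrite lerD//; last by apply: le_trans (cx i) _; exact: ler_norm.
by have /norm_rowP := lexx `|c|; apply.
Qed.

Lemma continuous_cube_bounded (G : V -> R) (c : V) (r : R) : continuous G ->
  exists M, 0 < M /\ forall x, cube c r x -> `|G x| <= M.
Proof.
move=> cG.
have : compact (G @` cube c r).
  by apply: continuous_compact; [exact: continuous_subspaceT|exact: compact_cube].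
move/compact_bounded => [M [_ HM]]; exists (`|M| + 1); split.
  by rewrite ltr_wpDl.
move=> x cx; apply: (HM (`|M| + 1)); last by exists x.
by rewrite (le_lt_trans (ler_norm M))// ltrDl.
Qed.

(** An open set is the union of those cubes with rational centre and radius [1 / (k + 1)] that it
    contains, and there are countably many of them. *)
Lemma open_measurable_row (O : set V) : open O -> measurable (O : set (Rn R n)).
Proof.
move=> oO.
pose F (z : 'rV[rat]_n * nat) : set (Rn R n) :=
  let C := cube (map_mx ratr z.1) (z.2.+1%:R^-1) in
  if pselect (C `<=` O) then C else set0.
have -> : O = \bigcup_z F z.
  apply/seteqP; split => [x Ox|x [z _]]; last first.
    by rewrite /F; case: pselect => // CO; exact: CO.
  have /nbhs_ballP[e /= e0 eO] := open_nbhs_nbhs (conj oO Ox).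
  have e20 : 0 < e / 2 by rewrite divr_gt0.
  pose k := Num.truncn (e / 2)^-1.
  have ke : k.+1%:R^-1 < e / 2 by rewrite invf_plt ?posrE// truncnS_gt.
  have k0 : 0 < k.+1%:R^-1 :> R by rewrite invr_gt0.
  have H i : exists q : rat, ratr q \in `]x ord0 i - k.+1%:R^-1, x ord0 i + k.+1%:R^-1[.
    by apply: rat_in_itvoo; rewrite ltrBlDr -addrA ltrDl addr_gt0.
  pose q : 'rV[rat]_n := \row_i projT1 (cid (H i)).
  have qP i : `|x ord0 i - ratr (q ord0 i)| < k.+1%:R^-1.
    by rewrite mxE; case: cid => a/=; rewrite in_itv/= distrC ltr_distl.
  exists (q, k) => //; rewrite /F; case: pselect => [_|[]] /=.
    by move=> i; rewrite mxE; exact: ltW.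
  move=> y Cy; apply: eO; apply/ball_rowP => // i.
  have := Cy i; rewrite mxE => Cyi; have := qP i.
  rewrite (_ : y ord0 i - x ord0 i = (y ord0 i - ratr (q ord0 i)) - (x ord0 i - ratr (q ord0 i))); last by ring.
  move=> qi; apply: le_lt_trans (ler_normB _ _) _.
  by rewrite (splitr e) ler_ltD ?(le_trans Cyi) ?(ltW ke)// (lt_trans qi).
apply: countable_bigcupT_measurable; first exact: countableP.
by move=> z; rewrite /F; case: (pselect _) => ? /=; [exact: measurable_cube|].
Qed.

Lemma continuous_measurable_row (f : V -> R) : continuous f ->
  measurable_fun (setT : set (Rn R n)) f.
Proof.
move=> /continuousP cf; apply: (measurability _ (RGenOpens.measurableE R)).
move=> _ [_ [a [b ->] <-]]; rewrite setTI; apply: open_measurable_row.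
exact/cf/interval_open.
Qed.

End leb_topology.


Section integral_support.
Context d (T : measurableType d) (R : realType) (mu : {measure set T -> \bar R}).
Variable D : set T.
Hypotheses (mD : measurable D) (Dfin : (mu D < +oo)%E).

Lemma integrable_indic_fin :
  mu.-integrable setT (fun x : T => (\1_D x)%:E).
Proof.
apply/integrableP; split; first exact/measurable_EFinP/measurable_indic.
rewrite (eq_integral (fun x => (\1_D x)%:E)); last first.
  by move=> t _; rewrite gee0_abs// lee_fin.
by rewrite integral_indic// setIT.
Qed.

Lemma integrable_bounded_support (f : T -> R) (M : R) :
  measurable_fun setT f -> (forall x, `|f x| <= M) ->
  (forall x, ~ D x -> f x = 0) -> mu.-integrable setT (EFin \o f).
Proof.
move=> mf fM f0.
have intM : mu.-integrable setT (EFin \o (fun x => M * \1_D x)).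
  have -> : EFin \o (fun x => M * \1_D x) = (fun x => M%:E * (\1_D x)%:E)%E.
    by apply/funext => x; rewrite /= EFinM.
  by apply: integrableZl => //; exact: integrable_indic_fin.
apply: le_integrable intM => //; first exact/measurable_EFinP.
move=> x _ /=; rewrite lee_fin; have [Dx|nDx] := pselect (D x).
  by rewrite indicE mem_set// mulr1 (le_trans (fM x))// ler_norm.
by rewrite f0// normr0.
Qed.

Lemma Rintegral_le_support (f : T -> R) (M : R) :
  mu.-integrable setT (EFin \o f) -> (forall x, D x -> f x <= M) ->
  (forall x, ~ D x -> f x <= 0) -> \int[mu]_x f x <= M * fine (mu D).
Proof.
move=> intf fM f0.
have intM : mu.-integrable setT (EFin \o (fun x => M * \1_D x)).
  have -> : EFin \o (fun x => M * \1_D x) = (fun x => M%:E * (\1_D x)%:E)%E.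
    by apply/funext => x; rewrite /= EFinM.
  by apply: integrableZl => //; exact: integrable_indic_fin.
apply: (@le_trans _ _ (\int[mu]_x (M * \1_D x))).
  apply: le_Rintegral => // x _; rewrite indicE; have [Dx|nDx] := pselect (D x).
    by rewrite mem_set// mulr1 fM.
  by rewrite memNset// mulr0 f0.
rewrite RintegralZl//; last exact: integrable_indic_fin.
by rewrite /Rintegral integral_indic// setIT.
Qed.

End integral_support.

Section integral_misc.
Context d (T : measurableType d) (R : realType) (mu : {measure set T -> \bar R}).

Lemma integrable_mul_bounded (u F : T -> R) (M : R) :
  mu.-integrable setT (EFin \o u) -> measurable_fun setT F ->
  (forall x, `|F x| <= M) -> mu.-integrable setT (EFin \o (fun x => u x * F x)).
Proof.
move=> intu mF FM.
have M0 (x : T) : 0 <= M by exact: le_trans (normr_ge0 _) (FM x).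
have intM : mu.-integrable setT (EFin \o (fun x => M * u x)).
  have -> : EFin \o (fun x => M * u x) = (fun x => M%:E * (u x)%:E)%E.
    by apply/funext => x; rewrite /= EFinM.
  exact: integrableZl.
apply: le_integrable intM => //.
  apply/measurable_EFinP; apply: measurable_funM => //.
  by apply/measurable_EFinP; case/integrableP : intu.
move=> x _ /=; rewrite lee_fin !normrM mulrC (ger0_norm (M0 x)).
by rewrite ler_wpM2r.
Qed.

Lemma integrable_norm (u : T -> R) :
  mu.-integrable setT (EFin \o u) -> mu.-integrable setT (EFin \o (fun x => `|u x|)).
Proof. exact: integrable_abse. Qed.

Lemma integrable_scale (u : T -> R) (k : R) :
  mu.-integrable setT (EFin \o u) -> mu.-integrable setT (EFin \o (fun x => k * u x)).
Proof.
move=> intu; have -> : EFin \o (fun x => k * u x) = (fun x => k%:E * (u x)%:E)%E.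
  by apply/funext => x; rewrite /= EFinM.
exact: integrableZl.
Qed.

Lemma integrable_add (u v : T -> R) :
  mu.-integrable setT (EFin \o u) -> mu.-integrable setT (EFin \o v) ->
  mu.-integrable setT (EFin \o (fun x => u x + v x)).
Proof.
move=> intu intv.
have -> : EFin \o (fun x => u x + v x) = (fun x => (u x)%:E + (v x)%:E)%E.
  by apply/funext => x; rewrite /= EFinD.
exact: integrableD.
Qed.

Lemma integrable_sub (u v : T -> R) :
  mu.-integrable setT (EFin \o u) -> mu.-integrable setT (EFin \o v) ->
  mu.-integrable setT (EFin \o (fun x => u x - v x)).
Proof.
move=> intu intv.
have -> : EFin \o (fun x => u x - v x) = (fun x => (u x)%:E - (v x)%:E)%E.
  by apply/funext => x; rewrite /= EFinB.
exact: integrableB.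
Qed.

Lemma integrable_sum (I : Type) (s : seq I) (u : I -> T -> R) :
  (forall i, mu.-integrable setT (EFin \o u i)) ->
  mu.-integrable setT (EFin \o (fun x => \sum_(i <- s) u i x)).
Proof.
move=> intu; elim: s => [|i s ih].
  under eq_fun do rewrite big_nil.
  by rewrite (_ : EFin \o _ = cst 0%E)//; exact: integrable0.
by under eq_fun do rewrite big_cons; exact: integrable_add.
Qed.

Lemma Rintegral_sum (I : Type) (s : seq I) (u : I -> T -> R) :
  (forall i, mu.-integrable setT (EFin \o u i)) ->
  \int[mu]_x (\sum_(i <- s) u i x) = \sum_(i <- s) \int[mu]_x u i x.
Proof.
move=> intu; elim: s => [|i s ih].
  under eq_Rintegral do rewrite big_nil.
  by rewrite big_nil /Rintegral integral0.
under eq_Rintegral do rewrite big_cons.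
by rewrite RintegralD//; [rewrite ih big_cons|exact: integrable_sum].
Qed.

Lemma ae_eq_Rintegral (f g : T -> R) : measurable_fun setT f -> measurable_fun setT g ->
  {ae mu, forall x, f x = g x} -> \int[mu]_x f x = \int[mu]_x g x.
Proof.
move=> mf mg fg; rewrite /Rintegral; congr fine; apply: ae_eq_integral => //.
- exact/measurable_EFinP.
- exact/measurable_EFinP.
- by apply: filterS fg => x /= -> _.
Qed.

Lemma dominated_Rintegral_cvg (f_ : nat -> T -> R) (f g : T -> R) :
  (forall k, measurable_fun setT (f_ k)) ->
  (forall x, f_ ^~ x @ \oo --> f x) ->
  mu.-integrable setT (EFin \o g) -> (forall k x, `|f_ k x| <= g x) ->
  \int[mu]_x f_ k x @[k --> \oo] --> \int[mu]_x f x.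
Proof.
move=> mf ff intg fg.
have H : (\int[mu]_x (f_ k x)%:E @[k --> \oo] --> \int[mu]_x (f x)%:E)%E.
  apply: (@dominated_cvg _ _ _ mu setT measurableT (fun k x => (f_ k x)%:E) (EFin \o f) (EFin \o g)) => //.
  - by move=> k; apply/measurable_EFinP.
  - by move=> x _; apply/fine_cvgP; split; [exact: nearW|exact: ff].
  - by move=> k x _ /=; rewrite lee_fin.
have mff : measurable_fun setT f.
  by apply: (measurable_fun_cvg (h := f_)) => // x _; exact: ff.
have intf : mu.-integrable setT (EFin \o f).
  apply: le_integrable intg => //; first exact/measurable_EFinP.
  move=> x _ /=; rewrite lee_fin (@le_trans _ _ (g x)) ?ler_norm//.
  have cv : `|f_ k x| @[k --> \oo] --> `|f x| by apply: cvg_norm; exact: ff.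
  rewrite -(cvg_lim _ cv)//; apply: limr_le; first by apply/cvg_ex; exists `|f x|.
  exact: nearW.
have : ((fine \o (fun k => \int[mu]_x (f_ k x)%:E)%E) k @[k --> \oo] --> \int[mu]_x f x).
  by apply: fine_cvg; rewrite /Rintegral fineK//; apply: integrable_fin_num.
by [].
Qed.

End integral_misc.

(** * Integration by parts for compactly supported functions *)

Section derivative_line.
Context (R : realType) (n : nat).
Local Notation V := 'rV[R]_n.

Lemma is_derive_line (F G : V -> R) (x v : V) (t : R) :
  is_derive (x + t *: v) v F (G (x + t *: v)) ->
  is_derive t (1 : R) (fun s => F (x + s *: v)) (G (x + t *: v)).
Proof.
move=> [dF <-].
have E : (fun h : R => h^-1 *: ((F (x + (h *: (1:R) + t) *: v) : R^o) - F (x + t *: v))) =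
  (fun h : R => h^-1 *: ((F (h *: v + (x + t *: v)) : R^o) - F (x + t *: v))).
  by apply/funext => h; rewrite [h *: 1]mulr1 scalerDl addrCA addrA.
apply: DeriveDef.
  by rewrite /derivable E.
by rewrite /derive E.
Qed.

Lemma le_line_derive (F G : V -> R) (x v : V) (M h : R) : 0 < h ->
  (forall y, is_derive y v F (G y)) -> (forall s, 0 <= s <= h -> `|G (x + s *: v)| <= M) ->
  `|F (x + h *: v) - F x| <= M * h.
Proof.
move=> h0 dF GM.
have dl t : is_derive t (1 : R) (fun s => F (x + s *: v)) (G (x + t *: v)).
  exact: is_derive_line.
have cl : {within `[0, h], continuous (fun s => F (x + s *: v))}.
  apply: continuous_subspaceT => t; apply: differentiable_continuous.
  by apply/derivable1_diffP; case: (dl t).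
have [c c0h E] := @MVT_segment R (fun s => F (x + s *: v)) _ 0 h (ltW h0)
  (fun t _ => dl t) cl.
move: E; rewrite scale0r addr0 subr0 => ->; rewrite normrM (gtr0_norm h0).
rewrite ler_wpM2r ?(ltW h0)//; apply: GM; by move: c0h; rewrite in_itv.
Qed.

End derivative_line.


Section integration_by_parts.
Context (R : realType) (n : nat).
Local Notation V := 'rV[R]_n.

Lemma leb_cube_fin (c : V) (r : R) : (leb R n (cube c r) < +oo)%E.
Proof.
have [r0|r0] := leP 0 r; first by rewrite leb_cube// ltry.
apply: (@le_lt_trans _ _ (leb R n (cube c 0))); last by rewrite leb_cube// ltry.
apply: le_measure; rewrite ?inE; [exact: measurable_cube..|].
by move=> x H i; apply: le_trans (H i) (ltW r0).
Qed.

Lemma continuous_support_bounded (f : V -> R) (c : V) (r : R) : continuous f ->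
  (forall x, ~ cube c r x -> f x = 0) -> exists M, 0 < M /\ forall x, `|f x| <= M.
Proof.
move=> cf f0; have [M [M0 HM]] := continuous_cube_bounded c r cf.
exists M; split=> // x; have [/HM//|/f0 ->] := pselect (cube c r x).
by rewrite normr0 ltW.
Qed.

Lemma integrable_continuous (f : V -> R) (c : V) (r : R) : continuous f ->
  (forall x, ~ cube c r x -> f x = 0) -> (leb R n).-integrable setT (EFin \o f).
Proof.
move=> cf f0; have [M [M0 HM]] := continuous_support_bounded cf f0.
apply: (integrable_bounded_support (measurable_cube c r) (leb_cube_fin c r) _ HM) f0.
exact: continuous_measurable_row.
Qed.

Lemma Rintegral_le_cube (f : V -> R) (M r : R) (c : V) : 0 <= r ->
  (leb R n).-integrable setT (EFin \o f) -> (forall x, cube c r x -> f x <= M) ->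
  (forall x, ~ cube c r x -> f x <= 0) -> \int[leb R n]_x f x <= M * (2 * r) ^+ n.
Proof.
move=> r0 intf fM f0.
have := Rintegral_le_support (measurable_cube c r) (leb_cube_fin c r) intf fM f0.
by rewrite leb_cube.
Qed.

(* Translation invariance makes the integral of each difference quotient of
   [F] vanish. *)
Lemma Rintegral_derive0 (F G : V -> R) (v c : V) (r : R) :
  continuous F -> continuous G -> (forall x, is_derive x v F (G x)) ->
  (forall x, ~ cube c r x -> F x = 0) -> \int[leb R n]_x G x = 0.
Proof.
move=> cF cG dF F0.
have intF := integrable_continuous cF F0.
(* For steps at most 1 the difference quotients vanish off the cube of radius [r'], and the mean
   value theorem evaluates [G] in that cube enlarged once more. This yields the dominating
   function. *)
set r' := r + `|v|.
have [M [M0 HM]] := continuous_cube_bounded c (r' + `|v|) cG.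
pose h (k : nat) : R := k.+1%:R^-1.
have h0 k : 0 < h k by rewrite invr_gt0.
have h1 k : h k <= 1 by rewrite invf_le1// ler1n.
pose g k (x : V) := (h k)^-1 * (F (x + h k *: v) - F x).
have vi i : `|v ord0 i| <= `|v| by have /norm_rowP := lexx `|v|; apply.
have cubeS x s : cube c r (x + s *: v) -> 0 <= s <= 1 -> cube c r' x.
  move=> H /andP[s0 s1] i; have := H i; rewrite !mxE => Hi.
  rewrite (_ : x ord0 i - c ord0 i = (x ord0 i + s * v ord0 i - c ord0 i) - s * v ord0 i); last by ring.
  apply: (le_trans (ler_normB _ _)); rewrite lerD// normrM ger0_norm//.
  by rewrite (le_trans _ (vi i))// ler_piMl.
have cubeS' x s : cube c r' x -> 0 <= s <= 1 -> cube c (r' + `|v|) (x + s *: v).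
  move=> H /andP[s0 s1] i; have := H i; rewrite !mxE => Hi.
  rewrite (_ : x ord0 i + s * v ord0 i - c ord0 i = (x ord0 i - c ord0 i) + s * v ord0 i); last by ring.
  apply: (le_trans (ler_normD _ _)); rewrite lerD// normrM ger0_norm//.
  by rewrite (le_trans _ (vi i))// ler_piMl.
have intg k : (leb R n).-integrable setT (EFin \o g k).
  apply: integrable_scale; apply: integrable_sub => //.
  exact: (integrable_shift (h k *: v) intF).
have g0 k : \int[leb R n]_x g k x = 0.
  rewrite RintegralZl//; last first.
    apply: integrable_sub => //; exact: (integrable_shift (h k *: v) intF).
  rewrite RintegralB//; last exact: (integrable_shift (h k *: v) intF).
  by rewrite Rintegral_shift// subrr mulr0.
have gM k x : `|g k x| <= M * \1_(cube c r') x.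
  rewrite indicE; have [cx|ncx] := pselect (cube c r' x).
    rewrite mem_set// mulr1 /g normrM gtr0_norm ?invr_gt0// mulrC ler_pdivrMr//.
    apply: (@le_line_derive _ _ F G) => // s /andP[s0 sh]; apply: HM.
    by apply: cubeS' => //; rewrite s0/= (le_trans sh).
  rewrite memNset// mulr0 /g !F0 ?subrr ?mulr0 ?normr0//.
    by move=> H; apply: ncx; apply: (cubeS x 0); rewrite ?scale0r ?addr0// lexx ler01.
  by move=> H; apply: ncx; apply: (cubeS x (h k)); rewrite // (ltW (h0 k)) h1.
have gG x : g ^~ x @ \oo --> G x.
  have [dFx dE] := dF x.
  have /cvgr_dnbhsP/(_ h) H : h0^-1 *: ((F (h0 *: v + x) : R^o) - F x) @[h0 --> (0 : R)^'] --> G x.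
    by rewrite -dE; exact: dFx.
  have {}H := H (conj (fun k => lt0r_neq0 (h0 k)) cvg_harmonic).
  apply: cvg_trans H; apply: near_eq_cvg; apply: nearW => k /=.
  by rewrite /g [x + _]addrC.
have cv : \int[leb R n]_x g k x @[k --> \oo] --> \int[leb R n]_x G x.
  have mg k : measurable_fun (setT : set (Rn R n)) (g k).
    by apply/measurable_EFinP; case/integrableP : (intg k).
  have intM : (leb R n).-integrable setT (EFin \o (fun x => M * \1_(cube c r') x)).
    by apply: integrable_scale; apply: integrable_indic_fin; [exact: measurable_cube|exact: leb_cube_fin].
  exact: (dominated_Rintegral_cvg mg gG intM gM).
have cv0 : \int[leb R n]_x g k x @[k --> \oo] --> (0 : R).
  by under eq_cvg do rewrite g0; exact: cvg_cst.
by rewrite -(cvg_lim _ cv)// (cvg_lim _ cv0).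
Qed.

End integration_by_parts.


(** * Smooth functions and mollification *)

Section derivative_along_lines.
Context (R : realType) (n : nat).
Local Notation V := 'rV[R]_n.

Lemma is_derive_of_line (F : V -> R) (x v : V) (d : R) :
  is_derive (0 : R) (1 : R) (fun s => F (x + s *: v)) d -> is_derive x v F d.
Proof.
move=> [dF <-].
have E : (fun h : R => h^-1 *: ((F (h *: v + x) : R^o) - F x)) =
  (fun h : R => h^-1 *: ((F (x + (h *: (1:R) + 0) *: v) : R^o) - F (x + 0 *: v))).
  by apply/funext => h; rewrite [h *: 1]mulr1 scale0r !addr0 [h *: v + x]addrC.
apply: DeriveDef.
  by rewrite /derivable E; exact: dF.
by rewrite /derive E.
Qed.

End derivative_along_lines.

Section derivative_rules.
Context (R : realType) (V : normedModType R).
Implicit Types (f g : V -> R) (x v : V).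

Lemma is_derive_add f g x v (a b : R) : is_derive x v f a -> is_derive x v g b ->
  is_derive x v (fun y => f y + g y) (a + b).
Proof. by move=> df dg; exact: is_deriveD. Qed.

Lemma is_derive_opp f x v (a : R) : is_derive x v f a ->
  is_derive x v (fun y => - f y) (- a).
Proof. by move=> df; exact: is_deriveN. Qed.

Lemma is_derive_mul f g x v (a b : R) : is_derive x v f a -> is_derive x v g b ->
  is_derive x v (fun y => f y * g y) (a * g x + f x * b).
Proof.
move=> df dg; have : is_derive x v (f * g) (f x *: b + g x *: a) by exact: is_deriveM.
by rewrite addrC [g x *: _]mulrC.
Qed.

Lemma is_derive_scale f x v (a k : R) : is_derive x v f a ->
  is_derive x v (fun y => k * f y) (k * a).
Proof.
move=> df; have dk : is_derive x v (fun=> k) 0 by exact: is_derive_cst.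
by have := is_derive_mul dk df; rewrite mul0r add0r.
Qed.

Lemma is_derive_exp f x v (a : R) m : is_derive x v f a ->
  is_derive x v (fun y => f y ^+ m) (m%:R * f x ^+ m.-1 * a).
Proof.
move=> df; have -> : (fun y => f y ^+ m) = f ^+ m by rewrite exprfctE.
exact: is_deriveX.
Qed.

Lemma is_derive_bigsum (I : Type) (s : seq I) (f : I -> V -> R) x v (a : I -> R) :
  (forall i, is_derive x v (f i) (a i)) ->
  is_derive x v (fun y => \sum_(i <- s) f i y) (\sum_(i <- s) a i).
Proof.
move=> df; elim: s => [|i s ih].
  by under eq_fun do rewrite big_nil; rewrite big_nil; exact: is_derive_cst.
by under eq_fun do rewrite big_cons; rewrite big_cons; exact: is_derive_add.
Qed.

End derivative_rules.

Section continuity_rules.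
Context (R : realType) (T : topologicalType).
Implicit Types (f g : T -> R).

Lemma continuous_cst (k : R) : continuous (fun _ : T => k).
Proof. by move=> x; exact: cst_continuous. Qed.

Lemma continuous_add f g : continuous f -> continuous g ->
  continuous (fun y => f y + g y).
Proof. by move=> cf cg x; apply: continuousD; [exact: cf|exact: cg]. Qed.

Lemma continuous_opp f : continuous f -> continuous (fun y => - f y).
Proof. by move=> cf x; apply: continuousN; exact: cf. Qed.

Lemma continuous_mul f g : continuous f -> continuous g ->
  continuous (fun y => f y * g y).
Proof. by move=> cf cg x; apply: continuousM; [exact: cf|exact: cg]. Qed.

Lemma continuous_scale (k : R) f : continuous f -> continuous (fun y => k * f y).
Proof. by move=> cf; apply: continuous_mul => //; exact: continuous_cst. Qed.

Lemma continuous_exp f m : continuous f -> continuous (fun y => f y ^+ m).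
Proof.
move=> cf; elim: m => [|m ih].
  by under eq_fun do rewrite expr0; exact: continuous_cst.
by under eq_fun do rewrite exprS; exact: continuous_mul.
Qed.

Lemma continuous_sum (I : Type) (s : seq I) (f : I -> T -> R) :
  (forall i, continuous (f i)) -> continuous (fun y => \sum_(i <- s) f i y).
Proof.
move=> cf; elim: s => [|i s ih].
  by under eq_fun do rewrite big_nil; exact: continuous_cst.
by under eq_fun do rewrite big_cons; exact: continuous_add.
Qed.

Lemma continuous_inv f : continuous f -> (forall y, f y != 0) ->
  continuous (fun y => (f y)^-1).
Proof. by move=> cf f0 x; apply: cvgV => //; exact: cf. Qed.

End continuity_rules.

(** * Flat exponentials and smooth expressions *)

Section flat_exponential.
Context (R : realType).
Implicit Types (t s : R) (k : nat).

(** Carrying the power [t^(-k)] along makes the family closed under differentiation: the derivative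
    combines the indices [k + 2] and [k + 1], which is the rule used by [dd]. *)
Definition th k t : R := if 0 < t then t^-1 ^+ k * expR (- t^-1) else 0.

Lemma th_gt0 k t : 0 < t -> 0 < th k t.
Proof. by move=> t0; rewrite /th t0 mulr_gt0 ?exprn_gt0 ?invr_gt0// expR_gt0. Qed.

Lemma th_ge0 k t : 0 <= th k t.
Proof. by have [/th_gt0/ltW//|t0] := ltP 0 t; rewrite /th ltNge t0. Qed.

Lemma th_le0 k t : t <= 0 -> th k t = 0.
Proof. by move=> t0; rewrite /th ltNge t0. Qed.

(** This is [1 + s / m <= exp (s / m)] raised to the power [m]. *)
Lemma le_expr_expR m s : 0 <= s -> s ^+ m <= m%:R ^+ m * expR s.
Proof.
case: m => [|m] s0; first by rewrite !expr0 mul1r -expR0 ler_expR.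
have m0 : 0 < m.+1%:R :> R by [].
rewrite -(divfK (lt0r_neq0 m0) s) expRM_natr -exprMn [m.+1%:R * _]mulrC.
rewrite lerXn2r ?nnegrE ?mulr_ge0 ?divr_ge0 ?expR_ge0//.
by rewrite ler_wpM2r// (le_trans _ (expR_ge1Dx _))// ?lerDr.
Qed.

(** A quadratic bound makes the difference quotient at 0 tend to 0, which is the only delicate point
    in differentiating [th]. *)
Lemma th_le_sqr k t : th k t <= (k.+2)%:R ^+ k.+2 * t ^+ 2.
Proof.
have [t0|t0] := ltP 0 t; last by rewrite th_le0// mulr_ge0 ?sqr_ge0 ?exprn_ge0.
rewrite /th t0 expRN.
have e0 : 0 < expR t^-1 by exact: expR_gt0.
have := @le_expr_expR k.+2 t^-1; rewrite ltW ?invr_gt0// => /(_ isT) H.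
rewrite ler_pdivrMr// -mulrA [t ^+ 2 * _]mulrC mulrA -ler_pdivrMr ?exprn_gt0//.
by rewrite -exprVn -exprD addn2.
Qed.

Lemma is_derive_th k t : is_derive t (1 : R) (th k) (th k.+2 t - k%:R * th k.+1 t).
Proof.
have [t0|t0|<-] := ltgtP 0 t.
- have tn0 : t != 0 by rewrite gt_eqF.
  pose f s : R := s^-1 ^+ k * expR (- s^-1).
  have fE : {near t, f =1 th k}.
    near=> s; rewrite /th /f.
    have -> // : 0 < s by near: s; exact: lt_nbhsr.
  apply: (near_eq_is_derive fE).
  rewrite /f /th t0.
  have dV : is_derive t (1 : R) (fun s : R => s^-1) (- t ^- 2).
    have := is_deriveV tn0 (is_derive_id t (1 : R)); rewrite /= [X in is_derive _ _ _ X]mulr1.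
    by [].
  have dE : is_derive t (1 : R) (fun s : R => expR (- s^-1)) (expR (- t^-1) * - - t ^- 2).
    exact: (is_derive1_comp (is_derive_expR _) (is_derive_opp dV)).
  have H := is_derive_mul (is_derive_exp k dV) dE.
  move: H; rewrite /=; set D := (X in is_derive _ _ _ X) => H.
  suff -> : t^-1 ^+ k.+2 * expR (- t^-1) - k%:R * (t^-1 ^+ k.+1 * expR (- t^-1)) = D by [].
  rewrite /D.
  rewrite -exprVn; move: (t^-1) (expR _) => w e.
  by case: k {f fE D H} => [|k] /=; rewrite ?exprS ?expr0; ring.
- have fE : {near t, cst 0 =1 th k}.
    near=> s; rewrite th_le0//=.
    by apply: ltW; near: s; exact: lt_nbhsl.
  apply: (near_eq_is_derive fE).
  rewrite !th_le0 ?(ltW t0)// mulr0 subr0; exact: is_derive_cst.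
- rewrite !th_le0// mulr0 subr0.
  have H : h^-1 *: ((th k (h *: (1:R) + 0) : R^o) - th k 0) @[h --> (0 : R)^'] --> (0 : R).
    have K0 : k.+2%:R ^+ k.+2 * `|h| @[h --> (0 : R)^'] --> (0 : R).
      rewrite -[X in _ --> X](mulr0 (k.+2%:R ^+ k.+2 : R)).
      apply: cvgMr; rewrite -[X in _ --> X](normr0 R); apply: cvg_norm.
      exact: cvg_within.
    apply: (@squeeze_cvgr _ _ _ _ (fun h => - (k.+2%:R ^+ k.+2 * `|h|)) (fun h => k.+2%:R ^+ k.+2 * `|h|)).
    - near=> h; have h0 : h != 0 by near: h; exact: nbhs_dnbhs_neq.
      rewrite (th_le0 _ (lexx 0)) subr0 addr0 [h *: 1]mulr1 -ler_norml [_ *: _]mulrC.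
      rewrite normrM normfV ler_pdivrMr ?normr_gt0// -mulrA -expr2 real_normK ?num_real//.
      by rewrite ger0_norm ?th_ge0// th_le_sqr.
    - by rewrite -[X in _ --> X]oppr0; exact: (cvgN K0).
    - exact: K0.
  apply: DeriveDef; first by apply/cvg_ex; exists 0.
  exact/cvg_lim.
Unshelve. all: end_near. Qed.

Lemma continuous_th k : continuous (th k).
Proof.
move=> t; apply: differentiable_continuous; apply/derivable1_diffP.
by case: (is_derive_th k t).
Qed.

End flat_exponential.

(* Reified smooth functions: closed under partial differentiation, hence smooth,
   and with commuting partial derivatives by computation. *)
Section smooth_expressions.
Context (R : realType) (n : nat).
Local Notation V := 'rV[R]_n.

Inductive sexp : Type :=
| Cst of R
| Crd of 'I_n
| Add of sexp & sexp
| Mul of sexp & sexp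
| Th of nat & sexp.

Fixpoint ev (e : sexp) (x : V) : R :=
  match e with
  | Cst c => c
  | Crd i => x ord0 i
  | Add a b => ev a x + ev b x
  | Mul a b => ev a x * ev b x
  | Th k a => th k (ev a x)
  end.

Fixpoint dd (i : 'I_n) (e : sexp) : sexp :=
  match e with
  | Cst _ => Cst 0
  | Crd j => Cst (i == j)%:R
  | Add a b => Add (dd i a) (dd i b)
  | Mul a b => Add (Mul (dd i a) b) (Mul a (dd i b))
  | Th k a => Mul (Add (Th k.+2 a) (Mul (Cst (- k%:R)) (Th k.+1 a))) (dd i a)
  end.

Lemma ev_ddC i j e x : ev (dd i (dd j e)) x = ev (dd j (dd i e)) x.
Proof.
elim: e => //= [a iha b ihb|a iha b ihb|k a iha]; first by rewrite iha ihb.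
- by rewrite iha ihb; ring.
- by rewrite iha; ring.
Qed.

Lemma ev_chain e (g : R -> V) (g' : 'I_n -> R) (t : R) :
  (forall i, is_derive t (1 : R) (fun s => g s ord0 i) (g' i)) ->
  is_derive t (1 : R) (fun s => ev e (g s)) (\sum_i g' i * ev (dd i e) (g t)).
Proof.
move=> dg; elim: e => /= [c|j|a iha b ihb|a iha b ihb|k a iha].
- rewrite big1; first exact: is_derive_cst.
  by move=> i _; rewrite mulr0.
- rewrite (bigD1 j)//= eqxx mulr1 big1 ?addr0 => [|i ij]; first exact: dg.
  by rewrite (negbTE ij) mulr0.
- under eq_bigr do rewrite mulrDr.
  by rewrite big_split/=; exact: is_derive_add.
- have -> : \sum_i g' i * (ev (dd i a) (g t) * ev b (g t) + ev a (g t) * ev (dd i b) (g t)) =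
    (\sum_i g' i * ev (dd i a) (g t)) * ev b (g t) + ev a (g t) * (\sum_i g' i * ev (dd i b) (g t)).
    by rewrite big_distrl big_distrr -big_split; apply: eq_bigr => i _ /=; ring.
  exact: is_derive_mul.
- have -> : \sum_i g' i * ((th k.+2 (ev a (g t)) + - k%:R * th k.+1 (ev a (g t))) * ev (dd i a) (g t)) =
    (th k.+2 (ev a (g t)) - k%:R * th k.+1 (ev a (g t))) * (\sum_i g' i * ev (dd i a) (g t)).
    by rewrite big_distrr; apply: eq_bigr => i _ /=; ring.
  exact: (is_derive1_comp (is_derive_th k _) iha).
Qed.

Lemma continuous_ev e : continuous (ev e).
Proof.
elim: e => /= [c|j|a iha b ihb|a iha b ihb|k a iha] x.
- exact: cst_continuous.
- exact: coord_continuous.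
- exact: continuous_add iha ihb x.
- exact: continuous_mul iha ihb x.
- by apply: continuous_comp; [exact: iha|exact: continuous_th].
Qed.

Definition sc (e : sexp) (c : R) (z x : V) : R := ev e (c *: (x - z)).

Lemma continuous_sc e c z : continuous (sc e c z).
Proof.
have -> : sc e c z = ev e \o (fun x => c *: (x - z)) by [].
move=> x; apply: continuous_comp; last exact: continuous_ev.
by apply: continuousZl_tmp; apply: continuousB; [exact: cvg_id|exact: cst_continuous].
Qed.

Lemma is_derive_sc e c z (x v : V) :
  is_derive x v (sc e c z) (c * \sum_i v ord0 i * sc (dd i e) c z x).
Proof.
apply: is_derive_of_line; rewrite /sc.
have dg i : is_derive (0 : R) (1 : R) (fun s => (c *: (x + s *: v - z)) ord0 i) (c * v ord0 i).
  have -> : (fun s => (c *: (x + s *: v - z)) ord0 i) =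
      (fun s => c * (x ord0 i - z ord0 i + v ord0 i * s)).
    by apply/funext => s; rewrite !mxE; ring.
  apply: is_derive_scale.
  have := is_derive_add (is_derive_cst (x ord0 i - z ord0 i) (0 : R) (1 : R))
    (is_derive_scale (v ord0 i) (is_derive_id (0 : R) (1 : R))).
  by rewrite add0r mulr1.
have := ev_chain e dg; rewrite scale0r addr0.
by rewrite big_distrr/=; under eq_bigr do rewrite -mulrA.
Qed.

Lemma is_derive_sc_coord e c z (x : V) (i : 'I_n) :
  is_derive x (delta_mx ord0 i) (sc e c z) (c * sc (dd i e) c z x).
Proof.
have := is_derive_sc e c z x (delta_mx ord0 i).
rewrite (bigD1 i)//= mxE !eqxx mul1r big1 ?addr0// => j ji.
by rewrite mxE eqxx (negbTE ji) mul0r.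
Qed.

Lemma pderiv_sc (s : seq 'I_n) e c z :
  pderiv s (sc e c z) = (fun x => c ^+ size s * sc (foldr dd e s) c z x).
Proof.
elim: s => [|i s ih] /=; first by apply/funext => x; rewrite expr0 mul1r.
rewrite ih; apply/funext => x.
have := is_derive_scale (c ^+ size s) (is_derive_sc_coord (foldr dd e s) c z x i).
by case=> _ ->; rewrite exprS; ring.
Qed.

Lemma smooth_sc e c z : smooth (sc e c z).
Proof.
move=> s; rewrite pderiv_sc; split.
  by apply: continuous_scale; exact: continuous_sc.
by move=> i x; case: (is_derive_scale (c ^+ size s) (is_derive_sc_coord (foldr dd e s) c z x i)).
Qed.

End smooth_expressions.


(** * The Euclidean norm and the kernels *)

Section euclidean_norm.
Context (R : realType) (n : nat).
Local Notation V := 'rV[R]_n.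
Implicit Types x y z : V.

Definition nsq x : R := \sum_i x ord0 i ^+ 2.
Definition en x : R := Num.sqrt (nsq x).

Lemma nsq_ge0 x : 0 <= nsq x.
Proof. by apply: sumr_ge0 => i _; exact: sqr_ge0. Qed.

Lemma en_ge0 x : 0 <= en x. Proof. exact: sqrtr_ge0. Qed.

Lemma sqr_en x : en x ^+ 2 = nsq x.
Proof. by rewrite sqr_sqrtr// nsq_ge0. Qed.

Lemma nsqZ c x : nsq (c *: x) = c ^+ 2 * nsq x.
Proof. by rewrite /nsq big_distrr; apply: eq_bigr => i _; rewrite mxE exprMn. Qed.

Lemma enZ c x : en (c *: x) = `|c| * en x.
Proof. by rewrite /en nsqZ sqrtrM ?sqr_ge0// sqrtr_sqr. Qed.

Lemma enN x : en (- x) = en x.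
Proof. by rewrite -scaleN1r enZ normrN1 mul1r. Qed.

Lemma enB x y : en (x - y) = en (y - x).
Proof. by rewrite -opprB enN. Qed.

Lemma en0 : en 0 = 0.
Proof. by rewrite /en /nsq big1 ?sqrtr0// => i _; rewrite mxE expr0n. Qed.

Lemma cauchy_schwarz_row x y :
  (\sum_i x ord0 i * y ord0 i) ^+ 2 <= nsq x * nsq y.
Proof.
set s := \sum_i _.
have H (t : R) : 0 <= nsq x - 2 * t * s + t ^+ 2 * nsq y.
  have -> : nsq x - 2 * t * s + t ^+ 2 * nsq y = nsq (x - t *: y).
    rewrite /nsq /s !big_distrr/= -sumrB -big_split/=; apply: eq_bigr => i _.
    by rewrite !mxE; ring.
  exact: nsq_ge0.
have [y0|y0] := eqVneq (nsq y) 0.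
  rewrite y0 mulr0; have [->|s0] := eqVneq s 0; first by rewrite expr0n.
  have := H ((nsq x + 1) / (2 * s)); rewrite y0 mulr0 addr0.
  have -> : 2 * ((nsq x + 1) / (2 * s)) * s = nsq x + 1 by field.
  by lra.
have y1 : 0 < nsq y by rewrite lt_neqAle eq_sym y0 nsq_ge0.
have := H (s / nsq y).
have -> : nsq x - 2 * (s / nsq y) * s + (s / nsq y) ^+ 2 * nsq y = nsq x - s ^+ 2 / nsq y.
  by field.
by rewrite subr_ge0 ler_pdivrMr.
Qed.

Lemma enD x y : en (x + y) <= en x + en y.
Proof.
rewrite -(@ler_pXn2r _ 2) ?nnegrE ?addr_ge0 ?en_ge0// sqr_en.
have -> : nsq (x + y) = nsq x + nsq y + 2 * \sum_i x ord0 i * y ord0 i.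
  rewrite /nsq big_distrr/= -!big_split/=; apply: eq_bigr => i _.
  by rewrite mxE; ring.
have -> : (en x + en y) ^+ 2 = nsq x + nsq y + 2 * (en x * en y).
  by rewrite -!sqr_en; ring.
rewrite lerD2l ler_pM2l//.
apply: le_trans (ler_norm _) _.
rewrite -(@ler_pXn2r _ 2) ?nnegrE ?mulr_ge0 ?en_ge0//.
by rewrite real_normK ?num_real// exprMn !sqr_en cauchy_schwarz_row.
Qed.

Lemma en_triangle y x z : en (x - z) <= en (x - y) + en (y - z).
Proof. by rewrite -{1}(subrK y x) -addrA enD. Qed.

Lemma coord_le_en x i : `|x ord0 i| <= en x.
Proof.
rewrite -(@ler_pXn2r _ 2) ?nnegrE ?en_ge0// sqr_en real_normK ?num_real//.
by rewrite /nsq (bigD1 i)//= lerDl sumr_ge0// => j _; exact: sqr_ge0.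
Qed.

Lemma en_le_coord x r : 0 <= r -> (forall i, `|x ord0 i| <= r) -> en x <= n%:R * r.
Proof.
move=> r0 H; have [n0|n0] := posnP n.
  rewrite /en /nsq big1 ?sqrtr0 ?mulr_ge0// => i _.
  by have := ltn_ord i; rewrite {2}n0.
rewrite -(@ler_pXn2r _ 2) ?nnegrE ?en_ge0 ?mulr_ge0// sqr_en /nsq.
apply: (@le_trans _ _ (\sum_(i < n) r ^+ 2)).
  apply: ler_sum => i _; rewrite -[_ ^+ 2]real_normK ?num_real//.
  by rewrite lerXn2r ?nnegrE.
rewrite sumr_const card_ord -[leLHS]mulr_natl exprMn ler_wpM2r ?sqr_ge0//.
by rewrite expr2 ler_peMr// ler1n.
Qed.

Lemma eballE x r y : eball x r y = (en (y - x) < r) :> Prop.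
Proof.
rewrite /eball /en /nsq /=; congr (is_true (Num.sqrt _ < r)).
by apply: eq_bigr => i _; rewrite !mxE.
Qed.

Lemma continuous_nsq : continuous nsq.
Proof. by apply: continuous_sum => i; apply: continuous_exp; exact: coord_continuous. Qed.

Lemma continuous_en : continuous en.
Proof.
have -> : en = Num.sqrt \o nsq by [].
by move=> x; apply: continuous_comp; [exact: continuous_nsq|exact: sqrt_continuous].
Qed.

Lemma continuous_en_sub z : continuous (fun x => en (x - z)).
Proof.
have -> : (fun x => en (x - z)) = en \o (fun x => x - z) by [].
move=> x; apply: continuous_comp; last exact: continuous_en.
by apply: continuousB; [exact: cvg_id|exact: cst_continuous].
Qed.

Lemma open_eball z r : open (eball z r).
Proof.
have -> : eball z r = (fun x => en (x - z)) @^-1` [set t | t < r].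
  by apply/seteqP; split => x; rewrite -[eball z r x]/(eball z r x) eballE.
by apply: open_comp; [move=> x _; exact: continuous_en_sub|exact: open_lt].
Qed.

Lemma en_le_cube z r x : en (x - z) <= r -> cube z r x.
Proof. by move=> H i; have := coord_le_en (x - z) i; rewrite !mxE => /le_trans; exact. Qed.

Lemma cube_en z r x : 0 <= r -> cube z r x -> en (x - z) <= n%:R * r.
Proof. by move=> r0 H; apply: en_le_coord => // i; have := H i; rewrite !mxE. Qed.

Lemma nbhs_eball x (A : set V) : nbhs x A ->
  exists2 r, 0 < r & forall y, en (y - x) <= r -> A y.
Proof.
move=> /nbhs_ballP[e /= e0 eA]; exists (e / 2); first by rewrite divr_gt0.
move=> y H; apply: eA; apply/ball_rowP => // i.
have := coord_le_en (y - x) i; rewrite !mxE => /le_lt_trans; apply.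
by apply: (le_lt_trans H); rewrite ltr_pdivrMr// ltr_pMr// ltr1n.
Qed.

Lemma eball_nbhs x r : 0 < r -> nbhs x [set y | en (y - x) < r].
Proof.
move=> r0; apply: open_nbhs_nbhs; split.
  have -> : [set y | en (y - x) < r] = (fun y => en (y - x)) @^-1` [set t | t < r] by [].
  by apply: open_comp; [move=> y _; exact: continuous_en_sub|exact: open_lt].
by rewrite /= subrr en0.
Qed.

End euclidean_norm.

Section kernels.
Context (R : realType) (n : nat).
Local Notation V := 'rV[R]_n.
Local Notation sexp := (sexp R n).

Definition sSum (s : seq 'I_n) (F : 'I_n -> sexp) : sexp :=
  foldr (fun i a => Add (F i) a) (Cst n 0) s.

Lemma ev_sSum s F (x : V) : ev (sSum s F) x = \sum_(i <- s) ev (F i) x.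
Proof. by elim: s => [|i s ih] /=; rewrite ?big_nil// big_cons ih. Qed.

Lemma dd_sSum j s F : dd j (sSum s F) = sSum s (fun i => dd j (F i)).
Proof. by elim: s => [|i s ih] //=; rewrite ih. Qed.

Definition sNsq : sexp := sSum (index_enum 'I_n) (fun i => Mul (Crd R i) (Crd R i)).

Lemma ev_sNsq x : ev sNsq x = nsq x.
Proof. by rewrite ev_sSum. Qed.

Lemma ev_dd_sNsq i (x : V) : ev (dd i sNsq) x = 2 * x ord0 i.
Proof.
rewrite dd_sSum ev_sSum /= (bigD1 i)//= eqxx big1 => [|j ji]; first by rewrite mulr1 mul1r; ring.
by rewrite eq_sym (negbTE ji) mul0r mulr0 addr0.
Qed.

Definition lap (e : sexp) : sexp := sSum (index_enum 'I_n) (fun i => dd i (dd i e)).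

Lemma ev_lap e (x : V) : ev (lap e) x = \sum_i ev (dd i (dd i e)) x.
Proof. by rewrite ev_sSum. Qed.

Lemma ev_derive e (x : V) i : is_derive x (delta_mx ord0 i) (ev e) (ev (dd i e) x).
Proof.
have E : sc e 1 0 = ev e by apply/funext => y; rewrite /sc scale1r subr0.
by have := is_derive_sc_coord e 1 0 x i; rewrite E mul1r /sc scale1r subr0.
Qed.

(** [dd] is syntactic, but its value is a genuine derivative and so depends only on the germ of the
    evaluated function. This transports supports and identities between expressions to their
    derivatives. *)
Lemma ev_dd_local a b (x : V) i : (\near x, ev a x = ev b x) ->
  ev (dd i a) x = ev (dd i b) x.
Proof.
move=> ab; have [_ <-] := ev_derive b x i.
by have [_ <-] := ev_derive a x i; exact: near_eq_derive.
Qed.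

Lemma ev_dd_ext a b (x : V) i : (forall x, ev a x = ev b x) ->
  ev (dd i a) x = ev (dd i b) x.
Proof.
by move=> ab; apply: ev_dd_local; near=> y; exact: ab.
Unshelve. all: end_near. Qed.

Definition usupp (e : sexp) := forall x : V, 1 < nsq x -> ev e x = 0.

Lemma usupp_dd e i : usupp e -> usupp (dd i e).
Proof.
move=> se x x1; rewrite (@ev_dd_local e (Cst n 0))//=.
have C := @continuous_nsq R n x _ (lt_nbhsr x1).
by near=> y; apply: se; near: y; exact: C.
Unshelve. all: end_near. Qed.

Lemma usupp_lap e : usupp e -> usupp (lap e).
Proof.
move=> se x x1; rewrite ev_lap big1// => i _.
by apply: usupp_dd x1; exact: usupp_dd.
Qed.

Lemma usupp_cube e (x : V) : usupp e -> ~ cube 0 1 x -> ev e x = 0.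
Proof.
move=> se nx; apply: se; rewrite ltNge; apply/negP => x1; apply: nx.
apply: en_le_cube; rewrite subr0 -(@ler_pXn2r _ 2) ?nnegrE ?en_ge0//.
by rewrite sqr_en expr1n.
Qed.

Lemma usupp_bounded e : usupp e -> exists M, 0 < M /\ forall x : V, `|ev e x| <= M.
Proof.
move=> se; apply: (@continuous_support_bounded _ _ _ 0 1).
  exact: continuous_ev.
by move=> x; exact: usupp_cube.
Qed.

Definition sBmp : sexp := Add (Cst n 1) (Mul (Cst n (- 1)) sNsq).

Lemma ev_sBmp x : ev sBmp x = 1 - nsq x.
Proof. by rewrite -[LHS]/(1 + - 1 * ev sNsq x) ev_sNsq mulN1r. Qed.

(* [rho0] is a radial bump with [grad Pk = - x rho0]; hence the Laplacian of
   [t^(1-n) Pk(x/t)] is the [t]-derivative of [t^(-n) rho0(x/t)]. *)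
Definition Pk : sexp := Th 0 sBmp.
Definition rho0 : sexp := Mul (Cst n 2) (Th 2 sBmp).

Lemma ev_Pk x : ev Pk x = th 0 (1 - nsq x).
Proof. by rewrite -[LHS]/(th 0 (ev sBmp x)) ev_sBmp. Qed.

Lemma ev_rho0 x : ev rho0 x = 2 * th 2 (1 - nsq x).
Proof. by rewrite -[LHS]/(2 * th 2 (ev sBmp x)) ev_sBmp. Qed.

Lemma ev_dd_Pk i (x : V) : ev (dd i Pk) x = - (x ord0 i * ev rho0 x).
Proof.
rewrite -[LHS]/((th 2 (ev sBmp x) + (- 0) * th 1 (ev sBmp x)) *
  (0 + (0 * ev sNsq x + - 1 * ev (dd i sNsq) x))).
by rewrite -[ev rho0 x]/(2 * th 2 (ev sBmp x)) ev_dd_sNsq; ring.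
Qed.

(** The divergence of [- x rho0]. The right-hand side is also what differentiating
    [t^(-n) rho0(x/t)] in [t] gives at [t = 1]. *)
Lemma ev_lap_Pk (x : V) :
  ev (lap Pk) x = - (n%:R * ev rho0 x) - \sum_i x ord0 i * ev (dd i rho0) x.
Proof.
rewrite ev_lap.
have H i : ev (dd i (dd i Pk)) x = - ev rho0 x - x ord0 i * ev (dd i rho0) x.
  rewrite (@ev_dd_ext _ (Mul (Cst n (- 1)) (Mul (Crd R i) rho0))).
    by move: rho0 => r; rewrite /= eqxx mul1r; ring.
  by move=> y; rewrite ev_dd_Pk -[RHS]/(- 1 * (y ord0 i * ev rho0 y)) mulN1r.
move: rho0 H => r H.
rewrite (eq_bigr _ (fun i _ => H i)) big_split/= sumr_const card_ord sumrN.
by rewrite mulNrn mulr_natl.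
Qed.

Lemma usupp_Pk : usupp Pk.
Proof. by move=> x x1; rewrite ev_Pk th_le0// subr_le0 ltW. Qed.

Lemma usupp_rho0 : usupp rho0.
Proof. by move=> x x1; rewrite ev_rho0 th_le0 ?mulr0// subr_le0 ltW. Qed.

Lemma ev_rho0_ge0 x : 0 <= ev rho0 x.
Proof. by rewrite ev_rho0 mulr_ge0 ?th_ge0. Qed.

Lemma ev_Pk_ge0 x : 0 <= ev Pk x.
Proof. by rewrite ev_Pk th_ge0. Qed.

Lemma ev_rho0N x : ev rho0 (- x) = ev rho0 x.
Proof. by rewrite !ev_rho0 -[- x]scaleN1r nsqZ sqrrN expr1n mul1r. Qed.

(* A cutoff equal to 1 on the unit ball and to 0 where [nsq x >= 2]. *)
Definition kap : sexp :=
  Mul (Cst n (th 0 (th 0 1 : R))^-1)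
    (Th 0 (Add (Cst n (th 0 1)) (Mul (Cst n (- 1)) (Th 0 (Add sNsq (Cst n (- 1))))))).

Lemma ev_kap x : ev kap x = (th 0 (th 0 1 : R))^-1 * th 0 (th 0 1 - th 0 (nsq x - 1)).
Proof.
rewrite -[LHS]/((th 0 (th 0 1 : R))^-1 *
  th 0 (th 0 1 + - 1 * th 0 (ev sNsq x + - 1))).
by rewrite ev_sNsq mulN1r.
Qed.

Lemma ev_kap1 x : nsq x <= 1 -> ev kap x = 1.
Proof.
move=> x1; rewrite ev_kap [th 0 (nsq x - 1)]th_le0 ?subr_le0// subr0 mulVf//.
by rewrite gt_eqF// !th_gt0.
Qed.

(** Once [nsq x >= 2], the inner [th 0 (nsq x - 1)] has reached [th 0 1] by monotonicity, so the
    outer argument is nonpositive. *)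
Lemma ev_kap0 x : 2 <= nsq x -> ev kap x = 0.
Proof.
move=> x2; rewrite ev_kap [X in _ * X]th_le0 ?mulr0// subr_le0.
have x1 : 0 < nsq x - 1 by lra.
rewrite /th x1 ltr01 !expr0 !mul1r ler_expR lerN2 invr1 invf_le1//; lra.
Qed.

End kernels.

Arguments ev : simpl never.
Arguments dd : simpl never.


(** * Convolutions and their derivatives in position and in scale *)

Section parametric_integrals.
Context d (T : measurableType d) (R : realType) (mu : {measure set T -> \bar R}).

Lemma ae_le_Rintegral (f g : T -> R) : mu.-integrable setT (EFin \o f) ->
  mu.-integrable setT (EFin \o g) -> {ae mu, forall x, f x <= g x} ->
  \int[mu]_x f x <= \int[mu]_x g x.
Proof.
move=> intf intg fg; rewrite -subr_ge0 -RintegralB//.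
have inth := integrable_sub intg intf.
have mh : measurable_fun setT (fun x => g x - f x).
  by apply/measurable_EFinP; case/integrableP : inth.
rewrite (@ae_eq_Rintegral _ _ _ mu (fun x => g x - f x) (fun x => `|g x - f x|))//.
- exact: Rintegral_ge0.
- exact: measurableT_comp.
- by apply: filterS fg => x /= fgx; rewrite ger0_norm// subr_ge0.
Qed.

Lemma is_derive_Rintegral (f df : R -> T -> R) (G : T -> R) (a r : R) : 0 < r ->
  (forall t, a - r < t < a + r -> mu.-integrable setT (EFin \o f t)) ->
  (forall t y, a - r < t < a + r -> is_derive t (1 : R) (f ^~ y) (df t y)) ->
  mu.-integrable setT (EFin \o G) ->
  (forall t y, a - r < t < a + r -> `|df t y| <= G y) ->
  is_derive a (1 : R) (fun t => \int[mu]_y f t y) (\int[mu]_y df a y).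
Proof.
move=> r0 intf dfP intG dG.
have ar : a - r < a < a + r by apply/andP; split; lra.
have Ia : `]a - r, a + r[%classic a by rewrite /= in_itv.
have G0 y : 0 <= G y by exact: le_trans (normr_ge0 _) (dG a y ar).
have dE t y : a - r < t < a + r -> partial1of2 f t y = df t y.
  by move=> art; rewrite partial1of2E; case: (dfP t y art).
have H : h^-1 *: ((\int[mu]_y f (h + a) y : R^o) - \int[mu]_y f a y) @[h --> (0:R)^'] -->
    \int[mu]_y partial1of2 f a y.
  apply: (@cvg_differentiation_under_integral R d T mu f setT measurableT a (a - r) (a + r) Ia _ _ G G0 intG).
  - by move=> t /=; rewrite in_itv/=; exact: intf.
  - by move=> t y /=; rewrite in_itv/= => art _; case: (dfP t y art).
  - by move=> t y /=; rewrite in_itv/= => art _; rewrite dE//; exact: dG.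
have E : \int[mu]_y partial1of2 f a y = \int[mu]_y df a y.
  by apply: eq_Rintegral => y _; rewrite dE.
rewrite E in H.
apply: DeriveDef.
  rewrite /derivable; under eq_fun do rewrite [_ *: 1]mulr1.
  by apply/cvg_ex; exists (\int[mu]_y df a y).
rewrite /derive; under eq_fun do rewrite [_ *: 1]mulr1.
exact: cvg_lim H.
Qed.

End parametric_integrals.

Section lipschitz_kernels.
Context (R : realType) (n : nat).
Local Notation V := 'rV[R]_n.
Implicit Type e : sexp R n.

Lemma usupp_gradient_bounded e : usupp e ->
  exists2 M, 0 < M & forall x v : V, `|\sum_i v ord0 i * ev (dd i e) x| <= M * en v.
Proof.
move=> se.
have H i : exists M, 0 < M /\ forall x : V, `|ev (dd i e) x| <= M.
  exact/usupp_bounded/usupp_dd.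
pose M i := projT1 (cid (H i)).
have M0 i : 0 < M i by case: (projT2 (cid (H i))).
have HM i x : `|ev (dd i e) x| <= M i by case: (projT2 (cid (H i))) => _; exact.
exists (1 + \sum_i M i).
  by rewrite ltr_pwDl// sumr_ge0// => i _; exact: ltW.
move=> x v; apply: le_trans (ler_norm_sum _ _ _) _.
apply: (@le_trans _ _ (\sum_i M i * en v)).
  apply: ler_sum => i _; rewrite normrM mulrC ler_pM ?HM//.
  exact: coord_le_en.
by rewrite -big_distrl/= ler_wpM2r ?en_ge0// lerDr.
Qed.

Lemma usupp_lipschitz e : usupp e ->
  exists2 M, 0 < M & forall x y : V, `|ev e x - ev e y| <= M * en (x - y).
Proof.
move=> se; have [M M0 HM] := usupp_gradient_bounded se.
exists M => // x y.
have E : sc e 1 0 = ev e by apply/funext => w; rewrite /sc scale1r subr0.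
have dE (w v : V) : is_derive w v (ev e) (\sum_i v ord0 i * ev (dd i e) w).
  have := is_derive_sc e 1 0 w v; rewrite E mul1r.
  by under eq_bigr do rewrite /sc scale1r subr0.
have := @le_line_derive R n (ev e) (fun w => \sum_i (x - y) ord0 i * ev (dd i e) w)
  y (x - y) (M * en (x - y)) 1 ltr01 (fun w => dE w (x - y)) (fun s _ => HM _ _).
have -> : y + 1 *: (x - y) = x by rewrite scale1r addrC subrK.
by rewrite mulr1.
Qed.

End lipschitz_kernels.

Section convolution.
Context (R : realType) (n : nat).
Local Notation V := 'rV[R]_n.
Local Notation itg f := ((leb R n).-integrable setT (EFin \o f)).
Implicit Types (e : sexp R n) (u : V -> R).

(** With an arbitrary expression and scale factor and no normalisation, derivatives in [x] and in
    the scale are again multiples of such integrals. *)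
Definition cv u e (c : R) (x : V) : R := \int[leb R n]_y (u y * ev e (c *: (y - x))).

Lemma measurable_ev e c x :
  measurable_fun (setT : set (Rn R n)) (fun y => ev e (c *: (y - x))).
Proof. exact: (continuous_measurable_row (@continuous_sc R n e c x)). Qed.

Lemma integrable_cv u e c x : itg u -> usupp e ->
  itg (fun y => u y * ev e (c *: (y - x))).
Proof.
move=> hu se; have [M [M0 HM]] := usupp_bounded se.
apply: (integrable_mul_bounded hu (measurable_ev e c x)) => y; exact: HM.
Qed.

Lemma cv_lipschitz u e c : itg u -> usupp e ->
  exists2 M, 0 < M & forall x y, `|cv u e c x - cv u e c y| <= M * en (x - y).
Proof.
move=> hu se; have [M M0 HM] := usupp_lipschitz se.
have hau := integrable_norm hu.
have I0 : 0 <= \int[leb R n]_y `|u y| by exact: Rintegral_ge0.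
exists (1 + `|c| * M * \int[leb R n]_y `|u y|).
  by rewrite ltr_pwDl// !mulr_ge0// ltW.
move=> x y; rewrite /cv -RintegralB; [|by []|exact: integrable_cv..].
have intB := integrable_sub (integrable_cv c x hu se) (integrable_cv c y hu se).
apply: le_trans (le_normr_Rintegral _ intB) _ => //.
apply: (@le_trans _ _ (\int[leb R n]_w ((`|c| * M * en (x - y)) * `|u w|))).
  apply: le_Rintegral => //; [exact: integrable_norm intB|exact: integrable_scale|].
  move=> w _; rewrite -mulrBr normrM mulrC ler_wpM2r//.
  apply: (le_trans (HM _ _)).
  have -> : c *: (w - x) - c *: (w - y) = c *: (y - x).
    by rewrite -scalerBr opprB addrC addrA subrK.
  by rewrite enZ enB mulrCA mulrA.
rewrite RintegralZl//.
rewrite [leLHS](_ : _ = `|c| * M * (\int[leb R n]_y `|u y|) * en (x - y)); last by ring.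
by rewrite ler_wpM2r ?en_ge0// lerDr.
Qed.

Lemma lipschitz_continuous (f : V -> R) M : 0 < M ->
  (forall x y, `|f x - f y| <= M * en (x - y)) -> continuous f.
Proof.
move=> M0 H x A /nbhs_ballP[e /= e0 eA].
have eM : 0 < e / M by rewrite divr_gt0.
apply: (filterS _ (eball_nbhs x eM)) => y /= Hy; apply: eA.
by rewrite /ball/=; apply: (le_lt_trans (H x y)); rewrite mulrC -ltr_pdivlMr// enB.
Qed.

Lemma continuous_cv u e c : itg u -> usupp e -> continuous (cv u e c).
Proof. by move=> hu se; have [M M0] := cv_lipschitz c hu se; exact: lipschitz_continuous. Qed.

Lemma is_derive_cv u e c x i : itg u -> usupp e ->
  is_derive x (delta_mx ord0 i) (cv u e c) (- c * cv u (dd i e) c x).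
Proof.
move=> hu se; apply: is_derive_of_line.
have [M [M0 HM]] := usupp_bounded (usupp_dd i se).
pose f (t : R) (y : V) := u y * ev e (c *: (y - (x + t *: delta_mx ord0 i))).
pose df (t : R) (y : V) := u y * (- c * ev (dd i e) (c *: (y - (x + t *: delta_mx ord0 i)))).
have -> : - c * cv u (dd i e) c x = \int[leb R n]_y df 0 y.
  rewrite /cv -RintegralZl; [|by []|by apply: integrable_cv => //; exact: usupp_dd].
  by apply: eq_Rintegral => y _; rewrite /df scale0r addr0; ring.
apply: (@is_derive_Rintegral _ (Rn R n) R (leb R n) f df (fun y => `|c| * M * `|u y|) 0 1) => //.
- by move=> t _; exact: integrable_cv.
- move=> t y _; rewrite /f /df; apply: is_derive_scale.
  have dg j : is_derive t (1 : R) (fun s => (c *: (y - (x + s *: delta_mx ord0 i))) ord0 j)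
      (- c * (i == j)%:R).
    have -> : (fun s => (c *: (y - (x + s *: delta_mx ord0 i))) ord0 j) =
        (fun s => c * (y ord0 j - x ord0 j) + (- c * (i == j)%:R) * s).
      by apply/funext => s; rewrite !mxE eqxx [j == i]eq_sym; ring.
    have := is_derive_add (is_derive_cst (c * (y ord0 j - x ord0 j)) t (1 : R))
      (is_derive_scale (- c * (i == j)%:R) (is_derive_id t (1 : R))).
    by rewrite add0r mulr1.
  have := ev_chain e dg; rewrite (bigD1 i)//= eqxx mulr1 big1 ?addr0// => j ji.
  by rewrite eq_sym (negbTE ji) mulr0 mul0r.
- by apply: integrable_scale; exact: integrable_norm.
- move=> t y _; rewrite /df !normrM normrN mulrC ler_wpM2r// ler_wpM2l//.
Qed.

Lemma cv_ext u e e' c x : (forall y, ev e y = ev e' y) -> cv u e c x = cv u e' c x.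
Proof. by move=> ee; apply: eq_Rintegral => y _; rewrite ee. Qed.

Lemma cv_lap u e c x : itg u -> usupp e ->
  cv u (lap e) c x = \sum_i cv u (dd i (dd i e)) c x.
Proof.
move=> hu se; rewrite -Rintegral_sum; last first.
  by move=> i; apply: integrable_cv => //; do 2!apply: usupp_dd.
by apply: eq_Rintegral => y _; rewrite ev_lap big_distrr.
Qed.

(** The mass of [rho0] is not divided out, which keeps the derivative in [t] free of constants;
    [molc] is the normalised version. *)
Definition mol u (t : R) (x : V) : R := t ^- n * cv u (rho0 R n) t^-1 x.

(** Under the integral sign, [ev_lap_Pk] turns the scale derivative of the kernel [rho0] into a
    Laplacian of [Pk]. For scales between [t / 2] and [3 t / 2] the differentiated integrand is
    dominated by a multiple of [|u|]. *)
Lemma is_derive_mol u x (t : R) : itg u -> 0 < t ->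
  is_derive t (1 : R) (fun t => mol u t x) (t ^- n.+1 * cv u (lap (Pk R n)) t^-1 x).
Proof.
move=> hu t0.
have sr := @usupp_rho0 R n; have sl := usupp_lap (@usupp_Pk R n).
have [M [M0 HM]] := usupp_bounded sl.
pose f (t : R) (y : V) := u y * (t ^- n * ev (rho0 R n) (t^-1 *: (y - x))).
pose df (t : R) (y : V) := u y * (t ^- n.+1 * ev (lap (Pk R n)) (t^-1 *: (y - x))).
have -> : t ^- n.+1 * cv u (lap (Pk R n)) t^-1 x = \int[leb R n]_y df t y.
  rewrite /cv -RintegralZl; [|by []|exact: integrable_cv].
  by apply: eq_Rintegral => y _; rewrite /df; ring.
have -> : (fun t => mol u t x) = (fun t => \int[leb R n]_y f t y).
  apply/funext => s; rewrite /mol /cv -RintegralZl; [|by []|exact: integrable_cv].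
  by apply: eq_Rintegral => y _; rewrite /f; ring.
have t20 : 0 < t / 2 by rewrite divr_gt0.
have pos s : t - t / 2 < s < t + t / 2 -> t / 2 < s by move=> /andP[? _]; lra.
apply: (@is_derive_Rintegral _ (Rn R n) R (leb R n) f df
  (fun y => (t / 2) ^- n.+1 * M * `|u y|) t (t / 2)) => //.
- move=> s _; have := integrable_scale (s ^- n) (integrable_cv s^-1 x hu sr).
  by congr (_.-integrable _ _); apply/funext => y; rewrite /f /=; congr (_%:E); ring.
- move=> s y /pos ts; have s0 : 0 < s by exact: lt_trans ts.
  have sn0 : s != 0 by rewrite gt_eqF.
  rewrite /f /df; apply: is_derive_scale.
  have dV : is_derive s (1 : R) (fun s : R => s^-1) (- s ^- 2).
    have := is_deriveV sn0 (is_derive_id s (1 : R)); rewrite /= [X in is_derive _ _ _ X]mulr1.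
    by [].
  have dn := is_derive_exp n dV.
  have dg j : is_derive s (1 : R) (fun s => (s^-1 *: (y - x)) ord0 j) (- s ^- 2 * (y - x) ord0 j).
    have -> : (fun s => (s^-1 *: (y - x)) ord0 j) = (fun s => s^-1 * (y - x) ord0 j).
      by apply/funext => r; rewrite [LHS]mxE.
    have := is_derive_mul dV (is_derive_cst ((y - x) ord0 j) s (1 : R)).
    by rewrite mulr0 addr0.
  have := is_derive_mul dn (ev_chain (rho0 R n) dg).
  have -> : (fun s : R => s^-1 ^+ n * ev (rho0 R n) (s^-1 *: (y - x))) =
    (fun s : R => s ^- n * ev (rho0 R n) (s^-1 *: (y - x))).
    by apply/funext => r; rewrite exprVn.
  set D := (X in is_derive _ _ _ X).
  suff -> : D = s ^- n.+1 * ev (lap (Pk R n)) (s^-1 *: (y - x)) by [].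
  rewrite /D ev_lap_Pk mulrBr -!exprVn.
  have -> : \sum_i (s^-1 *: (y - x)) ord0 i * ev (dd i (rho0 R n)) (s^-1 *: (y - x)) =
     s^-1 * \sum_i (y - x) ord0 i * ev (dd i (rho0 R n)) (s^-1 *: (y - x)).
    by rewrite big_distrr; apply: eq_bigr => i _ /=; rewrite [X in X * _ = _]mxE; ring.
  have -> : \sum_i - s^-1 ^+ 2 * (y - x) ord0 i * ev (dd i (rho0 R n)) (s^-1 *: (y - x)) =
     - s^-1 ^+ 2 * \sum_i (y - x) ord0 i * ev (dd i (rho0 R n)) (s^-1 *: (y - x)).
    by rewrite big_distrr; apply: eq_bigr => i _ /=; ring.
  move: (\sum_i _) (ev (rho0 R n) _) => S r.
  clear; case: n => [|m]; rewrite /= ?exprS ?expr0; last by ring.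
  by ring.
- by apply: integrable_scale; exact: integrable_norm.
- move=> s y /pos ts; have s0 : 0 < s by exact: lt_trans ts.
  rewrite /df !normrM mulrC ler_wpM2r// ler_pM//.
  rewrite ger0_norm ?invr_ge0 ?exprn_ge0 ?(ltW s0)//.
  by rewrite lef_pV2 ?posrE ?exprn_gt0// lerXn2r ?nnegrE ?(ltW s0)// ltW.
Qed.

End convolution.


(** * The fundamental lemma for continuous test functions *)

Section positivity_sets.
Context (R : realType) (n : nat).
Local Notation V := 'rV[R]_n.

(** A class stable under intersection, by multiplying the functions, which generates the Borel sets,
    and whose indicators are limits of continuous functions: what is needed to pass from test
    functions to sets. *)
Definition positivity_sets : set (set V) :=
  [set A | exists2 f : V -> R, continuous f /\ (forall x, 0 <= f x) & A = [set x | 0 < f x]].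

Lemma positivity_setsI : setI_closed positivity_sets.
Proof.
move=> A B [f [cf f0] ->] [g [cg g0] ->].
exists (fun x => f x * g x).
  by split; [exact: continuous_mul|move=> x; exact: mulr_ge0].
apply/seteqP; split => x /=; first by move=> [? ?]; exact: mulr_gt0.
move=> fg; split; rewrite lt_neqAle ?f0 ?g0 andbT; apply/eqP => E;
  by move: fg; rewrite -E ?mul0r ?mulr0 ltxx.
Qed.

Let S := g_sigma_algebraType positivity_sets.

Lemma measurable_coord_positivity (i : 'I_n) :
  measurable_fun (setT : set S) (fun x : V => x ord0 i).
Proof.
apply: (measurability _ (RGenOpens.measurableE R)).
move=> _ [_ [a [b ->] <-]]; rewrite setTI.
apply: sub_sigma_algebra.
exists (fun x => Num.max 0 (x ord0 i - a) * Num.max 0 (b - x ord0 i)).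
  split; last by move=> x; rewrite mulr_ge0// le_max lexx.
  have cc := @coord_continuous R 1 n ord0 i.
  apply: continuous_mul => x.
    apply: (@continuous_comp _ _ _ (fun x : V => x ord0 i) (fun t => Num.max 0 (t - a))).
      exact: cc.
    apply: continuous_max; first exact: cst_continuous.
    by apply: continuousB; [exact: cvg_id|exact: cst_continuous].
  apply: (@continuous_comp _ _ _ (fun x : V => x ord0 i) (fun t => Num.max 0 (b - t))).
    exact: cc.
  apply: continuous_max; first exact: cst_continuous.
  by apply: continuousB; [exact: cst_continuous|exact: cvg_id].
apply/seteqP; split => x /=; rewrite in_itv/=.
  by move=> /andP[ax xb]; rewrite mulr_gt0// lt_max subr_gt0 ?ax ?xb orbT.
move=> H; apply/andP; split; rewrite ltNge; apply/negP => xle; move: H.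
  by rewrite [Num.max 0 (_ - a)]max_l ?subr_le0// mul0r ltxx.
by rewrite [Num.max 0 (b - _)]max_l ?subr_le0// mulr0 ltxx.
Qed.

Lemma measurable_positivity_row (B : set (n.-tuple (measurableTypeR R))) :
  measurable B -> <<s positivity_sets >> (@tuple_of_row R n @^-1` B).
Proof.
move=> mB.
have mt : measurable_fun (setT : set S) (@tuple_of_row R n).
  apply/measurable_fun_tnthP => i.
  rewrite (_ : _ \o _ = fun x : V => x ord0 i); first exact: measurable_coord_positivity.
  by apply/funext => x /=; rewrite tnth_mktuple.
by have := mt measurableT _ mB; rewrite setTI.
Qed.

End positivity_sets.

Section fundamental_lemma.
Context (R : realType) (n : nat).
Local Notation V := 'rV[R]_n.
Local Notation itg f := ((leb R n).-integrable setT (EFin \o f)).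
Variables (w : V -> R) (z : V) (r : R).
Hypotheses (hw : itg w) (w0 : forall x, ~ eball z r x -> w x = 0).
Hypothesis hphi : forall (phi : V -> R) (s : R), continuous phi -> s < r ->
  (forall x, 0 <= phi x <= 1) -> (forall x, s < en (x - z) -> phi x = 0) ->
  \int[leb R n]_x (w x * phi x) = 0.

Let mw : measurable_fun (setT : set (Rn R n)) w.
Proof. by apply/measurable_EFinP; case/integrableP : hw. Qed.

(** The sets over which [w] integrates to 0. They contain the positivity sets and form a
    lambda-system, hence they contain all the Borel sets. *)
Let H (A : set V) := measurable (A : set (Rn R n)) /\
  \int[leb R n]_x (w x * \1_A x) = 0.

Let itgI (A : set (Rn R n)) : measurable A -> itg (fun x => w x * \1_A x).
Proof.
move=> mA; apply: (@integrable_mul_bounded _ _ _ (leb R n) w (\1_A) 1 hw).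
  exact: measurable_indic.
by move=> x; rewrite indicE; case: (_ \in _); rewrite ?normr1 ?normr0 ?ler01.
Qed.

Let clamp (t : R) : R := Num.min 1 (Num.max 0 t).

Let clamp01 t : 0 <= clamp t <= 1.
Proof. by rewrite /clamp ge_min lexx le_min ler01 le_max lexx. Qed.

Let clamp0 t : t <= 0 -> clamp t = 0.
Proof. by move=> t0; rewrite /clamp max_l// min_r. Qed.

Let clamp1 t : 1 <= t -> clamp t = 1.
Proof. by move=> t1; rewrite /clamp max_r ?(le_trans ler01)// min_l. Qed.

Let continuous_clamp (f : V -> R) : continuous f -> continuous (clamp \o f).
Proof.
move=> cf x; apply: continuous_comp; first exact: cf.
apply: continuous_min; first exact: cst_continuous.
by apply: continuous_max; [exact: cst_continuous|exact: cvg_id].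
Qed.

Let clamp_cvg (a : R) : 0 < a ->
  \forall k \near \oo, clamp (k%:R * a) = 1.
Proof.
move=> a0; near=> k; apply: clamp1; rewrite -ler_pdivrMr// div1r.
near: k; exact: nbhs_infty_ger.
Unshelve. all: end_near. Qed.

Let HG : @positivity_sets R n `<=` H.
Proof.
move=> _ [f [cf f0] ->]; split.
  apply: open_measurable_row.
  rewrite (_ : [set _ | _] = f @^-1` [set t | 0 < t])//.
  by apply: open_comp; [move=> x _; exact: cf|exact: open_gt].
(* The first factor tends to the indicator of [0 < f]. The second confines [g k] to the ball of
   radius [r - 1 / (k + 1)], which makes it an admissible test function, and tends to 1 in the open
   ball, outside of which [w] is 0. *)
pose g (k : nat) (x : V) := clamp (k%:R * f x) * clamp (k%:R * (r - k.+1%:R^-1 - en (x - z))).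
have cg k : continuous (g k).
  apply: continuous_mul; apply: continuous_clamp; apply: continuous_scale => //.
  by apply: continuous_add; [exact: continuous_cst|apply: continuous_opp; exact: continuous_en_sub].
have g01 k x : 0 <= g k x <= 1.
  have /andP[a0 a1] := clamp01 (k%:R * f x).
  have /andP[b0 b1] := clamp01 (k%:R * (r - k.+1%:R^-1 - en (x - z))).
  by rewrite /g mulr_ge0//= mulr_ile1.
have gI k : \int[leb R n]_x (w x * g k x) = 0.
  apply: (hphi (s := r - k.+1%:R^-1)) => //.
    by rewrite ltrBlDr ltrDl invr_gt0.
  move=> x sx; rewrite /g [X in _ * X]clamp0 ?mulr0//.
  by rewrite mulr_ge0_le0// subr_le0 ltW.
have cv : \int[leb R n]_x (w x * g k x) @[k --> \oo] -->
    \int[leb R n]_x (w x * \1_[set x | 0 < f x] x).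
  have mg k : measurable_fun (setT : set (Rn R n)) (fun x => w x * g k x).
    exact: (measurable_funM mw (continuous_measurable_row (cg k))).
  apply: (dominated_Rintegral_cvg mg _ (integrable_norm hw)).
    move=> x; have [bx|nbx] := pselect (eball z r x); last first.
      by rewrite w0// mul0r; under eq_fun do rewrite mul0r; exact: cvg_cst.
    apply: cvgMr; rewrite indicE; have [fx|fx] := ltP 0 (f x).
      rewrite mem_set//; apply: cvg_near_cst.
      move: bx; rewrite eballE => bx; pose a := r - en (x - z).
      have a0 : 0 < a by rewrite subr_gt0.
      have a20 : 0 < a / 2 by rewrite divr_gt0.
      near=> k; rewrite /g.
      have -> : clamp (k%:R * f x) = 1 by near: k; exact: clamp_cvg.
      rewrite mul1r; apply: clamp1.
      have k0 : (0 < k)%N by near: k; exact: nbhs_infty_gt.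
      have H1 : k.+1%:R^-1 <= a / 2.
        rewrite invf_ple ?posrE//; apply: (@le_trans _ _ k%:R); last by rewrite ler_nat.
        near: k; exact: nbhs_infty_ger.
      have H2 : (a / 2)^-1 <= k%:R by near: k; exact: nbhs_infty_ger.
      apply: (@le_trans _ _ (k%:R * (a / 2))); first by rewrite -ler_pdivrMr// div1r.
      rewrite ler_wpM2l//; move: H1; rewrite /a; move: (k.+1%:R^-1) => t; lra.
    rewrite memNset; last by rewrite /= ltNge fx.
    apply: cvg_near_cst; apply: nearW => k.
    by rewrite /g clamp0 ?mul0r// mulr_ge0_le0.
  move=> k x; have /andP[g0 g1] := g01 k x.
  by rewrite normrM (ger0_norm g0) ler_piMr.
have cv0 : \int[leb R n]_x (w x * g k x) @[k --> \oo] --> (0 : R).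
  by under eq_cvg do rewrite gI; exact: cvg_cst.
by rewrite -(cvg_lim _ cv)// (cvg_lim _ cv0).
Unshelve. all: end_near. Qed.

Let Hlambda : lambda_system setT H.
Proof.
split => //.
- apply: HG; exists (fun=> 1); first by split; [exact: continuous_cst|].
  by apply/seteqP; split => x /=; rewrite ltr01.
- move=> A B BA [mA iA] [mB iB]; split; first exact: measurableD.
  have -> : (fun x => w x * \1_(A `\` B) x) = (fun x => w x * \1_A x - w x * \1_B x).
    apply/funext => x; rewrite -mulrBr; congr (_ * _).
    rewrite !indicE; have [Bx|nBx] := pselect (B x).
      have nAB : ~ (A `\` B) x by case.
      by rewrite (memNset nAB) (mem_set Bx) (mem_set (BA x Bx)) subrr.
    rewrite (memNset nBx) subr0; have [Ax|nAx] := pselect (A x).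
      by rewrite !mem_set.
    have nAB : ~ (A `\` B) x by case.
    by rewrite !memNset.
  by rewrite RintegralB ?iA ?iB ?subrr//; exact: itgI.
- move=> F ndF HF; split; first by apply: bigcupT_measurable => k; case: (HF k).
  have cv : \int[leb R n]_x (w x * \1_(F k) x) @[k --> \oo] -->
      \int[leb R n]_x (w x * \1_(\bigcup_k F k) x).
    have mg k : measurable_fun (setT : set (Rn R n)) (fun x => w x * \1_(F k) x).
      by case: (HF k) => mFk _; exact: (measurable_funM mw (measurable_indic mFk)).
    apply: (dominated_Rintegral_cvg mg _ (integrable_norm hw)); last first.
      move=> k x; rewrite normrM ler_piMr// indicE.
      by case: (_ \in _); rewrite ?normr1 ?normr0 ?ler01.
    move=> x; apply: cvgMr; apply: cvg_near_cst.
    have [[k0 _ Fx]|nF] := pselect ((\bigcup_k F k) x).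
      have UF : (\bigcup_k F k) x by exists k0.
      near=> k; have Fkx : F k x.
        have : (k0 <= k)%N by near: k; exact: nbhs_infty_ge.
        by move=> /ndF/subsetPset; apply.
      by rewrite !indicE (mem_set Fkx) (mem_set UF).
    apply: nearW => k; have nFk : ~ F k x by move=> Fx; apply: nF; exists k.
    by rewrite !indicE (memNset nFk) (memNset nF).
  have cv0 : \int[leb R n]_x (w x * \1_(F k) x) @[k --> \oo] --> (0 : R).
    by under eq_cvg do rewrite (proj2 (HF _)); exact: cvg_cst.
  by rewrite -(cvg_lim _ cv)// (cvg_lim _ cv0).
Unshelve. all: end_near. Qed.

Let H_row (B : set (n.-tuple (measurableTypeR R))) : measurable B ->
  H (@tuple_of_row R n @^-1` B).
Proof.
move=> /measurable_positivity_row.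
by apply: (lambda_system_subset (@positivity_setsI R n) Hlambda HG).
Qed.

(** The set where [w > 0] need not be Borel. Its Borel hull has the same measure, so [w] integrates
    to 0 over both, and a nonnegative function of integral 0 vanishes almost everywhere. The
    opposite inequality will come from [- w]. *)
Lemma ae_le0_test : {ae leb R n, forall x, w x <= 0}.
Proof.
pose E : set (Rn R n) := [set x | 0 < w x].
have mE : measurable E.
  have := mw measurableT (measurable_itv `]0, +oo[).
  rewrite setTI; congr measurable.
  by apply/seteqP; split => x /=; rewrite in_itv/= andbT.
have Efin : (leb_outer R n E < +oo)%E.
  apply: (le_lt_trans _ (leb_cube_fin z r)); apply: le_measure; rewrite ?inE//.
    exact: measurable_cube.
  move=> x Ex; apply: en_le_cube; rewrite leNgt; apply/negP => rx.
  by move: Ex; rewrite /E /= w0 ?ltxx// eballE; apply/negP; rewrite -leNgt ltW.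
have [B mB [EB muB]] := leb_hull Efin.
pose E' : set (Rn R n) := @tuple_of_row R n @^-1` B.
have [mE' iE'] := H_row mB; rewrite -/E' in mE' iE' EB.
have lE' : leb R n E' = leb_outer R n E by rewrite /E' (leb_row mB) muB.
have DE : leb R n (E' `\` E) = 0%E.
  rewrite (measureD mE' mE); last by move: Efin; rewrite -lE'.
  rewrite (setIidr EB) [X in (X - _)%E]lE' -[leb R n E]/(leb_outer R n E) subee//.
  by rewrite ge0_fin_numE//; exact: outer_measure_ge0.
have iE : \int[leb R n]_x (w x * \1_E x) = 0.
  rewrite -iE'; apply: ae_eq_Rintegral.
  - by apply/measurable_EFinP; case/integrableP : (itgI mE).
  - by apply/measurable_EFinP; case/integrableP : (itgI mE').
  exists (E' `\` E); split => //; first exact: measurableD.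
  move=> x /=; apply: contra_notP => nx; rewrite !indicE; congr (_ * _).
  have [Ex|nEx] := pselect (E x); first by rewrite !mem_set//; exact: EB.
  by rewrite !memNset// => E'x; apply: nx.
have : (\int[leb R n]_x `|(w x * \1_E x)%:E| = 0)%E.
  have E0 x : 0 <= w x * \1_E x.
    rewrite indicE; have [Ex|nEx] := pselect (E x); last by rewrite memNset// mulr0.
    by rewrite mem_set// mulr1 ltW.
  under eq_integral do rewrite gee0_abs ?lee_fin//.
  move: iE; rewrite /Rintegral => iE.
  by rewrite -[LHS]fineK ?iE//; apply: integrable_fin_num => //; exact: itgI.
have mwE : measurable_fun (setT : set (Rn R n)) (fun x => (w x * \1_E x)%:E).
  by case/integrableP : (itgI mE).
move=> /(ae_eq_integral_abs _ measurableT mwE) H0.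
apply: filterS H0 => x /= /(_ I) [H0]; rewrite leNgt; apply/negP => wx.
by move: H0; rewrite indicE mem_set// mulr1 => H0; rewrite H0 ltxx in wx.
Qed.

End fundamental_lemma.


(** * Symmetry of mollification, by Fubini *)

Section fubini_kernel.
Context d (T : measurableType d) (R : realType).

Lemma Rintegral_kernel_swap_sf (mu : {sigma_finite_measure set T -> \bar R})
    (f u : T -> R) (K : T * T -> R) (M : R) :
  mu.-integrable setT (EFin \o f) -> mu.-integrable setT (EFin \o u) ->
  measurable_fun setT K -> (forall z, `|K z| <= M) ->
  \int[mu]_x (f x * \int[mu]_y (u y * K (x, y))) =
  \int[mu]_y (u y * \int[mu]_x (f x * K (x, y))).
Proof.
move=> hf hu mK KM.
have mu1 : measurable_fun setT u by apply/measurable_EFinP; case/integrableP : hu.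
have mf1 : measurable_fun setT f by apply/measurable_EFinP; case/integrableP : hf.
have mKx x : measurable_fun setT (fun y => K (x, y)).
  exact: (measurableT_comp mK (measurable_pair1 x)).
have mKy y : measurable_fun setT (fun x => K (x, y)).
  exact: (measurableT_comp mK (measurable_pair2 y)).
have iux x : mu.-integrable setT (EFin \o (fun y => u y * K (x, y))).
  by apply: (integrable_mul_bounded (M := M) hu (mKx x)).
have ify y : mu.-integrable setT (EFin \o (fun x => f x * K (x, y))).
  by apply: (integrable_mul_bounded (M := M) hf (mKy y)).
pose g (z : T * T) : \bar R := (f z.1 * (u z.2 * K z))%:E.
have mg : measurable_fun setT g.
  apply/measurable_EFinP.
  apply: measurable_funM; first exact: (measurableT_comp mf1 measurable_fst).
  by apply: measurable_funM => //; exact: (measurableT_comp mu1 measurable_snd).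
have E1 x : (\int[mu]_y g (x, y) = (f x * \int[mu]_y (u y * K (x, y)))%:E)%E.
  rewrite -RintegralZl// /Rintegral fineK//.
  exact/integrable_fin_num/integrable_scale.
have E2 y : (\int[mu]_x g (x, y) = (u y * \int[mu]_x (f x * K (x, y)))%:E)%E.
  rewrite -RintegralZl// /Rintegral fineK//.
    by apply: eq_integral => x _; rewrite /g /=; congr (_%:E); ring.
  exact/integrable_fin_num/integrable_scale.
have intg : (mu \x mu)%E.-integrable setT g.
  apply: (proj2 (integrable12ltyP mu mu mg)).
  apply: (@le_lt_trans _ _ (\int[mu]_x (`|f x| * (M * \int[mu]_y `|u y|))%:E)%E).
    apply: ge0_le_integral => //.
    - by move=> x _; apply: integral_ge0 => y _.
    - have mag : measurable_fun setT (fun z => `|g z|%E) by exact: measurableT_comp.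
      by apply: (measurable_fun_fubini_tonelli_F (m2 := mu) (fun z => `|g z|%E)).
    - apply/measurable_EFinP; apply: measurable_funM => //.
      exact: measurableT_comp.
    move=> x _; rewrite -RintegralZl//; last exact: integrable_norm.
    rewrite -RintegralZl//; last exact/integrable_scale/integrable_norm.
    rewrite /Rintegral fineK; last first.
      exact/integrable_fin_num/integrable_scale/integrable_scale/integrable_norm.
    apply: ge0_le_integral => //.
    - exact/measurableT_comp/(measurableT_comp mg)/measurable_pair1.
    - apply/measurable_EFinP; do 2!apply: measurable_funM => //.
      exact: measurableT_comp.
    move=> y _; rewrite /g /= lee_fin !normrM ler_wpM2l//.
    by rewrite mulrC ler_wpM2r.
  have : mu.-integrable setT (EFin \o (fun x => `|f x| * (M * \int[mu]_y `|u y|))).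
    have -> : (fun x => `|f x| * (M * \int[mu]_y `|u y|)) =
       (fun x => (M * \int[mu]_y `|u y|) * `|f x|) by apply/funext => x; rewrite mulrC.
    exact/integrable_scale/integrable_norm.
  move=> /(integrable_fin_num measurableT); rewrite ge0_fin_numE//.
  by apply: integral_ge0 => x _; rewrite lee_fin !mulr_ge0//; [exact: le_trans (normr_ge0 _) (KM (x, x))|exact: Rintegral_ge0].
have := Fubini intg.
rewrite (eq_integral _ _ (fun x _ => E1 x)) (eq_integral _ _ (fun y _ => E2 y)).
by rewrite /Rintegral => ->.
Qed.

Section sigma_finite_alias.
Context (mu : {measure set T -> \bar R}) (sf : sigma_finite setT mu).

(** A copy of [mu] carrying the proof [sf] as a canonical instance, so that Fubini, stated for
    sigma-finite measures, applies to [leb] through [leb_sigma_finite]. *)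
Definition sigma_finite_alias : set T -> \bar R := mu.
Let nu := sigma_finite_alias.
HB.instance Definition _ := Measure.copy nu mu.
HB.instance Definition _ := Measure_isSigmaFinite.Build _ _ _ nu sf.

Lemma Rintegral_kernel_swap (f u uK fK : T -> R) (K : T * T -> R) (M : R) :
  mu.-integrable setT (EFin \o f) -> mu.-integrable setT (EFin \o u) ->
  measurable_fun setT K -> (forall z, `|K z| <= M) ->
  (forall x, uK x = \int[mu]_y (u y * K (x, y))) ->
  (forall y, fK y = \int[mu]_x (f x * K (x, y))) ->
  \int[mu]_x (f x * uK x) = \int[mu]_y (u y * fK y).
Proof.
move=> hf hu mK KM uKE fKE.
transitivity (\int[mu]_x (f x * \int[mu]_y (u y * K (x, y)))).
  by apply: eq_Rintegral => x _; rewrite uKE.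
transitivity (\int[mu]_y (u y * \int[mu]_x (f x * K (x, y)))); last first.
  by apply: eq_Rintegral => y _; rewrite fKE.
exact: (@Rintegral_kernel_swap_sf nu f u K M).
Qed.

End sigma_finite_alias.

End fubini_kernel.

Section fubini.
Context (R : realType) (n : nat).
Local Notation V := 'rV[R]_n.
Local Notation itg f := ((leb R n).-integrable setT (EFin \o f)).

Lemma leb_sigma_finite : sigma_finite setT (leb R n).
Proof.
exists (fun k => cube 0 k%:R); last first.
  by move=> k; split; [exact: measurable_cube|exact: leb_cube_fin].
apply/esym/seteqP; split => // x _.
exists (Num.truncn (en x)).+1 => //.
by apply: en_le_cube; rewrite subr0 ltW// truncnS_gt.
Qed.

Lemma measurable_ev_comp d (T : measurableType d) (g : T -> V) (e : sexp R n) :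
  (forall i, measurable_fun setT (fun t => g t ord0 i)) ->
  measurable_fun setT (fun t => ev e (g t)).
Proof.
move=> mg; elim: e => [c|i|a iha b ihb|a iha b ihb|k a iha].
- exact: measurable_cst.
- exact: mg.
- exact: measurable_funD.
- exact: measurable_funM.
- exact: (measurableT_comp (continuous_measurable_fun (@continuous_th R k)) iha).
Qed.

(** Mollification is self-adjoint because [rho0] is even. *)
Lemma Rintegral_cv (u f : V -> R) (c : R) : itg u -> itg f ->
  \int[leb R n]_x (f x * cv u (rho0 R n) c x) =
  \int[leb R n]_y (u y * cv f (rho0 R n) c y).
Proof.
move=> hu hf; have sr := @usupp_rho0 R n; have [M [M0 HM]] := usupp_bounded sr.
pose K (z : Rn R n * Rn R n) : R := ev (rho0 R n) (c *: ((z.2 : V) - z.1)).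
have mK : measurable_fun setT K.
  apply: measurable_ev_comp => i.
  under eq_fun do rewrite !mxE.
  apply: measurable_funM; first exact: measurable_cst.
  apply: measurable_funB.
    exact: (measurableT_comp (measurable_coord i) measurable_snd).
  exact: (measurableT_comp (measurable_coord i) measurable_fst).
apply: (Rintegral_kernel_swap leb_sigma_finite hf hu mK (fun z => HM _)) => [//|y].
rewrite /cv; apply: eq_Rintegral => x _; congr (_ * _).
by rewrite /K /= -(opprB x y) scalerN ev_rho0N.
Qed.

End fubini.


(** * Increments of the mollification in the scale *)

Section increments.
Context (R : realType).

(** Both [B + f] and [B - f] have a nonnegative derivative. *)
Lemma mean_increment (f B f' b : R -> R) (s t : R) : s <= t ->
  (forall x, s <= x <= t -> is_derive x (1 : R) f (f' x)) ->
  (forall x, s <= x <= t -> is_derive x (1 : R) B (b x)) ->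
  (forall x, s <= x <= t -> `|f' x| <= b x) -> `|f t - f s| <= B t - B s.
Proof.
move=> st df dB fb.
have mono (g g' : R -> R) : (forall x, s <= x <= t -> is_derive x (1 : R) g (g' x)) ->
    (forall x, s <= x <= t -> 0 <= g' x) -> g s <= g t.
  move=> dg g0; rewrite -subr_ge0.
  have [] := @MVT_segment R g g' s t st.
  - by move=> x; rewrite in_itv/= => /andP[/ltW sx /ltW xt]; apply: dg; rewrite sx.
  - apply: derivable_within_continuous => x; rewrite in_itv/= => xst.
    by case: (dg x xst).
  move=> c; rewrite in_itv/= => cst ->.
  by rewrite mulr_ge0 ?subr_ge0// g0.
rewrite ler_norml; apply/andP; split.
  have := mono (fun x => f x + B x) (fun x => f' x + b x).
  move=> /(_ (fun x h => is_derive_add (df x h) (dB x h))) H.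
  have : f s + B s <= f t + B t.
    by apply: H => x /fb; rewrite ler_norml => /andP[? _]; lra.
  lra.
have := mono (fun x => B x + - f x) (fun x => b x + - f' x).
move=> /(_ (fun x h => is_derive_add (dB x h) (is_derive_opp (df x h)))) H.
have : B s + - f s <= B t + - f t.
  by apply: H => x /fb; rewrite ler_norml => /andP[_ ?]; lra.
lra.
Qed.

Lemma lim_increment (f : R -> R) (C t0 : R) : 0 < t0 -> 0 <= C ->
  (forall s t, 0 < s -> s <= t -> t <= t0 -> `|f t - f s| <= C * t) ->
  cvgn (fun k => f k.+1%:R^-1).
Proof.
move=> t00 C0 H; apply/cauchy_cvgP/cauchy_exP => e e0.
pose d := Num.min t0 (e / (C + 1)).
have d0 : 0 < d by rewrite lt_min t00 divr_gt0// ltr_pwDr.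
pose k0 := Num.truncn d^-1.
have kd : k0.+1%:R^-1 < d by rewrite invf_plt ?posrE// truncnS_gt.
exists (f k0.+1%:R^-1); exists k0 => // k /= k0k.
rewrite /ball/=.
have h1 : k.+1%:R^-1 <= k0.+1%:R^-1 :> R by rewrite lef_pV2 ?posrE// ler_nat ltnS.
apply: (le_lt_trans (H _ _ _ h1 _)); first by rewrite invr_gt0.
  by apply: (le_trans (ltW kd)); rewrite ge_min lexx.
apply: (@le_lt_trans _ _ (C * (e / (C + 1)))).
  by rewrite ler_wpM2l// (le_trans (ltW kd))// ge_min lexx orbT.
by rewrite mulrCA gtr_pMr// ltr_pdivrMr ?ltr_pwDr// mul1r ltrDl.
Qed.

Lemma le_lim_increment (f : R -> R) (b t : R) : 0 < t ->
  cvgn (fun k => f k.+1%:R^-1) ->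
  (forall s, 0 < s -> s <= t -> `|f t - f s| <= b) ->
  `|f t - limn (fun k => f k.+1%:R^-1)| <= b.
Proof.
move=> t0 cf H.
have cv : `|f t - f k.+1%:R^-1| @[k --> \oo] --> `|f t - limn (fun k => f k.+1%:R^-1)|.
  by apply: cvg_norm; apply: cvgB => //; exact: cvg_cst.
rewrite -(cvg_lim _ cv)//; apply: limr_le; first by apply/cvg_ex; eexists; exact: cv.
exists (Num.truncn t^-1) => // k /= hk; apply: H; first by rewrite invr_gt0.
rewrite invf_ple ?posrE//; apply: (le_trans (ltW (truncnS_gt t^-1))).
by rewrite ler_nat ltnS.
Qed.

End increments.

Section almost_everywhere.
Context d (T : measurableType d) (R : realType) (mu : {measure set T -> \bar R}).

Lemma ae_imp (P Q : T -> Prop) : (forall x, P x -> Q x) ->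
  {ae mu, forall x, P x} -> {ae mu, forall x, Q x}.
Proof. by move=> PQ; apply: filterS. Qed.

Lemma ae_and (P Q : T -> Prop) : {ae mu, forall x, P x} -> {ae mu, forall x, Q x} ->
  {ae mu, forall x, P x /\ Q x}.
Proof. by move=> aP aQ; apply: filterS2 aP aQ. Qed.

End almost_everywhere.

Section local_solution.
Context (R : realType) (n : nat).
Local Notation V := 'rV[R]_n.
Local Notation itg f := ((leb R n).-integrable setT (EFin \o f)).
Implicit Types (e : sexp R n) (u L : V -> R) (x z : V).

(* [u] and [L] are related by [Delta u = L] in the ball of radius [D] at [z],
   tested with the rescaled translates of the bumps [e]. *)
Definition weq z (D : R) u L := forall e x t, usupp e -> 0 < t ->
  en (x - z) + t < D -> cv u (lap e) t^-1 x = t ^+ 2 * cv L e t^-1 x.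

Lemma ker_support e x y (t : R) : usupp e -> 0 < t -> t < en (y - x) ->
  ev e (t^-1 *: (y - x)) = 0.
Proof.
move=> se t0 H; apply: se; rewrite nsqZ -sqr_en -exprMn exprn_egt1//.
by rewrite mulrC ltr_pdivlMr// mul1r.
Qed.

Lemma ker_cube e x y (t : R) : usupp e -> 0 < t -> ~ cube x t y ->
  ev e (t^-1 *: (y - x)) = 0.
Proof.
move=> se t0 H; apply: ker_support => //; rewrite ltNge; apply/negP => yx.
by apply: H; exact: en_le_cube.
Qed.

Lemma cv_bound u e x (t H M : R) : itg u -> usupp e -> 0 < t -> 0 <= H ->
  (forall y, `|ev e y| <= M) -> {ae leb R n, forall y, en (y - x) <= t -> `|u y| <= H} ->
  `|cv u e t^-1 x| <= H * M * (2 * t) ^+ n.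
Proof.
move=> hu se t0 H0 HM aeH.
have M0 : 0 <= M by exact: le_trans (normr_ge0 _) (HM 0).
have ic := integrable_cv t^-1 x hu se.
apply: le_trans (le_normr_Rintegral measurableT ic) _.
have ib : itg (fun y => H * M * \1_(cube x t) y).
  apply: integrable_scale; apply: integrable_indic_fin; [exact: measurable_cube|exact: leb_cube_fin].
apply: (@le_trans _ _ (\int[leb R n]_y (H * M * \1_(cube x t) y))).
  apply: ae_le_Rintegral; [exact: integrable_norm|exact: ib|].
  apply: (ae_imp _ aeH) => y Hy; rewrite indicE.
  have [cy|ncy] := pselect (cube x t y); last first.
    by rewrite (ker_cube se t0 ncy) mulr0 normr0 (memNset ncy) mulr0.
  rewrite (mem_set cy) mulr1 normrM.
  have [ty|ty] := ltP t (en (y - x)); last by rewrite ler_pM// Hy.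
  by rewrite (ker_support se t0 ty) normr0 mulr0 mulr_ge0.
apply: (@Rintegral_le_cube _ _ _ _ _ x); [exact: ltW|exact: ib| |].
  by move=> y cy; rewrite indicE (mem_set cy) mulr1.
by move=> y cy; rewrite indicE (memNset cy) mulr0.
Qed.

Lemma ev_Pk_le1 y : `|ev (Pk R n) y| <= 1.
Proof.
rewrite ger0_norm ?ev_Pk_ge0// ev_Pk /th; case: ifPn => // h.
by rewrite expr0 mul1r -[leRHS]expR0 ler_expR oppr_le0 invr_ge0 ltW.
Qed.

Lemma is_derive_mol_weq z D u L x (t : R) : itg u -> weq z D u L -> 0 < t ->
  en (x - z) + t < D ->
  is_derive t (1 : R) (fun t => mol u t x) (t * t ^- n * cv L (Pk R n) t^-1 x).
Proof.
move=> hu hw t0 tD; have := is_derive_mol x hu t0.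
rewrite (hw _ _ _ (@usupp_Pk R n) t0 tD) mulrA.
suff -> : t ^- n.+1 * t ^+ 2 = t * t ^- n by [].
rewrite exprS invfM -mulrA [_ ^- n * _]mulrC mulrA expr2 !mulrA mulVf ?gt_eqF// mul1r.
by [].
Qed.

(** The scale derivative [r^(1-n) cv L Pk] is at most [2^n H r], since [Pk <= 1] and the kernel
    lives in a cube of volume [(2 r)^n]. *)
Lemma mol_increment_bounded z D u L x (s t H : R) : itg u -> itg L ->
  weq z D u L -> 0 < s -> s <= t -> en (x - z) + t < D -> 0 <= H ->
  {ae leb R n, forall y, en (y - x) <= t -> `|L y| <= H} ->
  `|mol u t x - mol u s x| <= 2 ^+ n * H * t ^+ 2.
Proof.
move=> hu hL hw s0 st tD H0 aeH.
pose B (r : R) := 2 ^+ n * H * 2^-1 * r ^+ 2.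
apply: (@le_trans _ _ (B t - B s)); last first.
  rewrite /B; have : 0 <= 2 ^+ n * H * 2^-1 * s ^+ 2 by rewrite !mulr_ge0 ?exprn_ge0// ltW.
  have : 0 <= 2 ^+ n * H * t ^+ 2 by rewrite !mulr_ge0 ?exprn_ge0// (le_trans (ltW s0)).
  by set a := 2 ^+ n * H; rewrite [a * _ * _]mulrAC; lra.
apply: (@mean_increment _ (fun r => mol u r x) B (fun r => r * r ^- n * cv L (Pk R n) r^-1 x)
  (fun r => 2 ^+ n * H * r)) => // r /andP[sr rt].
- apply: is_derive_mol_weq hw _ _ => //; first exact: lt_le_trans sr.
  by apply: le_lt_trans tD; rewrite lerD2l.
- have := is_derive_scale (2 ^+ n * H * 2^-1) (is_derive_exp 2 (is_derive_id r (1 : R))).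
  by rewrite /= expr1 mulr1 mulrA -[_ * 2^-1 * 2%:R]mulrA mulVf ?mulr1.
have r0 : 0 < r by exact: lt_le_trans sr.
have := @cv_bound L (Pk R n) x r H 1 hL (@usupp_Pk R n) r0 H0 ev_Pk_le1.
have aeHr : {ae leb R n, forall y, en (y - x) <= r -> `|L y| <= H}.
  by apply: (ae_imp _ aeH) => y Hy yr; apply: Hy; exact: le_trans rt.
move=> /(_ aeHr); rewrite mulr1 => Hb.
rewrite normrM (ger0_norm (_ : 0 <= r * r ^- n)); last first.
  by rewrite mulr_ge0 ?invr_ge0 ?exprn_ge0// ltW.
apply: (@le_trans _ _ (r * r ^- n * (H * (2 * r) ^+ n))).
  by rewrite ler_wpM2l// mulr_ge0 ?invr_ge0 ?exprn_ge0// ltW.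
rewrite exprMn le_eqVlt; apply/orP; left; apply/eqP.
have rn : r ^+ n != 0 by rewrite expf_neq0// gt_eqF.
by field.
Qed.

(** This replaces Hoelder's inequality: [|L| <= 1/t + (1/t) (t |L|)^m] pointwise, because
    [b <= 1 + b^m] for [b >= 0] and [m >= 1]. *)
Lemma cv_bound_power L x (t m : R) : itg L -> 1 <= m -> 0 < t ->
  itg (fun y => `|L y| `^ m) ->
  `|cv L (Pk R n) t^-1 x| <=
    t^-1 * ((2 * t) ^+ n + t `^ m * \int[leb R n]_y (`|L y| `^ m)).
Proof.
move=> hL m1 t0 hLm; have se := @usupp_Pk R n.
have ic := integrable_cv t^-1 x hL se.
have icu : itg (\1_(cube x t) : V -> R).
  by apply: integrable_indic_fin; [exact: measurable_cube|exact: leb_cube_fin].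
apply: le_trans (le_normr_Rintegral measurableT ic) _.
have ib : itg (fun y => t^-1 * \1_(cube x t) y + t^-1 * t `^ m * `|L y| `^ m).
  by apply: integrable_add; apply: integrable_scale.
apply: (@le_trans _ _ (\int[leb R n]_y (t^-1 * \1_(cube x t) y + t^-1 * t `^ m * `|L y| `^ m))).
  apply: le_Rintegral; [exact: measurableT|exact: integrable_norm|exact: ib|].
  move=> y _; rewrite indicE normrM.
  have [cy|ncy] := pselect (cube x t y); last first.
    rewrite (ker_cube se t0 ncy) normr0 mulr0 (memNset ncy) mulr0 add0r.
    by rewrite !mulr_ge0 ?powR_ge0// invr_ge0 ltW.
  rewrite (mem_set cy) mulr1; apply: (@le_trans _ _ `|L y|).
    by rewrite ler_piMr// ev_Pk_le1.
  have -> : t^-1 + t^-1 * t `^ m * `|L y| `^ m = (1 + (t * `|L y|) `^ m) / t.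
    by rewrite powRM ?(ltW t0)//; ring.
  rewrite ler_pdivlMr// mulrC.
  have [a1|a1] := leP (t * `|L y|) 1; first by rewrite (le_trans a1)// lerDl powR_ge0.
  apply: (@le_trans _ _ ((t * `|L y|) `^ m)); last by rewrite lerDr.
  by rewrite -[leLHS]powRr1 ?ler_powR// ?ltW// (lt_trans ltr01).
rewrite RintegralD; [|exact: measurableT|exact: integrable_scale..].
rewrite RintegralZl; [|exact: measurableT|exact: icu].
rewrite RintegralZl; [|exact: measurableT|exact: hLm].
rewrite mulrDr mulrA lerD2r ler_wpM2l ?invr_ge0 ?(ltW t0)//.
rewrite -[leRHS]mul1r; apply: (@Rintegral_le_cube _ _ _ _ _ x); [exact: ltW|exact: icu| |].
  by move=> y cy; rewrite indicE (mem_set cy).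
by move=> y cy; rewrite indicE (memNset cy).
Qed.

(** After multiplication by [r^(1-n)], the term with the [m]-th power carries [r^(m-n) <= 1].
    Integrability above the dimension thus keeps the scale derivative bounded, and the
    mollifications converge although [L] may be unbounded. *)
Lemma mol_increment_power z D u L x (s t m : R) : itg u -> itg L -> 1 <= m -> n%:R <= m ->
  itg (fun y => `|L y| `^ m) ->
  weq z D u L -> 0 < s -> s <= t -> t <= 1 -> en (x - z) + t < D ->
  `|mol u t x - mol u s x| <= (2 ^+ n + \int[leb R n]_y (`|L y| `^ m)) * t.
Proof.
move=> hu hL m1 nm hLm hw s0 st t1 tD.
set K := \int[leb R n]_y (`|L y| `^ m).
have K0 : 0 <= K by apply: Rintegral_ge0 => y _; exact: powR_ge0.
pose B (r : R) := (2 ^+ n + K) * r.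
apply: (@le_trans _ _ (B t - B s)); last first.
  by rewrite /B gerBl mulr_ge0 ?(ltW s0)// addr_ge0// exprn_ge0.
apply: (@mean_increment _ (fun r => mol u r x) B (fun r => r * r ^- n * cv L (Pk R n) r^-1 x)
  (fun r => 2 ^+ n + K)) => // r /andP[sr rt].
- apply: is_derive_mol_weq hw _ _ => //; first exact: lt_le_trans sr.
  by apply: le_lt_trans tD; rewrite lerD2l.
- by have := is_derive_scale (2 ^+ n + K) (is_derive_id r (1 : R)); rewrite mulr1.
have r0 : 0 < r by exact: lt_le_trans sr.
have Hb := cv_bound_power x hL m1 r0 hLm; rewrite -/K in Hb.
have rn0 : 0 < r ^+ n by rewrite exprn_gt0.
rewrite normrM (ger0_norm (_ : 0 <= r * r ^- n)); last first.
  by rewrite mulr_ge0 ?invr_ge0 ?exprn_ge0// ltW.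
apply: (@le_trans _ _ (r * r ^- n * (r^-1 * ((2 * r) ^+ n + r `^ m * K)))).
  by rewrite ler_wpM2l// mulr_ge0 ?invr_ge0 ?exprn_ge0// ltW.
have -> : r * r ^- n * (r^-1 * ((2 * r) ^+ n + r `^ m * K)) = 2 ^+ n + r ^- n * r `^ m * K.
  rewrite exprMn; have rn : r ^+ n != 0 by rewrite gt_eqF.
  have rr : r != 0 by rewrite gt_eqF.
  by field; rewrite ?rn ?rr.
rewrite lerD2l ler_piMl// mulrC ler_pdivrMr// mul1r -powR_mulrn ?(ltW r0)//.
by rewrite ger_powR// r0 (le_trans rt).
Qed.

End local_solution.


Section integrable_dominated.
Context d (T : measurableType d) (R : realType) (mu : {measure set T -> \bar R}).

Lemma integrable_dominated (f g : T -> R) : measurable_fun setT f ->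
  mu.-integrable setT (EFin \o g) -> (forall x, `|f x| <= g x) ->
  mu.-integrable setT (EFin \o f).
Proof.
move=> mf intg fg; apply: le_integrable intg => //; first exact/measurable_EFinP.
by move=> x _ /=; rewrite lee_fin (le_trans (fg x))// ler_norm.
Qed.

End integrable_dominated.

(** * The mass of the bump and normalised mollification *)

Section bump_mass.
Context (R : realType) (n : nat).
Local Notation V := 'rV[R]_n.
Local Notation itg f := ((leb R n).-integrable setT (EFin \o f)).
Implicit Types (e : sexp R n) (u L : V -> R) (x z : V).

Lemma integrable_ker e c x : usupp e -> c != 0 -> itg (fun y => ev e (c *: (y - x))).
Proof.
move=> se c0; apply: (@integrable_continuous R n _ x `|c|^-1).
  exact: (@continuous_sc R n e c x).
move=> y ny; apply: (usupp_cube se) => H; apply: ny => i.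
have := H i; rewrite !mxE subr0 normrM => Hi.
by rewrite -(ler_pM2l (_ : 0 < `|c|)) ?normr_gt0// mulfV ?normr_eq0.
Qed.

Definition c0 : R := \int[leb R n]_y ev (rho0 R n) y.

Lemma c0_gt0 : 0 < c0.
Proof.
(* The cube of half-side [1 / (2 (n + 1))] lies in the ball of radius [1/2], where
   [1 - |y|^2 >= 3/4]; hence the exponent [- 4/3] in [dl]. *)
pose r : R := (2 * (n.+1)%:R)^-1.
have r0 : 0 < r by rewrite invr_gt0 mulr_gt0.
pose dl : R := 2 * expR (- (4 / 3)).
have dl0 : 0 < dl by rewrite mulr_gt0// expR_gt0.
have ic : itg (fun y : V => dl * \1_(cube (0 : V) r) y).
  apply: integrable_scale; apply: integrable_indic_fin; [exact: measurable_cube|exact: leb_cube_fin].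
have ir : itg (ev (rho0 R n)).
  have := integrable_ker 0 (@usupp_rho0 R n) (oner_neq0 R).
  by congr (_.-integrable _ _); apply/funext => y; rewrite /= subr0 scale1r.
apply: (@lt_le_trans _ _ (\int[leb R n]_y (dl * \1_(cube (0 : V) r) y))).
  rewrite RintegralZl; [|exact: measurableT|]; last first.
    by apply: integrable_indic_fin; [exact: measurable_cube|exact: leb_cube_fin].
  rewrite mulr_gt0// /Rintegral integral_indic; [|exact: measurableT|exact: measurable_cube].
  by rewrite setIT [X in fine X](leb_cube _ (ltW r0)) /= exprn_gt0// mulr_gt0.
apply: le_Rintegral; [exact: measurableT|exact: ic|exact: ir|] => y _.
rewrite indicE; have [cy|ncy] := pselect (cube 0 r y); last first.
  by rewrite (memNset ncy) mulr0 ev_rho0_ge0.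
rewrite (mem_set cy) mulr1 ev_rho0 /dl ler_pM2l//.
have n1 : en y <= 2^-1.
  have := cube_en (ltW r0) cy; rewrite subr0 => /le_trans; apply.
  rewrite /r invfM mulrCA -[leRHS]mulr1 ler_pM2l// ler_pdivrMr// mul1r ler_nat.
  exact: leqnSn.
have n2 : nsq y <= 4^-1.
  rewrite -sqr_en; apply: (@le_trans _ _ (2^-1 ^+ 2)).
    by rewrite lerXn2r ?nnegrE ?en_ge0.
  by rewrite expr2; lra.
have t0 : 0 < 1 - nsq y by lra.
have t1 : 1 - nsq y <= 1 by rewrite gerBl nsq_ge0.
rewrite /th t0 -[leLHS]mul1r ler_pM// ?expR_ge0//.
  by rewrite exprn_ege1// invf_ge1.
rewrite ler_expR lerN2 invf_ple ?posrE ?divr_gt0//.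
by rewrite invf_div; lra.
Qed.

Lemma Rintegral_ker_lap e c x : usupp e -> c != 0 ->
  \int[leb R n]_y ev (lap e) (c *: (y - x)) = 0.
Proof.
move=> se cn0.
transitivity (\sum_(i <- index_enum 'I_n) \int[leb R n]_y ev (dd i (dd i e)) (c *: (y - x))).
  rewrite -Rintegral_sum; last first.
    by move=> i; apply: integrable_ker => //; do 2!apply: usupp_dd.
  by apply: eq_Rintegral => y _; rewrite ev_lap.
rewrite big1_seq// => i _.
have : \int[leb R n]_y (c * sc (dd i (dd i e)) c x y) = 0.
  apply: (@Rintegral_derive0 R n (sc (dd i e) c x) _ (delta_mx ord0 i) x `|c|^-1).
  - exact: continuous_sc.
  - by apply: continuous_scale; exact: continuous_sc.
  - by move=> y; exact: is_derive_sc_coord.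
  move=> y ny; apply: (usupp_cube (usupp_dd i se)) => H; apply: ny => j.
  have := H j; rewrite !mxE subr0 normrM => Hj.
  by rewrite -(ler_pM2l (_ : 0 < `|c|)) ?normr_gt0// mulfV ?normr_eq0.
rewrite RintegralZl; [|exact: measurableT|by apply: integrable_ker => //; do 2!apply: usupp_dd].
by move=> /eqP; rewrite mulf_eq0 (negbTE cn0)/= => /eqP.
Qed.

(* Apply the derivative of [mol] in [t] to the solution [u = 1], [L = 0]. *)
Lemma Rintegral_rho0 x (t : R) : 0 < t ->
  \int[leb R n]_y ev (rho0 R n) (t^-1 *: (y - x)) = c0 * t ^+ n.
Proof.
(* On a cube of this radius the indicator is 1 on the support of the kernel at scale [t], at scale 1
   and at all scales in between. *)
move=> t0; pose T := t + 2.
pose u : V -> R := \1_(cube x T).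
have hu : itg u by apply: integrable_indic_fin; [exact: measurable_cube|exact: leb_cube_fin].
have uE e s : usupp e -> 0 < s -> s <= T ->
    cv u e s^-1 x = \int[leb R n]_y ev e (s^-1 *: (y - x)).
  move=> se s0 sT; apply: eq_Rintegral => y _; rewrite /u indicE.
  have [cy|ncy] := pselect (cube x T y); first by rewrite (mem_set cy) mul1r.
  rewrite (memNset ncy) mul0r (ker_cube se s0)// => H; apply: ncy => i.
  exact: le_trans (H i) sT.
have E (a b : R) : 0 < a -> a <= b -> b <= T -> mol u b x = mol u a x.
  move=> a0 ab bT; apply/eqP; rewrite -subr_eq0 -normr_le0.
  have H := @mean_increment R (fun t => mol u t x) (fun=> 0)
    (fun t => t ^- n.+1 * cv u (lap (Pk R n)) t^-1 x) (fun=> 0) a b ab.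
  have {}H : `|mol u b x - mol u a x| <= 0 - 0.
    apply: H.
    - by move=> s /andP[as_ _]; apply: is_derive_mol => //; exact: lt_le_trans as_.
    - move=> s /andP[as_ sb]; have s0 : 0 < s by exact: lt_le_trans as_.
      rewrite uE; [|exact/usupp_lap/usupp_Pk|by []|exact: le_trans bT].
      rewrite Rintegral_ker_lap ?mulr0 ?normr0//; first exact: usupp_Pk.
      by rewrite invr_neq0// gt_eqF.
  by apply: (le_trans H); rewrite subrr.
have tT : t <= T by rewrite /T lerDl.
have T1 : 1 <= T by apply: (@le_trans _ _ 2); [rewrite ler1n|rewrite /T lerDr ltW].
have E1 : mol u t x = mol u 1 x.
  by have [t1|/ltW t1] := leP t 1; [apply/esym; exact: E|exact: E].
have sr := @usupp_rho0 R n.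
rewrite /mol (uE _ _ sr t0 tT) (uE _ _ sr ltr01 T1) expr1n invr1 mul1r in E1.
have c0E : c0 = \int[leb R n]_y ev (rho0 R n) (1 *: (y - x)).
  have ir : itg (ev (rho0 R n)).
    have := integrable_ker 0 sr (oner_neq0 R).
    by congr (_.-integrable _ _); apply/funext => y; rewrite /= subr0 scale1r.
  rewrite /c0 -(Rintegral_shift (- x) ir).
  by apply: eq_Rintegral => y _; rewrite scale1r.
have solve (A B : R) : t ^- n * A = B -> c0 = B -> A = c0 * t ^+ n.
  by move=> <- ->; rewrite mulrAC mulVf ?mul1r// expf_neq0// gt_eqF.
exact: (solve _ _ E1 c0E).
Qed.

Lemma cv_rho0_bound u x (t H : R) : itg u -> 0 < t -> 0 <= H ->
  {ae leb R n, forall y, en (y - x) <= t -> `|u y| <= H} ->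
  `|cv u (rho0 R n) t^-1 x| <= H * (c0 * t ^+ n).
Proof.
move=> hu t0 H0 aeH; have se := @usupp_rho0 R n.
have ic := integrable_cv t^-1 x hu se.
have ik : itg (fun y => ev (rho0 R n) (t^-1 *: (y - x))).
  by apply: integrable_ker => //; rewrite invr_neq0// gt_eqF.
rewrite -(Rintegral_rho0 x t0).
apply: le_trans (le_normr_Rintegral measurableT ic) _.
rewrite -RintegralZl; [|exact: measurableT|exact: ik].
apply: ae_le_Rintegral; [exact: integrable_norm|exact: integrable_scale|].
apply: (ae_imp _ aeH) => y Hy; rewrite normrM [X in _ * X]ger0_norm ?ev_rho0_ge0//.
have [ty|ty] := ltP t (en (y - x)); first by rewrite (ker_support se t0 ty) !mulr0.
by rewrite ler_wpM2r ?ev_rho0_ge0// Hy.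
Qed.

Definition molc u t x : R := c0^-1 * mol u t x.

Lemma molc_bound u x (t H : R) : itg u -> 0 < t -> 0 <= H ->
  {ae leb R n, forall y, en (y - x) <= t -> `|u y| <= H} -> `|molc u t x| <= H.
Proof.
move=> hu t0 H0 aeH; have K := cv_rho0_bound hu t0 H0 aeH.
have tn0 : 0 < t ^+ n by rewrite exprn_gt0.
have cp := c0_gt0.
rewrite /molc /mol !normrM (ger0_norm (_ : 0 <= c0^-1)) ?invr_ge0 ?(ltW cp)//.
rewrite (ger0_norm (_ : 0 <= t ^- n)) ?invr_ge0 ?(ltW tn0)//.
have -> : c0^-1 * (t ^- n * `|cv u (rho0 R n) t^-1 x|) = `|cv u (rho0 R n) t^-1 x| / (c0 * t ^+ n).
  by rewrite mulrA -invfM mulrC.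
by rewrite ler_pdivrMr ?mulr_gt0.
Qed.

Lemma molcE u t x : molc u t x = c0^-1 * (t ^- n * cv u (rho0 R n) t^-1 x).
Proof. by []. Qed.

(** [limn] is meaningful only where the sequence converges; [mol_cvgn] provides this on the ball
    under consideration. *)
Definition ut u x : R := c0^-1 * limn (fun k => mol u k.+1%:R^-1 x).

Lemma ut_eq0 u x (r : R) : itg u -> 0 < r ->
  {ae leb R n, forall y, en (y - x) <= r -> u y = 0} -> ut u x = 0.
Proof.
move=> hu r0 aeu; rewrite /ut.
have -> : limn (fun k => mol u k.+1%:R^-1 x) = 0; last by rewrite mulr0.
apply: cvg_lim => //; apply: cvg_near_cst.
exists (Num.truncn r^-1) => // k /= hk.
have k0 : 0 < k.+1%:R^-1 :> R by rewrite invr_gt0.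
have kr : k.+1%:R^-1 <= r.
  rewrite invf_ple ?posrE//; apply: (le_trans (ltW (truncnS_gt r^-1))).
  by rewrite ler_nat ltnS.
have := @molc_bound u x _ 0 hu k0 (lexx 0).
rewrite normr_le0 /molc mulf_eq0 invr_eq0 (gt_eqF c0_gt0)/= => H; apply/eqP/H.
by apply: (ae_imp _ aeu) => y Hy yx; rewrite Hy ?normr0//; exact: le_trans kr.
Qed.

Lemma ut_molc u x (b t0 t : R) : 0 < t -> t <= t0 ->
  cvgn (fun k => mol u k.+1%:R^-1 x) ->
  (forall s, 0 < s -> s <= t -> `|mol u t x - mol u s x| <= b) ->
  `|molc u t x - ut u x| <= c0^-1 * b.
Proof.
move=> tp tt0 cf H; rewrite /molc /ut -mulrBr normrM ger0_norm ?invr_ge0 ?(ltW c0_gt0)//.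
rewrite ler_wpM2l ?invr_ge0 ?(ltW c0_gt0)//.
exact: (@le_lim_increment R (fun t => mol u t x)).
Qed.

Lemma mollify_cvg (f : V -> R) y (t : nat -> R) : itg f -> {for y, continuous f} ->
  (forall k, 0 < t k) -> t k @[k --> \oo] --> 0 ->
  c0^-1 * (t k ^- n * cv f (rho0 R n) (t k)^-1 y) @[k --> \oo] --> f y.
Proof.
move=> hf cf t0 tcv; apply/cvgrPdist_le => e e0.
have [r r0 Hr] : exists2 r, 0 < r & forall x, en (x - y) <= r -> `|f y - f x| <= e.
  have /nbhs_eball[r r0 Hr] : nbhs y (f @^-1` [set w | `|f y - w| <= e]).
    by apply: cf; apply/nbhs_ballP; exists e => //= w; rewrite /ball/= => /ltW.
  by exists r.
have : \forall k \near \oo, t k < r.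
  have := cvgr_lt 0 tcv; apply; exact: r0.
apply: filterS => k tr.
have tn0 : 0 < t k ^+ n by rewrite exprn_gt0.
have se := @usupp_rho0 R n.
have ik : itg (fun x => ev (rho0 R n) ((t k)^-1 *: (x - y))).
  by apply: integrable_ker => //; rewrite invr_neq0// gt_eqF.
have ic := integrable_cv (t k)^-1 y hf se.
have -> : f y = c0^-1 * (t k ^- n * (f y * (c0 * t k ^+ n))).
  have cn : c0 != 0 by rewrite gt_eqF// c0_gt0.
  have tn : t k ^+ n != 0 by rewrite gt_eqF.
  by field; rewrite cn tn.
rewrite -(Rintegral_rho0 y (t0 k)) /cv -RintegralZl; [|exact: measurableT|exact: ik].
rewrite -!mulrBr -RintegralB; [|exact: measurableT|exact: integrable_scale|exact: ic].
rewrite mulrA normrM [`|c0^-1 * _|]ger0_norm; last first.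
  by rewrite mulr_ge0 ?invr_ge0 ?(ltW c0_gt0) ?(ltW tn0).
rewrite -invfM mulrC ler_pdivrMr ?mulr_gt0 ?c0_gt0//.
rewrite -(Rintegral_rho0 y (t0 k)) -RintegralZl; [|exact: measurableT|exact: ik].
have iB := integrable_sub (integrable_scale (f y) ik) ic.
apply: le_trans (le_normr_Rintegral measurableT iB) _.
apply: le_Rintegral; [exact: measurableT|exact: integrable_norm|exact: integrable_scale|].
move=> x _; rewrite -mulrBl normrM [X in _ * X]ger0_norm ?ev_rho0_ge0//.
have [ty|ty] := ltP (t k) (en (x - y)); first by rewrite (ker_support se (t0 k) ty) !mulr0.
by rewrite ler_wpM2r ?ev_rho0_ge0// Hr// (le_trans ty)// ltW.
Qed.

End bump_mass.

Lemma cvg_le_scale (R : realType) (a : nat -> R) (l : R) (t : nat -> R) (K : R) :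
  (forall k, `|a k - l| <= K * t k) -> t k @[k --> \oo] --> (0 : R) ->
  a k @[k --> \oo] --> l.
Proof.
move=> H tcv; apply: cvg_zero; apply: norm_cvg0.
apply: (@squeeze_cvgr _ _ _ _ (fun=> 0) (fun k => K * t k)).
- by apply: nearW => k; rewrite normr_ge0 /= H.
- exact: cvg_cst.
- by rewrite -[X in _ --> X](mulr0 K); apply: cvgMr.
Qed.

(** * The continuous representative *)

Section continuous_representative.
Context (R : realType) (n : nat).
Local Notation V := 'rV[R]_n.
Local Notation itg f := ((leb R n).-integrable setT (EFin \o f)).
Variables (u : V -> R) (z : V) (D C t0 : R).
Hypotheses (hu : itg u) (D0 : 0 < D) (C0 : 0 <= C) (t00 : 0 < t0).
Hypothesis hmol : forall x s t, en (x - z) < D -> 0 < s -> s <= t -> t <= t0 ->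
  `|mol u t x - mol u s x| <= C * t.

Lemma mol_cvgn x : en (x - z) < D -> cvgn (fun k => mol u k.+1%:R^-1 x).
Proof. by move=> xD; apply: (@lim_increment R (fun t => mol u t x) C t0 t00 C0) => s t s0 st tt0; exact: hmol. Qed.

Lemma molc_ut x t : en (x - z) < D -> 0 < t -> t <= t0 ->
  `|molc u t x - ut u x| <= (c0 R n)^-1 * (C * t).
Proof.
move=> xD tp tt0; apply: (ut_molc tp tt0); first exact: mol_cvgn.
by move=> s s0 st; exact: hmol.
Qed.

Lemma ut_bounded : exists2 M, 0 < M & forall x, en (x - z) < D -> `|ut u x| <= M.
Proof.
have [M [M0 HM]] := usupp_bounded (@usupp_rho0 R n).
have I0 : 0 <= \int[leb R n]_y `|u y| by apply: Rintegral_ge0.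
have cp := c0_gt0 R n.
exists (1 + (c0 R n)^-1 * (t0 ^- n * (M * \int[leb R n]_y `|u y|)) + (c0 R n)^-1 * (C * t0)).
  rewrite -addrA ltr_pwDl// addr_ge0// !mulr_ge0 ?invr_ge0 ?exprn_ge0//; exact: ltW.
move=> x xD; have := molc_ut xD t00 (lexx t0).
have : `|molc u t0 x| <= (c0 R n)^-1 * (t0 ^- n * (M * \int[leb R n]_y `|u y|)).
  rewrite /molc /mol !normrM (ger0_norm (_ : 0 <= (c0 R n)^-1)) ?invr_ge0 ?(ltW cp)//.
  rewrite (ger0_norm (_ : 0 <= t0 ^- n)) ?invr_ge0 ?exprn_ge0 ?(ltW t00)//.
  apply: ler_wpM2l; first by rewrite invr_ge0 ltW.
  apply: ler_wpM2l; first by rewrite invr_ge0 exprn_ge0// ltW.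
  have ic := integrable_cv t0^-1 x hu (@usupp_rho0 R n).
  rewrite /cv; apply: le_trans (le_normr_Rintegral measurableT ic) _.
  rewrite -RintegralZl; [|exact: measurableT|exact: integrable_norm].
  apply: le_Rintegral; [exact: measurableT|exact: integrable_norm|exact/integrable_scale/integrable_norm|].
  by move=> y _; rewrite normrM mulrC ler_wpM2r.
have := ler_normB (molc u t0 x) (molc u t0 x - ut u x).
by rewrite subKr; lra.
Qed.

(** Test against a continuous [phi]. On one side [molc u] tends to [ut u], boundedly; on the other
    the mollification is moved onto [phi], where it converges to [phi] pointwise by continuity.
    Hence [u - ut u] is orthogonal to every [phi], and the fundamental lemma applies to both
    signs. *)
Lemma ut_ae_eq : {ae leb R n, forall x, eball z D x -> u x = ut u x}.
Proof.
pose t k : R := t0 * k.+1%:R^-1.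
have tp k : 0 < t k by rewrite mulr_gt0// invr_gt0.
have tt0 k : t k <= t0 by rewrite ger_pMr// invf_le1// ler1n.
have tcv : t k @[k --> \oo] --> (0 : R).
  rewrite -[X in _ --> X](mulr0 t0); apply: cvgMr; exact: cvg_harmonic.
have [M M0 HM] := ut_bounded.
have cp := c0_gt0 R n.
pose B : set V := eball z D.
have BP x : B x -> en (x - z) < D by rewrite /B eballE.
have mB : measurable (B : set (Rn R n)) by apply: open_measurable_row; exact: open_eball.
pose g k (x : V) := (u x - molc u (t k) x) * \1_B x.
pose w (x : V) := (u x - ut u x) * \1_B x.
have mu1 : measurable_fun (setT : set (Rn R n)) u by apply/measurable_EFinP; case/integrableP : hu.
have cmol k : continuous (molc u (t k)).
  by do 2!apply: continuous_scale; apply: continuous_cv => //; exact: usupp_rho0.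
have mg k : measurable_fun (setT : set (Rn R n)) (g k).
  exact: (measurable_funM (measurable_funB mu1 (continuous_measurable_row (cmol k))) (measurable_indic mB)).
have gw x : g ^~ x @ \oo --> w x.
  rewrite /g /w; have [Bx|nBx] := pselect (B x); last first.
    by rewrite !indicE (memNset nBx) mulr0; under eq_fun do rewrite mulr0; exact: cvg_cst.
  rewrite !indicE (mem_set Bx) mulr1; under eq_fun do rewrite mulr1.
  apply: cvgB; first exact: cvg_cst.
  apply: (@cvg_le_scale R _ _ t ((c0 R n)^-1 * C)) tcv => k.
  by rewrite -mulrA; apply: molc_ut => //; exact: BP.
have mw : measurable_fun (setT : set (Rn R n)) w.
  by apply: (measurable_fun_cvg mg) => x _; exact: gw.
pose M' := M + (c0 R n)^-1 * (C * t0).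
have gM k x : `|g k x| <= `|u x| + M' * \1_(cube z D) x.
  rewrite /g !indicE; have [Bx|nBx] := pselect (B x); last first.
    by rewrite (memNset nBx) mulr0 normr0 addr_ge0// mulr_ge0// /M' addr_ge0 ?(ltW M0)// !mulr_ge0 ?invr_ge0// ltW.
  have cx : cube z D x by apply: en_le_cube; exact/ltW/BP.
  rewrite (mem_set Bx) (mem_set cx) !mulr1 (le_trans (ler_normB _ _))// lerD2l.
  have := molc_ut (BP _ Bx) (tp k) (tt0 k); have := HM _ (BP _ Bx).
  have := ler_normD (molc u (t k) x - ut u x) (ut u x); rewrite subrK /M'.
  have : (c0 R n)^-1 * (C * t k) <= (c0 R n)^-1 * (C * t0).
    by rewrite !ler_wpM2l ?invr_ge0 ?(ltW cp).
  lra.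
have iM : itg (fun x => `|u x| + M' * \1_(cube z D) x).
  apply: integrable_add; first exact: integrable_norm.
  apply: integrable_scale; apply: integrable_indic_fin; [exact: measurable_cube|exact: leb_cube_fin].
have wM x : `|w x| <= `|u x| + M' * \1_(cube z D) x.
  have cv : `|g k x| @[k --> \oo] --> `|w x| by apply: cvg_norm; exact: gw.
  rewrite -(cvg_lim _ cv)//; apply: limr_le; first by apply/cvg_ex; eexists; exact: cv.
  exact: nearW.
have hw : itg w.
  exact: (integrable_dominated mw iM wM).
have w0 x : ~ eball z D x -> w x = 0.
  by move=> nB; rewrite /w indicE (memNset nB) mulr0.
have hphi (phi : V -> R) s : continuous phi -> s < D ->
    (forall x, 0 <= phi x <= 1) -> (forall x, s < en (x - z) -> phi x = 0) ->
    \int[leb R n]_x (w x * phi x) = 0.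
  move=> cphi sD phi01 phi0.
  have outD x : ~ cube z D x -> s < en (x - z).
    by move=> nx; rewrite (lt_trans sD)// ltNge; apply/negP => H; apply: nx; exact: en_le_cube.
  have iphi : itg phi.
    by apply: (integrable_continuous (c := z) (r := D) cphi) => x nx; exact: (phi0 _ (outD _ nx)).
  have mphi := continuous_measurable_row cphi.
  have phiB x : \1_B x * phi x = phi x.
    rewrite indicE; have [Bx|nBx] := pselect (B x); first by rewrite (mem_set Bx) mul1r.
    rewrite (memNset nBx) mul0r phi0// (lt_le_trans sD)// leNgt; apply/negP => H.
    by apply: nBx; rewrite /B eballE.
  have phin x : `|phi x| <= 1 by have /andP[a b] := phi01 x; rewrite ger0_norm.
  have iuphi : itg (fun x => u x * phi x) by apply: (integrable_mul_bounded hu mphi phin).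
  pose psi k y := (c0 R n)^-1 * (t k ^- n * cv phi (rho0 R n) (t k)^-1 y).
  have gphi k : \int[leb R n]_x (g k x * phi x) =
      \int[leb R n]_x (u x * phi x) - \int[leb R n]_x (u x * psi k x).
    have ig : itg (fun x => molc u (t k) x * phi x).
      apply: (integrable_continuous (c := z) (r := D)).
        exact: (continuous_mul (cmol k) cphi).
      move=> x nx; rewrite (phi0 _ (outD _ nx)); exact: mulr0.
    transitivity (\int[leb R n]_x (u x * phi x - molc u (t k) x * phi x)).
      by apply: eq_Rintegral => x _; rewrite /g -mulrA phiB mulrBl.
    rewrite RintegralB; [|exact: measurableT|exact: iuphi|exact: ig]; congr (_ - _).
    have sr := @usupp_rho0 R n.
    have Hs := Rintegral_cv (t k)^-1 hu iphi.
    transitivity (((c0 R n)^-1 * t k ^- n) * \int[leb R n]_x (phi x * cv u (rho0 R n) (t k)^-1 x)).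
      rewrite -RintegralZl; [|exact: measurableT|].
        by apply: eq_Rintegral => x _; rewrite /molc /mol; ring.
      apply: (integrable_continuous (c := z) (r := D)).
        apply: continuous_mul; [exact: cphi|exact: continuous_cv].
      move=> x nx; rewrite (phi0 _ (outD _ nx)); exact: mul0r.
    rewrite Hs -RintegralZl; [|exact: measurableT|].
      by apply: eq_Rintegral => x _; rewrite /psi; ring.
    have [M1 [_ HM1]] := usupp_bounded sr.
    have mc : measurable_fun (setT : set (Rn R n)) (cv phi (rho0 R n) (t k)^-1).
      by apply: continuous_measurable_row; exact: continuous_cv.
    apply: (@integrable_mul_bounded _ _ _ (leb R n) u _ (1 * (c0 R n * t k ^+ n)) hu mc) => y.
    by apply: (cv_rho0_bound iphi (tp k) ler01); apply: aeW => x _.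
  have psi1 k y : `|psi k y| <= 1.
    have := @molc_bound R n phi y (t k) 1 iphi (tp k) ler01; rewrite /molc /mol /psi; apply.
    by apply: aeW => x _.
  have cvp : \int[leb R n]_x (u x * psi k x) @[k --> \oo] --> \int[leb R n]_x (u x * phi x).
    have mpsi k : measurable_fun (setT : set (Rn R n)) (fun x => u x * psi k x).
      apply: (measurable_funM mu1); apply: continuous_measurable_row.
      by do 2!apply: continuous_scale; apply: continuous_cv => //; exact: usupp_rho0.
    apply: (dominated_Rintegral_cvg mpsi _ (integrable_norm hu)).
      by move=> x; apply: cvgMr; apply: mollify_cvg => //; exact: cphi.
    by move=> k x; rewrite normrM ler_piMr.
  have cvg1 : \int[leb R n]_x (g k x * phi x) @[k --> \oo] --> (0 : R).
    have H1 : (\int[leb R n]_x (u x * phi x) - \int[leb R n]_x (u x * psi k x)) @[k --> \oo] -->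
        \int[leb R n]_x (u x * phi x) - \int[leb R n]_x (u x * phi x).
      by apply: cvgB => //; exact: cvg_cst.
    by rewrite subrr in H1; under eq_cvg do rewrite gphi.
  have cvg2 : \int[leb R n]_x (g k x * phi x) @[k --> \oo] --> \int[leb R n]_x (w x * phi x).
    have mgp k : measurable_fun (setT : set (Rn R n)) (fun x => g k x * phi x).
      exact: (measurable_funM (mg k) mphi).
    apply: (dominated_Rintegral_cvg mgp _ iM).
      by move=> x; apply: cvgMl; exact: gw.
    by move=> k x; rewrite normrM (le_trans _ (gM k x))// ler_piMr.
  by rewrite -(cvg_lim _ cvg2)// (cvg_lim _ cvg1).
have le1 := ae_le0_test hw w0 hphi.
have hNw : itg (fun x => - w x).
  have := integrable_scale (-1) hw; congr (_.-integrable _ _).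
  by apply/funext => x; rewrite /= mulN1r.
have le2 : {ae leb R n, forall x, - w x <= 0}.
  apply: (ae_le0_test hNw); first by move=> x /w0 ->; rewrite oppr0.
  move=> phi s cphi sD phi01 phi0.
  transitivity (- 1 * \int[leb R n]_x (w x * phi x)); last by rewrite (hphi _ s)// mulr0.
  rewrite -RintegralZl; [|exact: measurableT|].
    by apply: eq_Rintegral => x _; rewrite mulN1r mulNr.
  apply: (integrable_mul_bounded (M := 1) hw (continuous_measurable_row cphi)) => x.
  by have /andP[a b] := phi01 x; rewrite ger0_norm.
apply: (ae_imp _ (ae_and le1 le2)) => x [w1 w2] Bx.
have : w x = 0 by apply/eqP; rewrite eq_le w1 -oppr_le0.
by rewrite /w indicE (mem_set Bx) mulr1 => /eqP; rewrite subr_eq0 => /eqP.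
Qed.

End continuous_representative.

#[global] Opaque cv mol molc ut.


(** * The Carleman inequality *)

Section twice_differentiable.
Context (R : realType) (n : nat).
Local Notation V := 'rV[R]_n.

(** Derivatives are carried as explicit functions, [f2 i j] being the derivative of [f1 j] in
    direction [i]. Their symmetry is part of the data: for kernels it comes from [ev_ddC], and
    products preserve it. *)
Definition c2 f (f1 : 'I_n -> V -> R) (f2 : 'I_n -> 'I_n -> V -> R) : Prop :=
  [/\ continuous f, (forall i, continuous (f1 i)) /\ (forall i j, continuous (f2 i j)),
    forall i x, is_derive x (delta_mx ord0 i) f (f1 i x),
    forall i j x, is_derive x (delta_mx ord0 i) (f1 j) (f2 i j x)
    & forall i j x, f2 i j x = f2 j i x].

Lemma c2_mul f f1 f2 g g1 g2 : c2 f f1 f2 -> c2 g g1 g2 ->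
  c2 (fun x => f x * g x) (fun i x => f1 i x * g x + f x * g1 i x)
    (fun i j x => (f2 i j x * g x + f1 j x * g1 i x) + (f1 i x * g1 j x + f x * g2 i j x)).
Proof.
move=> [cf [cf1 cf2] df df1 sf] [cg [cg1 cg2] dg dg1 sg]; split.
- exact: continuous_mul.
- split; first by move=> i; apply: continuous_add; apply: continuous_mul.
  by move=> i j; apply: continuous_add; apply: continuous_add; apply: continuous_mul.
- by move=> i x; apply: is_derive_mul.
- by move=> i j x; apply: is_derive_add; apply: is_derive_mul.
- by move=> i j x; rewrite sf sg; ring.
Qed.

Lemma c2_sub f f1 f2 g g1 g2 : c2 f f1 f2 -> c2 g g1 g2 ->
  c2 (fun x => f x - g x) (fun i x => f1 i x - g1 i x) (fun i j x => f2 i j x - g2 i j x).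
Proof.
move=> [cf [cf1 cf2] df df1 sf] [cg [cg1 cg2] dg dg1 sg]; split.
- by apply: continuous_add => //; exact: continuous_opp.
- split; first by move=> i; apply: continuous_add => //; exact: continuous_opp.
  by move=> i j; apply: continuous_add => //; exact: continuous_opp.
- by move=> i x; apply: is_derive_add => //; exact: is_derive_opp.
- by move=> i j x; apply: is_derive_add => //; exact: is_derive_opp.
- by move=> i j x; rewrite sf sg.
Qed.

Lemma c2_scale f f1 f2 (k : R) : c2 f f1 f2 ->
  c2 (fun x => k * f x) (fun i x => k * f1 i x) (fun i j x => k * f2 i j x).
Proof.
move=> [cf [cf1 cf2] df df1 sf]; split.
- exact: continuous_scale.
- by split=> *; exact: continuous_scale.
- by move=> i x; exact: is_derive_scale.
- by move=> i j x; exact: is_derive_scale.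
- by move=> i j x; rewrite sf.
Qed.

Lemma c2_sc (e : sexp R n) c z :
  c2 (sc e c z) (fun i x => c * sc (dd i e) c z x)
    (fun i j x => c * (c * sc (dd i (dd j e)) c z x)).
Proof.
split.
- exact: continuous_sc.
- split; first by move=> i; apply: continuous_scale; exact: continuous_sc.
  by move=> i j; do 2!apply: continuous_scale; exact: continuous_sc.
- by move=> i x; exact: is_derive_sc_coord.
- by move=> i j x; apply: is_derive_scale; exact: is_derive_sc_coord.
- by move=> i j x; rewrite /sc ev_ddC.
Qed.

Lemma c2_molc u (t : R) : (leb R n).-integrable setT (EFin \o u) ->
  c2 (molc u t)
    (fun i x => ((c0 R n)^-1 * t ^- n) * (- t^-1 * cv u (dd i (rho0 R n)) t^-1 x))
    (fun i j x => ((c0 R n)^-1 * t ^- n) *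
      (- t^-1 * (- t^-1 * cv u (dd i (dd j (rho0 R n))) t^-1 x))).
Proof.
move=> hu; have sr := @usupp_rho0 R n.
have -> : molc u t = (fun x => ((c0 R n)^-1 * t ^- n) * cv u (rho0 R n) t^-1 x).
  by apply/funext => x; rewrite molcE mulrA.
split.
- by apply: continuous_scale; exact: continuous_cv.
- split; first by move=> i; do 2!apply: continuous_scale; apply: continuous_cv => //; exact: usupp_dd.
  by move=> i j; do 3!apply: continuous_scale; apply: continuous_cv => //; do 2!apply: usupp_dd.
- by move=> i x; apply: is_derive_scale; exact: is_derive_cv.
- move=> i j x; do 2!apply: is_derive_scale; apply: is_derive_cv => //; exact: usupp_dd.
- by move=> i j x; do 3!congr (_ * _); apply: cv_ext => y; exact: ev_ddC.
Qed.

(** Each derivative in [x] brings a factor [- 1 / t], and [weq] at [e = rho0] gives back [t^2]. *)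
Lemma lap_molc z D (u L : V -> R) (t : R) x : weq z D u L ->
  (leb R n).-integrable setT (EFin \o u) -> 0 < t -> en (x - z) + t < D ->
  \sum_i ((c0 R n)^-1 * t ^- n) *
      (- t^-1 * (- t^-1 * cv u (dd i (dd i (rho0 R n))) t^-1 x)) = molc L t x.
Proof.
move=> hw hu t0 xD; have sr := @usupp_rho0 R n.
rewrite -big_distrr/= -big_distrr/= -big_distrr/= molcE.
have -> : \sum_i cv u (dd i (dd i (rho0 R n))) t^-1 x = cv u (lap (rho0 R n)) t^-1 x.
  by rewrite cv_lap.
rewrite (hw _ _ _ sr t0 xD) -mulrA; do 2!congr (_ * _).
rewrite mulrA mulrNN mulrA expr2 mulrACA mulVf ?gt_eqF// !mul1r.
by [].
Qed.

End twice_differentiable.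

(** * Divergence identities for the weighted vector fields *)

Section carleman.
Context (R : realType) (n : nat).
Local Notation V := 'rV[R]_n.
Variable z : V.

Local Notation X i x := ((x : V) ord0 i - z ord0 i).

Lemma is_derive_X i k (x : V) : is_derive x (delta_mx ord0 i) (fun y => X k y) (i == k)%:R.
Proof.
have E : (fun y => X k y) = sc (Crd R k) 1 z.
  by apply/funext => y; rewrite /sc scale1r /ev !mxE.
have := is_derive_sc_coord (Crd R k) 1 z x i; rewrite -E mul1r.
by [].
Qed.

Lemma continuous_X k : continuous (fun y => X k y).
Proof. by apply: continuous_add; [exact: coord_continuous|exact: continuous_cst]. Qed.

Section vector_fields.
Variables (f : V -> R) (f1 : 'I_n -> V -> R) (f2 : 'I_n -> 'I_n -> V -> R).
Variables (W : V -> R) (W1 : 'I_n -> V -> R) (a : nat).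
Hypotheses (hf : c2 f f1 f2) (cW : continuous W) (cW1 : forall i, continuous (W1 i)).
Hypothesis dW : forall i x, is_derive x (delta_mx ord0 i) W (W1 i x).

(** The value that annihilates, in the divergence of [carV1], both the coefficient
    [a + 1 - tau - n/2] of [W^a |grad f|^2] and the coefficient [2 a tau (tau - a - 1 + n/2)] of
    [W^(a+1) f^2]. *)
Let tau : R := a.+1%:R - n%:R / 2.
Let S x : R := \sum_k X k x * f1 k x.
Let Y x : R := S x - tau * f x.
Let G x : R := \sum_k f1 k x ^+ 2.
Let Q i x : R := \sum_k X k x * f2 i k x.
Let P i x : R := \sum_k f1 k x * f2 i k x.
Let Lf x : R := \sum_i f2 i i x.

(* [cardV1] and [cardV2] are the terms of the divergences of [carV1] and [carV2];
   [W] stands for [|x - z|^(-2)], regularised near [z]. *)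
Definition carV1 i x : R :=
  W x ^+ a * (Y x * f1 i x - 2^-1 * (G x * X i x)) +
  a%:R * tau * (W x ^+ a.+1 * (f x ^+ 2 * X i x)).

Definition carV2 i x : R := W x ^+ a * (f x ^+ 2 * X i x).

Definition cardV1 i x : R :=
  a%:R * W x ^+ a.-1 * W1 i x * (Y x * f1 i x - 2^-1 * (G x * X i x)) +
  W x ^+ a * ((f1 i x + Q i x - tau * f1 i x) * f1 i x + Y x * f2 i i x -
    2^-1 * (2 * P i x * X i x + G x)) +
  a%:R * tau * (a.+1%:R * W x ^+ a * W1 i x * (f x ^+ 2 * X i x) +
    W x ^+ a.+1 * (2 * f x * f1 i x * X i x + f x ^+ 2)).

Definition cardV2 i x : R :=
  a%:R * W x ^+ a.-1 * W1 i x * (f x ^+ 2 * X i x) +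
  W x ^+ a * (2 * f x * f1 i x * X i x + f x ^+ 2).

Let continuous_S : continuous S.
Proof.
case: hf => cf [cf1 cf2] _ _ _; apply: continuous_sum => k.
by apply: continuous_mul => //; exact: continuous_X.
Qed.

Let continuous_Y : continuous Y.
Proof.
case: hf => cf [cf1 cf2] _ _ _; apply: continuous_add => //.
by apply: continuous_opp; exact: continuous_scale.
Qed.

Let continuous_G : continuous G.
Proof. by case: hf => cf [cf1 cf2] _ _ _; apply: continuous_sum => k; exact: continuous_exp. Qed.

Let continuous_Q i : continuous (Q i).
Proof.
case: hf => cf [cf1 cf2] _ _ _; apply: continuous_sum => k.
by apply: continuous_mul => //; exact: continuous_X.
Qed.

Let continuous_P i : continuous (P i).
Proof. by case: hf => cf [cf1 cf2] _ _ _; apply: continuous_sum => k; exact: continuous_mul. Qed.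

Lemma continuous_carV1 i : continuous (carV1 i).
Proof.
case: hf => cf [cf1 cf2] _ _ _; have cX := @continuous_X i; apply: continuous_add.
  apply: continuous_mul; first exact: continuous_exp.
  apply: continuous_add; first exact: continuous_mul.
  by apply: continuous_opp; apply: continuous_scale; exact: continuous_mul.
apply: continuous_scale; apply: continuous_mul; first exact: continuous_exp.
by apply: continuous_mul => //; exact: continuous_exp.
Qed.

Lemma continuous_carV2 i : continuous (carV2 i).
Proof.
case: hf => cf [cf1 cf2] _ _ _; have cX := @continuous_X i.
apply: continuous_mul; first exact: continuous_exp.
by apply: continuous_mul => //; exact: continuous_exp.
Qed.

Lemma continuous_cardV1 i : continuous (cardV1 i).
Proof.
case: hf => cf [cf1 cf2] _ _ _; have cX := @continuous_X i.
apply: continuous_add; first apply: continuous_add.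
- apply: continuous_mul.
    by apply: continuous_mul => //; apply: continuous_scale; exact: continuous_exp.
  apply: continuous_add; first exact: continuous_mul.
  by apply: continuous_opp; apply: continuous_scale; exact: continuous_mul.
- apply: continuous_mul; first exact: continuous_exp.
  apply: continuous_add; first apply: continuous_add.
  + apply: continuous_mul => //; apply: continuous_add; first exact: continuous_add.
    by apply: continuous_opp; exact: continuous_scale.
  + exact: continuous_mul.
  + apply: continuous_opp; apply: continuous_scale; apply: continuous_add => //.
    by apply: continuous_mul => //; exact: continuous_scale.
- apply: continuous_scale; apply: continuous_add.
    apply: continuous_mul; last by apply: continuous_mul => //; exact: continuous_exp.
    by apply: continuous_mul => //; apply: continuous_scale; exact: continuous_exp.
  apply: continuous_mul; first exact: continuous_exp.
  apply: continuous_add; last exact: continuous_exp.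
  by apply: continuous_mul => //; apply: continuous_mul => //; exact: continuous_scale.
Qed.

Lemma continuous_cardV2 i : continuous (cardV2 i).
Proof.
case: hf => cf [cf1 cf2] _ _ _; have cX := @continuous_X i.
apply: continuous_add.
  apply: continuous_mul; last by apply: continuous_mul => //; exact: continuous_exp.
  by apply: continuous_mul => //; apply: continuous_scale; exact: continuous_exp.
apply: continuous_mul; first exact: continuous_exp.
apply: continuous_add; last exact: continuous_exp.
by apply: continuous_mul => //; apply: continuous_mul => //; exact: continuous_scale.
Qed.

Lemma is_derive_carV1 i x : is_derive x (delta_mx ord0 i) (carV1 i) (cardV1 i x).
Proof.
case: hf => cf [cf1 cf2] df df1 _.
have dX := is_derive_X i i x; rewrite eqxx in dX.
have dS : is_derive x (delta_mx ord0 i) S (f1 i x + Q i x).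
  have := is_derive_bigsum (index_enum 'I_n) (fun k => is_derive_mul (is_derive_X i k x) (df1 i k x)).
  rewrite big_split/= (bigD1 i)//= eqxx mul1r big1 ?addr0// => k ki.
  by rewrite eq_sym (negbTE ki) mul0r.
have dY := is_derive_add dS (is_derive_opp (is_derive_scale tau (df i x))).
have dG : is_derive x (delta_mx ord0 i) G (2 * P i x).
  have := is_derive_bigsum (index_enum 'I_n) (fun k => is_derive_exp 2 (df1 i k x)).
  by rewrite /P big_distrr/=; under eq_bigr do rewrite expr1 -mulrA.
have df2 := is_derive_mul (is_derive_exp 2 (df i x)) dX.
have dA := is_derive_mul (is_derive_exp a (dW i x)) (is_derive_add
  (is_derive_mul dY (df1 i i x)) (is_derive_opp (is_derive_scale 2^-1 (is_derive_mul dG dX)))).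
have dB := is_derive_scale (a%:R * tau) (is_derive_mul (is_derive_exp a.+1 (dW i x)) df2).
have := is_derive_add dA dB; rewrite /cardV1 /=.
set D1 := (X in is_derive _ _ _ X) => H; set D2 := (X in is_derive _ _ _ X).
suff -> : D2 = D1 by [].
by rewrite /D1 /D2 /Y /= !expr1; ring.
Qed.

Lemma is_derive_carV2 i x : is_derive x (delta_mx ord0 i) (carV2 i) (cardV2 i x).
Proof.
case: hf => cf [cf1 cf2] df df1 _.
have dX := is_derive_X i i x; rewrite eqxx in dX.
have df2 := is_derive_mul (is_derive_exp 2 (df i x)) dX.
have := is_derive_mul (is_derive_exp a (dW i x)) df2; rewrite /cardV2 /=.
set D1 := (X in is_derive _ _ _ X) => H; set D2 := (X in is_derive _ _ _ X).
suff -> : D2 = D1 by [].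
by rewrite /D1 /D2 /= !expr1; ring.
Qed.

(** The sums mixing [f1] and [f2] cancel by symmetry of [f2], the terms in [|grad f|^2] and [f^2] by
    the choice of [tau]. There remain a term with [Lf] and a square with a definite sign. *)
Lemma sum_cardV1 x : (0 < a)%N -> W x * nsq (x - z) = 1 ->
  (forall i, W1 i x = - 2 * X i x * W x ^+ 2) ->
  \sum_i cardV1 i x = W x ^+ a * Y x * Lf x - 2 * a%:R * W x ^+ a.+1 * Y x ^+ 2.
Proof.
move=> a0 Wr W1E; case: hf => _ _ _ _ sf.
have aE : W x ^+ a = W x ^+ a.-1 * W x by rewrite -exprSr prednK.
pose w := W x ^+ a.-1.
rewrite (eq_bigr (fun i =>
  (- 2 * a%:R * w * W x ^+ 2 * Y x + 2 * a%:R * tau * W x ^+ a.+1 * f x) * (X i x * f1 i x) +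
  (a%:R * w * W x ^+ 2 * G x - 2 * a%:R * a.+1%:R * tau * W x ^+ a * W x ^+ 2 * f x ^+ 2) * (X i x ^+ 2) +
  (W x ^+ a * (1 - tau)) * (f1 i x ^+ 2) +
  (W x ^+ a * Y x) * f2 i i x +
  W x ^+ a * (f1 i x * Q i x) + (- W x ^+ a) * (X i x * P i x) +
  (- 2^-1 * W x ^+ a * G x + a%:R * tau * W x ^+ a.+1 * f x ^+ 2))); last first.
  by move=> i _; rewrite /cardV1 W1E -/w; field.
have sc (c : R) : \sum_(i < n) c = n%:R * c by rewrite sumr_const card_ord mulr_natl.
rewrite !big_split/= !sc -!big_distrr/=.
have -> : \sum_i X i x ^+ 2 = nsq (x - z) by rewrite /nsq; apply: eq_bigr => i _; rewrite !mxE.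
have -> : \sum_i X i x * P i x = \sum_i f1 i x * Q i x.
  under eq_bigr do rewrite /P big_distrr/=.
  under [RHS]eq_bigr do rewrite /Q big_distrr/=.
  rewrite exchange_big/=; apply: eq_bigr => i _; apply: eq_bigr => k _.
  by rewrite sf; ring.
rewrite -/(S x) -/(G x) -/(Lf x).
have SY : S x = Y x + tau * f x by rewrite /Y subrK.
set T := \sum_i f1 i x * Q i x; set r := nsq (x - z) in Wr *.
have E1 : w * W x ^+ 2 * r = W x ^+ a by rewrite aE -/w -[RHS]mulr1 -Wr; ring.
have E2 : W x ^+ a * W x ^+ 2 * r = W x ^+ a.+1.
  by rewrite [W x ^+ a.+1]exprSr -[RHS]mulr1 -Wr; ring.
have E3 : w * W x ^+ 2 = W x ^+ a.+1 by rewrite [W x ^+ a.+1]exprSr aE -/w; ring.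
rewrite [(_ - _) * r]mulrBl.
have -> : a%:R * w * W x ^+ 2 * G x * r = a%:R * G x * W x ^+ a by rewrite -E1; ring.
have -> : 2 * a%:R * a.+1%:R * tau * W x ^+ a * W x ^+ 2 * f x ^+ 2 * r =
   2 * a%:R * a.+1%:R * tau * f x ^+ 2 * W x ^+ a.+1 by rewrite -E2; ring.
have -> : - 2 * a%:R * w * W x ^+ 2 * Y x = - 2 * a%:R * Y x * W x ^+ a.+1 by rewrite -E3; ring.
rewrite SY; have tE : n%:R = 2 * (a.+1%:R - tau) by rewrite /tau; field.
by rewrite tE -[a.+1%:R]natr1; field.
Qed.

(** Here the coefficient of [W^a f^2] is [n - 2 a + 2 tau = 2]: this field restores the positive
    term in [f^2] that is absent from the divergence of [carV1]. *)
Lemma sum_cardV2 x : (0 < a)%N -> W x * nsq (x - z) = 1 ->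
  (forall i, W1 i x = - 2 * X i x * W x ^+ 2) ->
  \sum_i cardV2 i x = 2 * W x ^+ a * f x ^+ 2 + 2 * W x ^+ a * f x * Y x.
Proof.
move=> a0 Wr W1E.
have aE : W x ^+ a = W x ^+ a.-1 * W x by rewrite -exprSr prednK.
pose w := W x ^+ a.-1.
rewrite (eq_bigr (fun i =>
  (2 * W x ^+ a * f x) * (X i x * f1 i x) +
  (- 2 * a%:R * w * W x ^+ 2 * f x ^+ 2) * (X i x ^+ 2) +
  W x ^+ a * f x ^+ 2)); last first.
  by move=> i _; rewrite /cardV2 W1E -/w; ring.
have sc (c : R) : \sum_(i < n) c = n%:R * c by rewrite sumr_const card_ord mulr_natl.
rewrite !big_split/= !sc -!big_distrr/=.
have -> : \sum_i X i x ^+ 2 = nsq (x - z) by rewrite /nsq; apply: eq_bigr => i _; rewrite !mxE.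
rewrite -/(S x).
have SY : S x = Y x + tau * f x by rewrite /Y subrK.
set r := nsq (x - z) in Wr *.
have -> : - 2 * a%:R * w * W x ^+ 2 * f x ^+ 2 * r = - 2 * a%:R * f x ^+ 2 * W x ^+ a.
  have E1 : w * W x ^+ 2 * r = W x ^+ a by rewrite aE -/w -[RHS]mulr1 -Wr; ring.
  by rewrite -E1; ring.
rewrite SY; have tE : n%:R = 2 * (a.+1%:R - tau) by rewrite /tau; field.
by rewrite tE -[a.+1%:R]natr1; field.
Qed.

(* Completing squares: [Y - rho Lf / 2] and [f + Y]. *)
Lemma carleman_pointwise x (r : R) : (0 < a)%N -> W x * nsq (x - z) = 1 -> 0 < W x ->
  (forall i, W1 i x = - 2 * X i x * W x ^+ 2) -> nsq (x - z) <= r ^+ 2 ->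
  W x ^+ a * f x ^+ 2 <= 4^-1 * r ^+ 2 * (W x ^+ a * nsq (x - z)) * Lf x ^+ 2 +
    \sum_i (cardV2 i x - r ^+ 2 * cardV1 i x).
Proof.
move=> a0 Wr W0 W1E xr.
rewrite big_split/= sumrN -big_distrr/= sum_cardV1// sum_cardV2//.
set q := nsq (x - z) in Wr xr *; set y := Y x; set l := Lf x; set w := W x ^+ a.
have w0 : 0 <= w by rewrite exprn_ge0// ltW.
have rW : 1 <= r ^+ 2 * W x by rewrite -Wr mulrC ler_pM2r.
rewrite [W x ^+ a.+1]exprS -/w -subr_ge0.
(* Of the [2 a] squares in [y], one completes the square with [l]; the other [2 a - 1] outweigh the
   [- y^2] left over from [f^2 + 2 f y], because [r^2 W >= 1]. *)
have -> : 4^-1 * r ^+ 2 * (w * q) * l ^+ 2 + (2 * w * f x ^+ 2 + 2 * w * f x * y -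
    r ^+ 2 * (w * y * l - 2 * a%:R * (W x * w) * y ^+ 2)) - w * f x ^+ 2 =
  w * ((f x + y) ^+ 2 + r ^+ 2 * (W x * (y - 2^-1 * q * l) ^+ 2) +
    ((2 * a%:R - 1) * (r ^+ 2 * W x) - 1) * y ^+ 2).
  have -> : W x * (y - 2^-1 * q * l) ^+ 2 = W x * y ^+ 2 - (W x * q) * y * l + 4^-1 * (W x * q) * q * l ^+ 2.
    by field.
  by rewrite Wr; ring.
have a1 : 1 <= a%:R :> R by rewrite ler1n.
have h1 : 0 <= (f x + y) ^+ 2 by exact: sqr_ge0.
have h2 : 0 <= r ^+ 2 * (W x * (y - 2^-1 * q * l) ^+ 2).
  by apply: mulr_ge0; [exact: sqr_ge0|apply: mulr_ge0; [exact: ltW|exact: sqr_ge0]].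
have h3 : 0 <= ((2 * a%:R - 1) * (r ^+ 2 * W x) - 1) * y ^+ 2.
  apply: mulr_ge0; last exact: sqr_ge0.
  by nra.
apply: mulr_ge0 => //; lra.
Qed.

End vector_fields.

End carleman.


(** * The integrated inequality for a cut-off function *)

Section carleman_integrated.
Context (R : realType) (n : nat).
Local Notation V := 'rV[R]_n.
Variables (z : V) (U : V -> R) (U1 : 'I_n -> V -> R) (U2 : 'I_n -> 'I_n -> V -> R).
Variables (chi : V -> R) (chi1 : 'I_n -> V -> R) (chi2 : 'I_n -> 'I_n -> V -> R).
Variables (psi : V -> R) (psi1 : 'I_n -> V -> R) (psi2 : 'I_n -> 'I_n -> V -> R).
Variables (W : V -> R) (W1 : 'I_n -> V -> R) (a : nat) (r B : R).
Hypotheses (hU : c2 U U1 U2) (hchi : c2 chi chi1 chi2) (hpsi : c2 psi psi1 psi2).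
Hypotheses (cW : continuous W) (cW1 : forall i, continuous (W1 i)).
Hypothesis dW : forall i x, is_derive x (delta_mx ord0 i) W (W1 i x).
Hypotheses (a0 : (0 < a)%N) (r0 : 0 <= r) (B0 : 0 <= B).
Hypothesis W0 : forall x, 0 < W x.
Hypothesis psi0 : forall x, 0 <= psi x.
Hypothesis weight : forall x,
  (W x * nsq (x - z) = 1 /\ forall i, W1 i x = - 2 * (x ord0 i - z ord0 i) * W x ^+ 2) \/
  [/\ chi x = 0, forall i, chi1 i x = 0 & forall i j, chi2 i j x = 0].
Hypothesis support : forall x, r < en (x - z) ->
  [/\ chi x = 0, forall i, chi1 i x = 0 & forall i j, chi2 i j x = 0] /\
  [/\ psi x = 0, forall i, psi1 i x = 0 & forall i j, psi2 i j x = 0].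
Hypothesis gradient : forall x,
  W x ^+ a * nsq (x - z) * (\sum_i chi1 i x ^+ 2) <= psi x.

Local Notation LU x := (\sum_i U2 i i x).
Local Notation Lchi x := (\sum_i chi2 i i x).
Local Notation Lpsi x := (\sum_i psi2 i i x).

(** [Delta (chi U)] has three terms, whence the factor 3 for its square. The one with
    [grad chi . grad U] is bounded through [psi] by [psi |grad U|^2], which the field [V3] turns
    into the last two summands. *)
Definition carleman_rhs x : R :=
  3 / 4 * r ^+ 2 * (W x ^+ a * nsq (x - z)) *
    (chi x ^+ 2 * LU x ^+ 2 + U x ^+ 2 * Lchi x ^+ 2) +
  3 * r ^+ 2 * (psi x * `|U x| * `|LU x| + 2^-1 * U x ^+ 2 * `|Lpsi x|).

Hypothesis rhsB : forall x, en (x - z) <= r -> carleman_rhs x <= B.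

Let f x := chi x * U x.
Let f1 i x := chi1 i x * U x + chi x * U1 i x.
Let f2 i j x := (chi2 i j x * U x + chi1 j x * U1 i x) + (chi1 i x * U1 j x + chi x * U2 i j x).
Let hf : c2 f f1 f2 := c2_mul hchi hU.

(** Caccioppoli's field, of divergence [psi |grad U|^2 + psi U LU - U^2 Lpsi / 2]. With the factor
    [3 r^2] it cancels the gradient term created by the cutoff, so no bound on [grad U] is
    required. *)
Let V3 i x := psi x * (U x * U1 i x) - 2^-1 * (U x ^+ 2 * psi1 i x).
Let dV3 i x := (psi1 i x * (U x * U1 i x) + psi x * (U1 i x * U1 i x + U x * U2 i i x)) -
  2^-1 * (2 * U x * U1 i x * psi1 i x + U x ^+ 2 * psi2 i i x).

Let F i x := carV2 z f W a i x - r ^+ 2 * carV1 z f f1 W a i x + 3 * r ^+ 2 * V3 i x.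
Let dF i x := (cardV2 z f f1 W W1 a i x - r ^+ 2 * cardV1 z f f1 f2 W W1 a i x) +
  3 * r ^+ 2 * dV3 i x.

Let continuous_dF i : continuous (dF i).
Proof.
case: hU => cU [cU1 cU2] dU dU1 _; case: hpsi => cp [cp1 cp2] dp dp1 _.
apply: continuous_add; first apply: continuous_add.
- exact: (@continuous_cardV2 R n z f f1 f2).
- apply: continuous_opp; apply: continuous_scale; exact: (@continuous_cardV1 R n z f f1 f2).
- apply: continuous_scale; apply: continuous_add.
    apply: continuous_add; first by do 2!apply: continuous_mul => //.
    by apply: continuous_mul => //; apply: continuous_add; apply: continuous_mul.
  apply: continuous_opp; apply: continuous_scale; apply: continuous_add.
    by do 2!(apply: continuous_mul => //); exact: continuous_scale.
  by apply: continuous_mul => //; exact: continuous_exp.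
Qed.

Let dF_int i : \int[leb R n]_x dF i x = 0.
Proof.
case: hU => cU [cU1 cU2] dU dU1 _; case: hpsi => cp [cp1 cp2] dp dp1 _.
apply: (@Rintegral_derive0 R n (F i) (dF i) (delta_mx ord0 i) z r).
- apply: continuous_add; first apply: continuous_add.
  + exact: (@continuous_carV2 R n z f f1 f2).
  + apply: continuous_opp; apply: continuous_scale; exact: (@continuous_carV1 R n z f f1 f2).
  + apply: continuous_scale; apply: continuous_add; first by do 2!apply: continuous_mul => //.
    apply: continuous_opp; apply: continuous_scale; apply: continuous_mul => //; exact: continuous_exp.
- exact: continuous_dF.
- move=> x; apply: is_derive_add.
    apply: is_derive_add; first exact: (@is_derive_carV2 R n z f f1 f2).
    by apply: is_derive_opp; apply: is_derive_scale; exact: (@is_derive_carV1 R n z f f1 f2).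
  apply: is_derive_scale; apply: is_derive_add.
    by apply: is_derive_mul => //; exact: is_derive_mul.
  apply: is_derive_opp; apply: is_derive_scale.
  have := is_derive_mul (is_derive_exp 2 (dU i x)) (dp1 i i x).
  by rewrite expr1.
- move=> x nx; have xr : r < en (x - z).
    by rewrite ltNge; apply/negP => xr; apply: nx; exact: en_le_cube.
  have [[chi0 chi10 chi20] [p0 p10 p20]] := support xr.
  have fx : f x = 0 by rewrite /f chi0 mul0r.
  have f1x k : f1 k x = 0 by rewrite /f1 chi0 chi10 !mul0r addr0.
  rewrite /F /carV2 /carV1 /V3 fx p0 p10.
  rewrite [in X in _ - _ * X]big1; last by move=> k _; rewrite f1x mulr0.
  rewrite [in X in _ - _ * X]big1; last by move=> k _; rewrite f1x expr0n.
  by rewrite f1x; ring.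
Qed.

Let pointwise x : W x ^+ a * f x ^+ 2 <= (if en (x - z) <= r then B else 0) + \sum_i dF i x.
Proof.
have sF : \sum_i dF i x =
    \sum_i (cardV2 z f f1 W W1 a i x - r ^+ 2 * cardV1 z f f1 f2 W W1 a i x) +
    3 * r ^+ 2 * (psi x * (\sum_i U1 i x ^+ 2) + psi x * U x * LU x - 2^-1 * U x ^+ 2 * Lpsi x).
  rewrite big_split/= -big_distrr/=; congr (_ + _ * _).
  rewrite !big_distrr/= -big_split -sumrN -big_split/=; apply: eq_bigr => i _.
  by rewrite /dV3; field.
have bad : [/\ chi x = 0, forall i, chi1 i x = 0 & forall i j, chi2 i j x = 0] ->
    f x = 0 /\ \sum_i (cardV2 z f f1 W W1 a i x - r ^+ 2 * cardV1 z f f1 f2 W W1 a i x) = 0.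
  move=> [chi0 chi10 chi20]; have fx : f x = 0 by rewrite /f chi0 mul0r.
  have f1x k : f1 k x = 0 by rewrite /f1 chi0 chi10 !mul0r addr0.
  have f2x k l : f2 k l x = 0 by rewrite /f2 chi0 !chi10 chi20 !mul0r !addr0.
  split=> //; apply: big1 => i _; rewrite /cardV2 /cardV1 fx !f1x !f2x.
  have s0 (g : 'I_n -> R) : (forall k, g k = 0) -> \sum_k g k = 0 by move=> H; rewrite big1.
  rewrite !s0; first (by ring); by move=> k; rewrite ?f1x ?f2x ?mul0r ?mulr0 ?expr0n.
have G0 : 0 <= \sum_i U1 i x ^+ 2 by apply: sumr_ge0 => i _; exact: sqr_ge0.
have r20 := sqr_ge0 r.
have p0 := psi0 x.
case: (leP (en (x - z)) r) => xr; last first.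
  have [/bad[fx s0] [p0' p10 p20]] := support xr.
  have Lp0 : Lpsi x = 0 by apply: big1 => i _.
  by rewrite sF s0 fx p0' Lp0 expr0n/= !(mulr0, mul0r, subr0, addr0).
set l := LU x in sF *; set lp := Lpsi x in sF *.
have hB := rhsB xr; rewrite /carleman_rhs -/l -/lp in hB.
have h1 : psi x * U x * l >= - (psi x * `|U x| * `|l|).
  by rewrite lerNl -!mulrA -mulrN ler_wpM2l// -normrM -normrN ler_norm.
have h2 : 2^-1 * U x ^+ 2 * lp <= 2^-1 * U x ^+ 2 * `|lp|.
  by rewrite ler_wpM2l ?ler_norm// mulr_ge0 ?sqr_ge0.
have w0 : 0 <= W x ^+ a by rewrite exprn_ge0// ltW.
have q0 := nsq_ge0 (x - z).
have [[Wr W1E]|/bad[-> s0]] := weight x; last first.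
  rewrite expr0n mulr0 sF s0 add0r.
  have : 0 <= B + 3 * r ^+ 2 * (psi x * (\sum_i U1 i x ^+ 2) + psi x * U x * l - 2^-1 * U x ^+ 2 * lp).
    have hh : 0 <= r ^+ 2 * (W x ^+ a * nsq (x - z)) * (chi x ^+ 2 * l ^+ 2 + U x ^+ 2 * Lchi x ^+ 2).
      apply: mulr_ge0; first by apply: mulr_ge0 => //; exact: mulr_ge0.
      by apply: addr_ge0; apply: mulr_ge0; exact: sqr_ge0.
    have hg : 0 <= psi x * (\sum_i U1 i x ^+ 2) by exact: mulr_ge0.
    have hd : 0 <= r ^+ 2 * (psi x * (\sum_i U1 i x ^+ 2) + (psi x * U x * l + psi x * `|U x| * `|l|) +
       (2^-1 * U x ^+ 2 * `|lp| - 2^-1 * U x ^+ 2 * lp)).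
      by apply: mulr_ge0 => //; lra.
    lra.
  by [].
have qr : nsq (x - z) <= r ^+ 2 by rewrite -sqr_en lerXn2r ?nnegrE ?en_ge0.
have H := carleman_pointwise hf a0 Wr (W0 x) W1E qr.
rewrite sF; apply: le_trans H _; rewrite [leRHS]addrCA [leLHS]addrC lerD2l.
set lc := Lchi x in hB *; set w := W x ^+ a * nsq (x - z) in hB *.
have -> : \sum_i f2 i i x = chi x * l + 2 * \sum_i chi1 i x * U1 i x + U x * lc.
  rewrite /l /lc !big_distrr/= -!big_split/=; apply: eq_bigr => i _; rewrite /f2; ring.
set s := \sum_i chi1 i x * U1 i x.
have cs : s ^+ 2 <= (\sum_i chi1 i x ^+ 2) * \sum_i U1 i x ^+ 2.
  have := cauchy_schwarz_row (\row_i chi1 i x) (\row_i U1 i x).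
  rewrite /nsq; under eq_bigr do rewrite !mxE.
  under [X in _ <= X * _ -> _]eq_bigr do rewrite !mxE.
  by under [X in _ <= _ * X -> _]eq_bigr do rewrite !mxE.
have ww : 0 <= w by exact: mulr_ge0.
have h3 : w * s ^+ 2 <= psi x * \sum_i U1 i x ^+ 2.
  apply: le_trans (_ : w * ((\sum_i chi1 i x ^+ 2) * \sum_i U1 i x ^+ 2) <= _).
    exact: ler_wpM2l.
  by rewrite mulrA ler_wpM2r// gradient.
have sq3 : (chi x * l + 2 * s + U x * lc) ^+ 2 <=
    3 * (chi x ^+ 2 * l ^+ 2 + 4 * s ^+ 2 + U x ^+ 2 * lc ^+ 2).
  have := sqr_ge0 (chi x * l - 2 * s); have := sqr_ge0 (chi x * l - U x * lc).
  have := sqr_ge0 (2 * s - U x * lc); lra.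
have h4 : 4^-1 * r ^+ 2 * w * (chi x * l + 2 * s + U x * lc) ^+ 2 <=
    4^-1 * r ^+ 2 * w * (3 * (chi x ^+ 2 * l ^+ 2 + 4 * s ^+ 2 + U x ^+ 2 * lc ^+ 2)).
  by apply: ler_wpM2l => //; apply: mulr_ge0 => //; apply: mulr_ge0.
have h5 : r ^+ 2 * (w * s ^+ 2) <= r ^+ 2 * (psi x * \sum_i U1 i x ^+ 2) by exact: ler_wpM2l.
have h6 : 0 <= r ^+ 2 * ((psi x * U x * l + psi x * `|U x| * `|l|) +
       (2^-1 * U x ^+ 2 * `|lp| - 2^-1 * U x ^+ 2 * lp)).
  by apply: mulr_ge0 => //; lra.
lra.
Qed.

Lemma integrable_carleman : (leb R n).-integrable setT
  (EFin \o (fun x => W x ^+ a * (chi x * U x) ^+ 2)).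
Proof.
case: hf => cf _ _ _ _; apply: (@integrable_continuous R n _ z r).
  by apply: continuous_mul; exact: continuous_exp.
move=> x nx; have xr : r < en (x - z).
  by rewrite ltNge; apply/negP => xr; apply: nx; exact: en_le_cube.
by have [[-> _ _] _] := support xr; rewrite mul0r expr0n mulr0.
Qed.

(** In the integral of the pointwise bound the divergences contribute 0 and the constant [B] is
    spread over a cube of side [2 r]. *)
Lemma carleman : \int[leb R n]_x (W x ^+ a * (chi x * U x) ^+ 2) <= B * (2 * r) ^+ n.
Proof.
have idF i : (leb R n).-integrable setT (EFin \o dF i).
  apply: (@integrable_continuous R n _ z r); first exact: continuous_dF.
  move=> x nx; have xr : r < en (x - z).
    by rewrite ltNge; apply/negP => xr; apply: nx; exact: en_le_cube.
  have [[chi0 chi10 chi20] [p0 p10 p20]] := support xr.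
  have fx : f x = 0 by rewrite /f chi0 mul0r.
  have f1x k : f1 k x = 0 by rewrite /f1 chi0 chi10 !mul0r addr0.
  have f2x k l : f2 k l x = 0 by rewrite /f2 chi0 !chi10 chi20 !mul0r !addr0.
  rewrite /dF /cardV2 /cardV1 /dV3 fx !f1x !f2x p0 !p10 p20.
  have s0 (g : 'I_n -> R) : (forall k, g k = 0) -> \sum_k g k = 0 by move=> H; rewrite big1.
  rewrite !s0; first (by ring); by move=> k; rewrite ?f1x ?f2x ?mul0r ?mulr0 ?expr0n.
have isF := integrable_sum (index_enum 'I_n) idF.
have iW := integrable_carleman.
have := @Rintegral_le_cube R n _ B r z r0 (integrable_sub iW isF).
rewrite RintegralB; [|exact: measurableT|exact: iW|exact: isF].
rewrite Rintegral_sum// big1 ?subr0; last by move=> i _; exact: dF_int.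
apply=> x.
  move=> _; rewrite lerBlDr; apply: le_trans (pointwise x) _.
  by rewrite lerD2r; case: ifP.
move=> nx; rewrite subr_le0; apply: le_trans (pointwise x) _.
by rewrite ifN ?add0r// -ltNge ltNge; apply/negP => xr; apply: nx; exact: en_le_cube.
Qed.

End carleman_integrated.


(** * The cutoffs and the regularised weight *)

Section cutoff.
Context (R : realType) (n : nat).
Local Notation V := 'rV[R]_n.
Implicit Types (e : sexp R n) (x y z : V).
Local Notation K0 := (kap R n).

Lemma c2_add f (f1 : 'I_n -> V -> R) f2 g (g1 : 'I_n -> V -> R) g2 :
  c2 f f1 f2 -> c2 g g1 g2 ->
  c2 (fun x => f x + g x) (fun i x => f1 i x + g1 i x) (fun i j x => f2 i j x + g2 i j x).
Proof.
move=> [cf [cf1 cf2] df df1 sf] [cg [cg1 cg2] dg dg1 sg]; split.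
- exact: continuous_add.
- by split=> *; exact: continuous_add.
- by move=> i x; exact: is_derive_add.
- by move=> i j x; exact: is_derive_add.
- by move=> i j x; rewrite sf sg.
Qed.

Lemma nbhs_nsq_lt y (b : R) : nsq y < b -> \near y, nsq y < b.
Proof. by move=> yb; exact: (@continuous_nsq R n y _ (lt_nbhsl yb)). Qed.

Lemma nbhs_nsq_gt y (b : R) : b < nsq y -> \near y, b < nsq y.
Proof. by move=> yb; exact: (@continuous_nsq R n y _ (lt_nbhsr yb)). Qed.

(** The annulus where the derivatives of [kap] live. Rescaled by [c], it is a region where [|x - z|]
    is comparable to [1 / c], so that the singular weight is bounded there by a power of [c]. *)
Definition shell e := forall y, nsq y < 1 \/ 2 < nsq y -> ev e y = 0.

Lemma shell_dd e i : shell e -> shell (dd i e).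
Proof.
move=> se y [y1|y2]; rewrite (@ev_dd_local R n e (Cst n 0))//=.
  have := nbhs_nsq_lt y1; apply: filterS => w w1; by apply: se; left.
have := nbhs_nsq_gt y2; apply: filterS => w w1; by apply: se; right.
Qed.

Lemma shell_dd_kap i : shell (dd i K0).
Proof.
move=> y [y1|y2].
  rewrite (@ev_dd_local R n K0 (Cst n 1))//=.
  have := nbhs_nsq_lt y1; apply: filterS => w w1; apply: ev_kap1; exact: ltW.
rewrite (@ev_dd_local R n K0 (Cst n 0))//=.
have := nbhs_nsq_gt y2; apply: filterS => w w1; apply: ev_kap0; exact: ltW.
Qed.

(** [|grad kap|^2], kept as an expression because [psi] is built from it and the Laplacian of [psi]
    enters the estimate. *)
Definition gsq : sexp R n := sSum (index_enum 'I_n) (fun i => Mul (dd i K0) (dd i K0)).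

Lemma ev_gsq y : ev gsq y = \sum_i ev (dd i K0) y ^+ 2.
Proof. by rewrite ev_sSum; apply: eq_bigr => i _; rewrite expr2. Qed.

Lemma ev_gsq_ge0 y : 0 <= ev gsq y.
Proof. by rewrite ev_gsq; apply: sumr_ge0 => i _; exact: sqr_ge0. Qed.

Lemma shell_gsq : shell gsq.
Proof. by move=> y hy; rewrite ev_gsq big1// => i _; rewrite shell_dd_kap// expr0n. Qed.

Lemma shell_lap_kap : shell (lap K0).
Proof. by move=> y hy; rewrite ev_lap big1// => i _; apply: shell_dd hy; exact: shell_dd_kap. Qed.

Lemma shell_lap_gsq : shell (lap gsq).
Proof. by move=> y hy; rewrite ev_lap big1// => i _; do 2!apply: shell_dd => //; exact: shell_gsq. Qed.

Lemma nsq2_bounded e : (forall y, 2 < nsq y -> ev e y = 0) ->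
  exists M, 0 < M /\ forall y, `|ev e y| <= M.
Proof.
move=> se; apply: (@continuous_support_bounded R n _ 0 2); first exact: continuous_ev.
move=> y ny; apply: se; rewrite ltNge; apply/negP => y2; apply: ny; apply: en_le_cube.
rewrite subr0 -(@ler_pXn2r _ 2) ?nnegrE ?en_ge0// sqr_en; lra.
Qed.

Lemma cutoff_bounds : exists2 M, 1 <= M & forall y,
  [/\ `|ev K0 y| <= M, `|ev (lap K0) y| <= M, ev gsq y <= M & `|ev (lap gsq) y| <= M].
Proof.
have [M1 [M10 H1]] := @nsq2_bounded K0 (fun y h => ev_kap0 (ltW h)).
have [M2 [M20 H2]] := @nsq2_bounded _ (fun y h => shell_lap_kap (or_intror h)).
have [M3 [M30 H3]] := @nsq2_bounded _ (fun y h => shell_gsq (or_intror h)).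
have [M4 [M40 H4]] := @nsq2_bounded _ (fun y h => shell_lap_gsq (or_intror h)).
exists (1 + M1 + M2 + M3 + M4); first by lra.
move=> y; have := H1 y; have := H2 y; have := H3 y; have := H4 y.
rewrite (ger0_norm (ev_gsq_ge0 y)) => h4 h3 h2 h1; split; lra.
Qed.

Lemma ev_kap_ge0 y : 0 <= ev K0 y.
Proof. by rewrite ev_kap mulr_ge0 ?invr_ge0 ?th_ge0. Qed.

End cutoff.

Section weights.
Context (R : realType) (n : nat).
Local Notation V := 'rV[R]_n.
Local Notation K0 := (kap R n).
Local Notation G0 := (gsq R n).
Variables (z : V) (r s : R) (a : nat).
Hypotheses (s0 : 0 < s) (sr : s <= r).
Let co : R := (2 * r)^-1.
Let ci : R := s^-1.
Let r0 : 0 < r. Proof. exact: lt_le_trans sr. Qed.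
Let co0 : 0 < co. Proof. by rewrite invr_gt0 mulr_gt0. Qed.
Let ci0 : 0 < ci. Proof. by rewrite invr_gt0. Qed.

(** Equal to 1 for [sqrt 2 s <= |x - z| <= 2 r], and to 0 for [|x - z| < s] as well as for
    [|x - z| > 3 r], where 3 is a round value above [2 sqrt 2]. *)
Definition chi (x : V) : R := sc K0 co z x - sc K0 ci z x.
Definition chi1 i (x : V) : R := co * sc (dd i K0) co z x - ci * sc (dd i K0) ci z x.
Definition chi2 i j (x : V) : R :=
  co * (co * sc (dd i (dd j K0)) co z x) - ci * (ci * sc (dd i (dd j K0)) ci z x).

Lemma c2_chi : c2 chi chi1 chi2.
Proof. by apply: c2_sub; exact: c2_sc. Qed.

(** On the shell of scale [c], outside the hole, [W <= c^2], so
    [W^a |x - z|^2 = W^(a-1) <= c^(2 a - 2)]. The missing [c^2] comes from the gradient of the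
    rescaled cutoff, and the 2 from splitting the square of the difference in [chi1]. *)
Let ko : R := 2 * (co ^+ 2) ^+ a.
Let ki : R := 2 * (ci ^+ 2) ^+ a.

Definition psi (x : V) : R := ko * sc G0 co z x + ki * sc G0 ci z x.
Definition psi1 i (x : V) : R := ko * (co * sc (dd i G0) co z x) + ki * (ci * sc (dd i G0) ci z x).
Definition psi2 i j (x : V) : R :=
  ko * (co * (co * sc (dd i (dd j G0)) co z x)) + ki * (ci * (ci * sc (dd i (dd j G0)) ci z x)).

Lemma c2_psi : c2 psi psi1 psi2.
Proof. by apply: c2_add; apply: c2_scale; exact: c2_sc. Qed.

(* [nsq (x - z)], made positive near [z]. *)
Let Dn (x : V) : R := sc (sNsq R n) 1 z x + sc K0 (2 * ci) z x.
Let Dn1 i (x : V) : R := 1 * sc (dd i (sNsq R n)) 1 z x + 2 * ci * sc (dd i K0) (2 * ci) z x.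

Definition W (x : V) : R := (Dn x)^-1.
Definition W1 i (x : V) : R := - (Dn x ^+ 2)^-1 * Dn1 i x.

Let sc_nsq x : sc (sNsq R n) 1 z x = nsq (x - z).
Proof. by rewrite /sc scale1r ev_sNsq. Qed.

Let nsq_sc c x : nsq (c *: (x - z)) = c ^+ 2 * nsq (x - z).
Proof. exact: nsqZ. Qed.

Let Dn0 x : 0 < Dn x.
Proof.
rewrite /Dn sc_nsq; have [q0|q0] := ltP 0 (nsq (x - z)).
  by rewrite ltr_pwDl// ev_kap_ge0.
have qe : nsq (x - z) = 0 by apply/eqP; rewrite eq_le q0 nsq_ge0.
by rewrite qe add0r /sc ev_kap1 ?ltr01// nsq_sc qe mulr0.
Qed.

Lemma W_gt0 x : 0 < W x. Proof. by rewrite invr_gt0. Qed.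

Let cDn : continuous Dn. Proof. by apply: continuous_add; exact: continuous_sc. Qed.

Lemma continuous_W : continuous W.
Proof. by apply: continuous_inv => // y; rewrite gt_eqF. Qed.

Lemma continuous_W1 i : continuous (W1 i).
Proof.
apply: continuous_mul.
  apply: continuous_opp; apply: continuous_inv; first exact: continuous_exp.
  by move=> y; rewrite gt_eqF// exprn_gt0.
by apply: continuous_add; apply: continuous_scale; exact: continuous_sc.
Qed.

Lemma is_derive_W i x : is_derive x (delta_mx ord0 i) W (W1 i x).
Proof.
have d : is_derive x (delta_mx ord0 i) Dn (Dn1 i x).
  by apply: is_derive_add; exact: is_derive_sc_coord.
have D0 : Dn x != 0 by rewrite gt_eqF.
have [dD dE] := d; apply: DeriveDef; first exact: derivableV.
by rewrite deriveV// dE.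
Qed.

Let q x := nsq (x - z).

Let qin x : q x < s ^+ 2 -> nsq (co *: (x - z)) < 1 /\ nsq (ci *: (x - z)) < 1.
Proof.
move=> qs; rewrite !nsq_sc -/(q x) /co /ci !exprVn; split.
  rewrite mulrC ltr_pdivrMr ?mul1r ?exprn_gt0 ?mulr_gt0//.
  by apply: lt_le_trans qs _; rewrite lerXn2r ?nnegrE ?mulr_ge0 ?(ltW s0) ?(ltW r0)//; have := r0; have := sr; lra.
by rewrite mulrC ltr_pdivrMr ?mul1r ?exprn_gt0.
Qed.

Lemma W_good x : s ^+ 2 <= nsq (x - z) -> W x * nsq (x - z) = 1 /\
  forall i, W1 i x = - 2 * (x ord0 i - z ord0 i) * W x ^+ 2.
Proof.
move=> qs; have hk : 2 < nsq ((2 * ci) *: (x - z)).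
  rewrite nsq_sc /ci exprMn exprVn.
  have : 1 <= (s ^+ 2)^-1 * nsq (x - z) by rewrite mulrC ler_pdivlMr ?mul1r ?exprn_gt0.
  lra.
have DE : Dn x = nsq (x - z) by rewrite /Dn sc_nsq /sc ev_kap0 ?addr0// ltW.
split; first by rewrite /W DE mulVf// gt_eqF// (lt_le_trans _ qs)// exprn_gt0.
move=> i; rewrite /W1 /W DE /Dn1 [X in _ + _ * X](shell_dd_kap _ (or_intror hk)).
rewrite mulr0 addr0 mul1r /sc scale1r ev_dd_sNsq !mxE exprVn; ring.
Qed.

Lemma chi_in x : nsq (x - z) < s ^+ 2 ->
  [/\ chi x = 0, forall i, chi1 i x = 0 & forall i j, chi2 i j x = 0].
Proof.
move=> /qin[ho hi]; split.
- by rewrite /chi /sc !ev_kap1 ?subrr// ltW.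
- by move=> i; rewrite /chi1 /sc !(shell_dd_kap i (or_introl _))// !mulr0 subrr.
- move=> i j; rewrite /chi2 /sc.
  by rewrite !(shell_dd i (shell_dd_kap j) (or_introl _))// !mulr0 subrr.
Qed.

Let qout x : 3 * r < en (x - z) -> 2 < nsq (co *: (x - z)) /\ 2 < nsq (ci *: (x - z)).
Proof.
move=> xr; have : (3 * r) ^+ 2 < q x.
  by rewrite /q -sqr_en ltrXn2r// ?nnegrE ?mulr_ge0 ?en_ge0 ?(ltW r0).
have r2 : 0 < r ^+ 2 by rewrite exprn_gt0.
have s2r : s ^+ 2 <= r ^+ 2 by rewrite lerXn2r ?nnegrE ?(ltW s0) ?(ltW r0).
rewrite exprMn => hq; rewrite !nsq_sc -/(q x) /co /ci !exprVn; split.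
  by rewrite mulrC ltr_pdivlMr ?exprn_gt0 ?mulr_gt0// exprMn; lra.
by rewrite mulrC ltr_pdivlMr ?exprn_gt0//; lra.
Qed.

Lemma cutoff_out x : 3 * r < en (x - z) ->
  [/\ chi x = 0, forall i, chi1 i x = 0 & forall i j, chi2 i j x = 0] /\
  [/\ psi x = 0, forall i, psi1 i x = 0 & forall i j, psi2 i j x = 0].
Proof.
have sg := @shell_gsq R n.
move=> /qout[ho hi]; split; split.
- by rewrite /chi /sc !ev_kap0 ?subrr// ltW.
- by move=> i; rewrite /chi1 /sc !(shell_dd_kap i (or_intror _))// !mulr0 subrr.
- move=> i j; rewrite /chi2 /sc.
  by rewrite !(shell_dd i (shell_dd_kap j) (or_intror _))// !mulr0 subrr.
- by rewrite /psi /sc !(sg _ (or_intror _))// !mulr0 addr0.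
- by move=> i; rewrite /psi1 /sc !(shell_dd i sg (or_intror _))// !mulr0 addr0.
- move=> i j; rewrite /psi2 /sc.
  by rewrite !(shell_dd i (shell_dd j sg) (or_intror _))// !mulr0 addr0.
Qed.

Lemma psi_ge0 x : 0 <= psi x.
Proof.
apply: addr_ge0; apply: mulr_ge0; rewrite ?ev_gsq_ge0// /ko /ki mulr_ge0// exprn_ge0//;
  exact: sqr_ge0.
Qed.

Hypothesis a0 : (0 < a)%N.

Lemma Wq x : s ^+ 2 <= nsq (x - z) -> W x ^+ a * nsq (x - z) = W x ^+ a.-1.
Proof. by move=> /W_good[Wr _]; rewrite -[in LHS](prednK a0) exprSr -mulrA Wr mulr1. Qed.

Lemma weight_shell e (c : R) x : 0 < c -> shell e -> s ^+ 2 <= nsq (x - z) ->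
  W x ^+ a * nsq (x - z) * `|sc e c z x| <= (c ^+ 2) ^+ a.-1 * `|sc e c z x|.
Proof.
move=> c0 se qs; rewrite Wq//; have [Wr _] := W_good qs.
have [h|h] := ltP (nsq (c *: (x - z))) 1.
  by rewrite /sc se ?normr0 ?mulr0//; left.
rewrite ler_wpM2r// lerXn2r ?nnegrE ?(ltW (W_gt0 x)) ?sqr_ge0//.
rewrite nsq_sc in h; rewrite -[leRHS]mulr1 -Wr mulrCA -[leLHS]mulr1.
by rewrite ler_wpM2l// ltW// W_gt0.
Qed.

Let pE (c : R) : (c ^+ 2) ^+ a = c ^+ 2 * (c ^+ 2) ^+ a.-1.
Proof. by rewrite -exprS prednK. Qed.

Lemma gradient_weight x :
  W x ^+ a * nsq (x - z) * (\sum_i chi1 i x ^+ 2) <= psi x.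
Proof.
have [qs|qs] := ltP (nsq (x - z)) (s ^+ 2).
  have [_ h _] := chi_in qs; rewrite big1 ?mulr0 ?psi_ge0// => i _.
  by rewrite h expr0n.
have g0 (c : R) : `|sc G0 c z x| = sc G0 c z x by rewrite ger0_norm ?ev_gsq_ge0.
have := weight_shell co0 (@shell_gsq R n) qs; have := weight_shell ci0 (@shell_gsq R n) qs.
rewrite !g0 /psi /ko /ki !pE; set w := W x ^+ a * _; set wi := (ci ^+ 2) ^+ a.-1.
set wo := (co ^+ 2) ^+ a.-1; set gi := sc G0 ci z x; set go := sc G0 co z x => hi ho.
have w0 : 0 <= w by rewrite mulr_ge0 ?nsq_ge0// exprn_ge0// ltW ?W_gt0.
have : \sum_i chi1 i x ^+ 2 <= 2 * (co ^+ 2 * go + ci ^+ 2 * gi).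
  rewrite /go /gi /sc !ev_gsq !big_distrr/= -big_split/= big_distrr/=; apply: ler_sum => i _.
  rewrite /chi1 /sc; set u := co * _; set v := ci * _.
  have := sqr_ge0 (u + v); rewrite -!exprMn -/u -/v; lra.
move=> /(ler_wpM2l w0) h; apply: le_trans h _.
have := ler_wpM2l (sqr_ge0 co) ho; have := ler_wpM2l (sqr_ge0 ci) hi; lra.
Qed.

Lemma cutoff_inside x : s ^+ 2 * 2 <= nsq (x - z) -> nsq (x - z) <= 4 * r ^+ 2 -> chi x = 1.
Proof.
move=> h1 h2; rewrite /chi /sc ev_kap1; last first.
  by rewrite nsq_sc /co exprVn mulrC ler_pdivrMr ?mul1r ?exprn_gt0 ?mulr_gt0// exprMn; lra.
rewrite ev_kap0 ?subr0// nsq_sc /ci exprVn mulrC ler_pdivlMr ?exprn_gt0//; lra.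
Qed.

Variables (K A M dl : R) (U : V -> R) (U1 : 'I_n -> V -> R) (U2 : 'I_n -> 'I_n -> V -> R).
Hypotheses (K1 : 1 <= K) (hK : forall y : V,
  [/\ `|ev K0 y| <= K, `|ev (lap K0) y| <= K, ev G0 y <= K & `|ev (lap G0) y| <= K]).
Hypothesis hU : c2 U U1 U2.
Hypotheses (A0 : 0 <= A) (M0 : 0 <= M) (dl0 : 0 <= dl).
Hypothesis LU_le : forall x, en (x - z) <= 3 * r -> `|\sum_i U2 i i x| <= A.
Hypothesis LU_small : forall x, s <= en (x - z) -> en (x - z) <= 3 * r ->
  `|\sum_i U2 i i x| <= 2 * (A * (en (x - z) / r) ^+ a.-1).
Hypothesis U_le : forall x, en (x - z) <= 3 * r -> `|U x| <= M.
Hypothesis U_small : forall x, en (x - z) <= 2 * s -> `|U x| <= dl.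

(** The contribution of the inner shell, at distance about [s] from [z]. It is controlled by the
    size [dl] of [U] there and will tend to 0 with [s]. *)
Definition inner_error : R :=
  27 / 2 * r ^+ 2 * (ci ^+ 2) ^+ a.+1 * K ^+ 2 * dl ^+ 2 +
  54 * r ^+ 2 * K * (ci ^+ 2) ^+ a * dl * A +
  27 * r ^+ 2 * (ci ^+ 2) ^+ a.+1 * K * dl ^+ 2.

(** 108 is [27/4 * 16]: [27/4] is the factor [3/4] of [carleman_rhs] at radius [3 r], and 16 comes
    from [chi^2 <= 4 K^2] and [LU^2 <= 4 A^2 (|x - z| / r)^(2 a - 2)]. The other outer terms fit
    under the same constant. *)
Let B := 108 * K ^+ 2 * (r ^- 2) ^+ a * (r ^+ 2 * A + M) ^+ 2 + inner_error.

Let near_small e x : shell e -> `|U x| * `|sc e ci z x| <= dl * `|sc e ci z x|.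
Proof.
move=> se; have [h|h] := leP (en (x - z)) (2 * s); first by rewrite ler_wpM2r// U_small.
rewrite /sc se ?normr0 ?mulr0//; right; rewrite nsq_sc /ci exprVn mulrC ltr_pdivlMr ?exprn_gt0//.
have : (2 * s) ^+ 2 < nsq (x - z) by rewrite -sqr_en ltrXn2r ?nnegrE ?mulr_ge0 ?en_ge0 ?(ltW s0).
rewrite exprMn; have : 0 < s ^+ 2 by rewrite exprn_gt0.
lra.
Qed.

Lemma rhs_bound x : en (x - z) <= 3 * r ->
  carleman_rhs z U U2 chi chi2 psi psi2 W a (3 * r) x <= B.
Proof.
move=> xr; have K0' : 0 <= K by exact: le_trans K1.
have r20 : 0 < r ^+ 2 by rewrite exprn_gt0.
set om := (r ^- 2) ^+ a; set P := (co ^+ 2) ^+ a; set Q := (ci ^+ 2) ^+ a.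
have om0 : 0 <= om by rewrite exprn_ge0// invr_ge0 ltW.
have P0 : 0 <= P by rewrite exprn_ge0// sqr_ge0.
have Q0 : 0 <= Q by rewrite exprn_ge0// sqr_ge0.
have cor : co ^+ 2 = 4^-1 * r ^- 2 by rewrite /co exprVn exprMn invfM; congr (_^-1 * _); ring.
have cor1 : r ^+ 2 * co ^+ 2 = 4^-1 by rewrite cor mulrCA mulfV ?mulr1// gt_eqF.
have Pom : P <= om.
  by rewrite lerXn2r ?nnegrE ?sqr_ge0 ?invr_ge0 ?(ltW r20)// cor ler_piMl ?invr_ge0 ?(ltW r20)//; lra.
have QE : (ci ^+ 2) ^+ a.+1 = ci ^+ 2 * Q by rewrite exprS.
have kx : `|chi x| <= 2 * K.
  have [h1 _ _ _] := hK (co *: (x - z)); have [h2 _ _ _] := hK (ci *: (x - z)).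
  have -> : 2 * K = K + K by ring.
  exact: le_trans (ler_normB _ _) (lerD h1 h2).
have hUM := U_le xr; have hLA := LU_le xr.
set l := \sum_i U2 i i x in hLA *.
have U2M : U x ^+ 2 <= M ^+ 2 by rewrite -real_normK ?num_real// lerXn2r ?nnegrE.
have go1 : sc G0 co z x <= K by have [] := hK (co *: (x - z)).
have gi1 : sc G0 ci z x <= K by have [] := hK (ci *: (x - z)).
have go0 : 0 <= sc G0 co z x by exact: ev_gsq_ge0.
have gi0 : 0 <= sc G0 ci z x by exact: ev_gsq_ge0.
have b3 : psi x * `|U x| * `|l| <= (2 * P * K * M + 2 * Q * K * dl) * A.
  apply: ler_pM => //; first by rewrite mulr_ge0 ?psi_ge0.
  rewrite /psi mulrDl; apply: lerD.
    rewrite /ko -!mulrA ler_wpM2l// ler_wpM2l//; exact: ler_pM.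
  rewrite /ki -!mulrA ler_wpM2l// ler_wpM2l// mulrC.
  have := near_small x (@shell_gsq R n); rewrite (ger0_norm gi0) => /le_trans; apply.
  by rewrite mulrC ler_wpM2r.
have lpE : \sum_i psi2 i i x =
    2 * P * (co ^+ 2 * sc (lap G0) co z x) + 2 * Q * (ci ^+ 2 * sc (lap G0) ci z x).
  rewrite /psi2 big_split/= /sc !ev_lap !big_distrr/=; congr (_ + _); apply: eq_bigr => i _;
    rewrite /ko /ki -/P -/Q; ring.
have lgo : `|sc (lap G0) co z x| <= K by have [] := hK (co *: (x - z)).
have lgi : `|sc (lap G0) ci z x| <= K by have [] := hK (ci *: (x - z)).
have sm2 e : shell e -> `|sc e ci z x| <= K -> U x ^+ 2 * `|sc e ci z x| <= dl ^+ 2 * `|sc e ci z x|.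
  move=> se hk; have h := near_small x se.
  rewrite -real_normK ?num_real// expr2 -mulrA (le_trans (ler_wpM2l (normr_ge0 _) h))//.
  by rewrite mulrCA expr2 -[leRHS]mulrA ler_wpM2l.
have b4 : 2^-1 * U x ^+ 2 * `|\sum_i psi2 i i x| <=
    P * co ^+ 2 * K * M ^+ 2 + Q * ci ^+ 2 * K * dl ^+ 2.
  have h1 : `|\sum_i psi2 i i x| <= 2 * P * (co ^+ 2 * `|sc (lap G0) co z x|) +
      2 * Q * (ci ^+ 2 * `|sc (lap G0) ci z x|).
    have N (p c y : R) : 0 <= p -> 0 <= c -> `|2 * p * (c ^+ 2 * y)| = 2 * p * (c ^+ 2 * `|y|).
      by move=> p0 c0; rewrite normrM ger0_norm ?mulr_ge0// normrM ger0_norm ?sqr_ge0.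
    by rewrite lpE (le_trans (ler_normD _ _))// !N// ltW.
  have U20 := sqr_ge0 (U x).
  have h2 : U x ^+ 2 * `|sc (lap G0) co z x| <= M ^+ 2 * K by exact: ler_pM.
  have h3 : U x ^+ 2 * `|sc (lap G0) ci z x| <= dl ^+ 2 * K.
    apply: le_trans (sm2 _ (@shell_lap_gsq R n) lgi) _.
    by rewrite ler_wpM2l// sqr_ge0.
  have h4 : U x ^+ 2 * `|\sum_i psi2 i i x| <= U x ^+ 2 * (2 * P * (co ^+ 2 * `|sc (lap G0) co z x|) +
      2 * Q * (ci ^+ 2 * `|sc (lap G0) ci z x|)) by rewrite ler_wpM2l.
  have h5 : P * co ^+ 2 * (U x ^+ 2 * `|sc (lap G0) co z x|) <= P * co ^+ 2 * (M ^+ 2 * K).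
    by rewrite ler_wpM2l// mulr_ge0// sqr_ge0.
  have h6 : Q * ci ^+ 2 * (U x ^+ 2 * `|sc (lap G0) ci z x|) <= Q * ci ^+ 2 * (dl ^+ 2 * K).
    by rewrite ler_wpM2l// mulr_ge0// sqr_ge0.
  lra.
(* The singularity of the weight is compensated exactly by the decay assumed for [LU]:
   [W^(a-1) |x - z|^(2 a - 2) = 1]. The terms with [U] live on the shells, where [weight_shell]
   bounds the weight. *)
have b12 : W x ^+ a * nsq (x - z) *
    (chi x ^+ 2 * l ^+ 2 + U x ^+ 2 * (\sum_i chi2 i i x) ^+ 2) <=
    16 * K ^+ 2 * A ^+ 2 * (r ^+ 2 * om) +
    2 * (co ^+ 2 * P * K ^+ 2 * M ^+ 2 + ci ^+ 2 * Q * K ^+ 2 * dl ^+ 2).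
  have R1 : 0 <= 16 * K ^+ 2 * A ^+ 2 * (r ^+ 2 * om).
    apply: mulr_ge0; last by rewrite mulr_ge0// ltW.
    by apply: mulr_ge0; [apply: mulr_ge0 => //|]; exact: sqr_ge0.
  have R2 : 0 <= co ^+ 2 * P * K ^+ 2 * M ^+ 2.
    by do 2!(apply: mulr_ge0; last exact: sqr_ge0); rewrite mulr_ge0// sqr_ge0.
  have R3 : 0 <= ci ^+ 2 * Q * K ^+ 2 * dl ^+ 2.
    by do 2!(apply: mulr_ge0; last exact: sqr_ge0); rewrite mulr_ge0// sqr_ge0.
  have [qs|qs] := ltP (nsq (x - z)) (s ^+ 2).
    have [-> _ h] := chi_in qs; rewrite big1 => [|i _]; last exact: h.
    by rewrite expr0n/= mul0r !mulr0 addr0 mulr0; lra.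
  have w0 : 0 <= W x ^+ a * nsq (x - z).
    by rewrite mulr_ge0 ?nsq_ge0// exprn_ge0// ltW ?W_gt0.
  have lcE : \sum_i chi2 i i x = co ^+ 2 * sc (lap K0) co z x - ci ^+ 2 * sc (lap K0) ci z x.
    rewrite /chi2 big_split/= sumrN /sc !ev_lap !big_distrr/=.
    by congr (_ - _); apply: eq_bigr => i _; ring.
  have ko1 : `|sc (lap K0) co z x| <= K by have [] := hK (co *: (x - z)).
  have ki1 : `|sc (lap K0) ci z x| <= K by have [] := hK (ci *: (x - z)).
  rewrite mulrDr; apply: lerD.
    have se : s <= en (x - z) by rewrite -(@ler_pXn2r _ 2) ?nnegrE ?(ltW s0) ?en_ge0// sqr_en.
    have h := LU_small se xr; rewrite -/l in h.
    have h2 : l ^+ 2 <= 4 * A ^+ 2 * (nsq (x - z) * r ^- 2) ^+ a.-1.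
      rewrite -[l ^+ 2]real_normK ?num_real//.
      apply: le_trans (_ : (2 * (A * (en (x - z) / r) ^+ a.-1)) ^+ 2 <= _).
        rewrite lerXn2r ?nnegrE// !mulr_ge0// exprn_ge0// divr_ge0 ?en_ge0// ltW//.
      rewrite 2!exprMn.
      have -> : (en (x - z) / r) ^+ a.-1 ^+ 2 = (nsq (x - z) * r ^- 2) ^+ a.-1.
        by rewrite exprAC expr_div_n sqr_en.
      lra.
    have h3 : W x ^+ a * nsq (x - z) * l ^+ 2 <= 4 * A ^+ 2 * (r ^+ 2 * om).
      apply: le_trans (ler_wpM2l w0 h2) _; rewrite Wq//.
      have [Wr _] := W_good qs.
      have -> : r ^+ 2 * om = (r ^- 2) ^+ a.-1.
        by rewrite /om -[X in _ * _ ^+ X](prednK a0) [_ ^+ a.-1.+1]exprS mulrA mulfV ?mul1r// gt_eqF.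
      rewrite [(nsq _ * _) ^+ _]exprMn; set w := W x ^+ a.-1; set qa := nsq _ ^+ _.
      have -> : w * (4 * A ^+ 2 * (qa * r ^- 2 ^+ a.-1)) = 4 * A ^+ 2 * (w * qa * r ^- 2 ^+ a.-1) by ring.
      by rewrite /w /qa -exprMn Wr expr1n mul1r.
    have h4 : chi x ^+ 2 <= 4 * K ^+ 2.
      rewrite -real_normK ?num_real// (_ : 4 * K ^+ 2 = (2 * K) ^+ 2); last by ring.
      by rewrite lerXn2r ?nnegrE ?mulr_ge0.
    have -> : 16 * K ^+ 2 * A ^+ 2 * (r ^+ 2 * om) = 4 * K ^+ 2 * (4 * A ^+ 2 * (r ^+ 2 * om)) by ring.
    by rewrite mulrCA; apply: ler_pM => //; [exact: sqr_ge0|rewrite mulr_ge0// sqr_ge0].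
  have ho := weight_shell co0 (@shell_lap_kap R n) qs.
  have hi := weight_shell ci0 (@shell_lap_kap R n) qs.
  have hio := sm2 _ (@shell_lap_kap R n) ki1.
  rewrite /P /Q !pE.
  set po := (co ^+ 2) ^+ a.-1 in ho *; set pi' := (ci ^+ 2) ^+ a.-1 in hi *.
  have po0 : 0 <= po by rewrite exprn_ge0// sqr_ge0.
  have pi0 : 0 <= pi' by rewrite exprn_ge0// sqr_ge0.
  set w := W x ^+ a * _ in w0 ho hi *.
  rewrite lcE; set lo := sc _ _ _ x in ho ko1 *; set li := sc _ _ _ x in hi hio ki1 *.
  have h1 : (co ^+ 2 * lo - ci ^+ 2 * li) ^+ 2 <=
      2 * (co ^+ 2 * co ^+ 2 * (`|lo| * `|lo|) + ci ^+ 2 * ci ^+ 2 * (`|li| * `|li|)).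
    rewrite -!expr2 !real_normK ?num_real//.
    have := sqr_ge0 (co ^+ 2 * lo + ci ^+ 2 * li); lra.
  have h2 : w * `|lo| * (`|lo| * U x ^+ 2) <= po * K * (K * M ^+ 2).
    have U20 := sqr_ge0 (U x).
    apply: ler_pM; [exact: mulr_ge0|exact: mulr_ge0| |exact: ler_pM].
    by apply: le_trans ho _; rewrite ler_wpM2l.
  have h3 : w * `|li| * (U x ^+ 2 * `|li|) <= pi' * K * (dl ^+ 2 * K).
    have U20 := sqr_ge0 (U x).
    apply: ler_pM; [exact: mulr_ge0|exact: mulr_ge0| |].
      by apply: le_trans hi _; rewrite ler_wpM2l.
    by apply: le_trans hio _; rewrite ler_wpM2l// sqr_ge0.
  have h4 : w * (U x ^+ 2 * (co ^+ 2 * lo - ci ^+ 2 * li) ^+ 2) <= w * (U x ^+ 2 *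
      (2 * (co ^+ 2 * co ^+ 2 * (`|lo| * `|lo|) + ci ^+ 2 * ci ^+ 2 * (`|li| * `|li|)))).
    by rewrite ler_wpM2l// ler_wpM2l// sqr_ge0.
  have c40 : 0 <= co ^+ 2 * co ^+ 2 by rewrite mulr_ge0 ?sqr_ge0.
  have i40 : 0 <= ci ^+ 2 * ci ^+ 2 by rewrite mulr_ge0 ?sqr_ge0.
  have := ler_wpM2l c40 h2; have := ler_wpM2l i40 h3; lra.
rewrite /carleman_rhs -/l /B /inner_error QE -/om -/Q.
have t1 : r ^+ 2 * (W x ^+ a * nsq (x - z) *
    (chi x ^+ 2 * l ^+ 2 + U x ^+ 2 * (\sum_i chi2 i i x) ^+ 2)) <=
    r ^+ 2 * (16 * K ^+ 2 * A ^+ 2 * (r ^+ 2 * om)) +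
    2 * (4^-1 * P * K ^+ 2 * M ^+ 2 + r ^+ 2 * ci ^+ 2 * Q * K ^+ 2 * dl ^+ 2).
  apply: le_trans (ler_wpM2l (ltW r20) b12) _.
  by rewrite -cor1; lra.
have t3 := ler_wpM2l (ltW r20) b3.
have t4 : r ^+ 2 * (2^-1 * U x ^+ 2 * `|\sum_i psi2 i i x|) <=
    4^-1 * P * K * M ^+ 2 + r ^+ 2 * Q * ci ^+ 2 * K * dl ^+ 2.
  by apply: le_trans (ler_wpM2l (ltW r20) b4) _; rewrite -cor1; lra.
have KK : K <= K ^+ 2 by rewrite expr2 ler_peMl.
have M20 := sqr_ge0 M; have K20 := sqr_ge0 K.
have p1 : P * (K ^+ 2 * M ^+ 2) <= om * (K ^+ 2 * M ^+ 2) by rewrite ler_wpM2r// mulr_ge0.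
have p2 : P * (K * M ^+ 2) <= om * (K ^+ 2 * M ^+ 2).
  by apply: ler_pM => //; [rewrite mulr_ge0|rewrite ler_wpM2r].
have p3 : P * (K * (M * (r ^+ 2 * A))) <= om * (K ^+ 2 * (M * (r ^+ 2 * A))).
  have h : 0 <= M * (r ^+ 2 * A) by rewrite !mulr_ge0// ltW.
  by apply: ler_pM => //; [rewrite mulr_ge0|rewrite ler_wpM2r].
have p4 : 0 <= om * (K ^+ 2 * (M * (r ^+ 2 * A))).
  by rewrite !mulr_ge0// ltW.
have p5 : 0 <= om * (K ^+ 2 * M ^+ 2) by rewrite !mulr_ge0.
lra.
Qed.

Lemma weighted_estimate :
  \int[leb R n]_x (W x ^+ a * (chi x * U x) ^+ 2) <= B * (6 * r) ^+ n.
Proof.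
have -> : 6 * r = 2 * (3 * r) by ring.
apply: (@carleman R n z U U1 U2 chi chi1 chi2 psi psi1 psi2 W W1 a (3 * r) B hU c2_chi c2_psi) => //.
- exact: continuous_W.
- exact: continuous_W1.
- exact: is_derive_W.
- by rewrite mulr_ge0// ltW.
- have r2 := sqr_ge0 r; have c2 k : 0 <= (ci ^+ 2) ^+ k by rewrite exprn_ge0// sqr_ge0.
  have K0' : 0 <= K by exact: le_trans K1.
  have rA : 0 <= r ^+ 2 * A + M by rewrite addr_ge0// mulr_ge0.
  by rewrite /B /inner_error !addr_ge0// !mulr_ge0// ?sqr_ge0// ?exprn_ge0// ?invr_ge0 ?sqr_ge0// ?(ltW r0).
- exact: W_gt0.
- exact: psi_ge0.
- move=> x; have [qs|qs] := ltP (nsq (x - z)) (s ^+ 2).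
    by right; exact: chi_in.
  by left; exact: W_good.
- exact: cutoff_out.
- exact: gradient_weight.
- exact: rhs_bound.
Qed.

End weights.


(** * Interior decay from the weighted estimate *)

Section interior_decay.
Context (R : realType) (n : nat).
Local Notation V := 'rV[R]_n.
Local Notation itg f := ((leb R n).-integrable setT (EFin \o f)).

(** By induction [(1 + h)^k (1 - k h) <= 1]. Changing a distance by a fraction [1 / (2 k)] therefore
    costs only a factor 2 in its [k]-th power, uniformly in [k]. *)
Lemma exp1D_le2 (h : R) (k : nat) : 0 <= h -> k%:R * h <= 2^-1 -> (1 + h) ^+ k <= 2.
Proof.
move=> h0 kh; suff H : (1 + h) ^+ k * (1 - k%:R * h) <= 1.
  have p0 : 0 <= (1 + h) ^+ k by rewrite exprn_ge0// addr_ge0.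
  nra.
move: kh => _; elim: k => [|k ih]; first by rewrite expr0 mul0r subr0 mul1r.
apply: le_trans ih; rewrite exprSr -mulrA ler_wpM2l ?exprn_ge0 ?addr_ge0// -natr1.
have := mulr_ge0 (ler0n R k) (sqr_ge0 h); have := sqr_ge0 h; lra.
Qed.

Lemma mean_value_bound z D (u L : V -> R) x (t H : R) : itg u -> itg L -> weq z D u L ->
  0 < t -> en (x - z) + t < D -> 0 <= H ->
  {ae leb R n, forall y, en (y - x) <= t -> `|L y| <= H} ->
  `|molc u t x - ut u x| <= (c0 R n)^-1 * (2 ^+ n * H * t ^+ 2).
Proof.
move=> hu hL hw t0 tD H0 aeH.
have K s t' : 0 < s -> s <= t' -> t' <= t ->
    `|mol u t' x - mol u s x| <= 2 ^+ n * H * t' ^+ 2.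
  move=> s0 st tt; apply: (mol_increment_bounded hu hL hw s0 st) => //.
    by apply: le_lt_trans tD; rewrite lerD2l.
  by apply: ae_imp aeH => y h yt; apply: h; exact: le_trans tt.
apply: (ut_molc t0 (lexx t)); last by move=> s s0 st; exact: K.
apply: (@lim_increment R (fun t => mol u t x) (2 ^+ n * H * t) t t0) => //.
  by rewrite !mulr_ge0// ?exprn_ge0// ltW.
move=> s t' s0 st tt; apply: le_trans (K _ _ s0 st tt) _.
have t'0 : 0 <= t' by apply: ltW; exact: lt_le_trans st.
by rewrite expr2 mulrA ler_wpM2r// ler_wpM2l// mulr_ge0// exprn_ge0.
Qed.

Section local.
Variables (u L : V -> R) (z : V) (r A M C : R) (a : nat).
Hypotheses (r0 : 0 < r) (A0 : 0 <= A) (M0 : 0 < M) (C0 : 0 <= C) (a0 : (0 < a)%N).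
Hypotheses (hu : itg u) (hL : itg L) (hw : weq z (4 * r) u L).
Hypothesis hA : {ae leb R n, forall y, en (y - z) < 4 * r -> `|L y| <= A}.
Hypothesis hAs : {ae leb R n, forall y, en (y - z) < 4 * r ->
  `|L y| <= A * (en (y - z) / r) ^+ a.-1}.
Hypothesis hut : {ae leb R n, forall y, en (y - z) < 4 * r -> u y = ut u y}.
Hypothesis hM : forall y, en (y - z) < 4 * r -> `|ut u y| <= M.
Hypothesis hC : forall y, en (y - z) < 4 * r -> `|ut u y| <= C * en (y - z) ^+ (2 * a + 4).

Let T := r ^+ 2 * A + M.
Let T0 : 0 < T. Proof. by rewrite ltr_wpDl// mulr_ge0// sqr_ge0. Qed.

(** The exponent [2 a + 4] in [hC] beats the factors [s^(-2 a)] and [s^(-2 a - 2)] of the inner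
    shell, with at least one power of [s] to spare. *)
Lemma inner_error_le K s : 0 < s -> s <= 1 -> 0 <= K ->
  inner_error r s a K A (C * (3 * s) ^+ (2 * a + 4)) <=
  s * (27 / 2 * r ^+ 2 * K ^+ 2 * (C * 3 ^+ (2 * a + 4)) ^+ 2 +
    54 * r ^+ 2 * K * (C * 3 ^+ (2 * a + 4)) * A +
    27 * r ^+ 2 * K * (C * 3 ^+ (2 * a + 4)) ^+ 2).
Proof.
move=> s0 s1 K0; rewrite /inner_error.
have -> : C * (3 * s) ^+ (2 * a + 4) = C * 3 ^+ (2 * a + 4) * s ^+ (2 * a + 4) by rewrite exprMn mulrA.
set C' := C * 3 ^+ _.
have C'0 : 0 <= C' by rewrite mulr_ge0// exprn_ge0.
have r2 := sqr_ge0 r.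
have e1 : (s^-1 ^+ 2) ^+ a * s ^+ (2 * a + 4) = s ^+ 4.
  by rewrite exprD mulrA exprM -exprMn -exprMn mulVf ?gt_eqF// !expr1n mul1r.
have e2 : (s^-1 ^+ 2) ^+ a.+1 * (s ^+ (2 * a + 4)) ^+ 2 = s ^+ 2 * s ^+ (2 * a + 4).
  rewrite exprS [in X in _ * X = _]expr2 -mulrA [X in _ * X = _]mulrA e1 mulrA; congr (_ * _).
  by rewrite exprVn -[s ^+ 4]/(s ^+ (2 + 2)) exprD mulKf// expf_neq0// gt_eqF.
have h4 : s ^+ 4 <= s by rewrite -[leRHS]expr1 ler_wiXn2l// ltW.
have h5 : s ^+ 2 * s ^+ (2 * a + 4) <= s.
  by rewrite -exprD -[leRHS]expr1 ler_wiXn2l// ltW.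
set P := (s^-1 ^+ 2) ^+ a in e1 *; set Q := (s^-1 ^+ 2) ^+ a.+1 in e2 *.
set S := s ^+ (2 * a + 4) in e1 e2 h5 *.
have -> : 27 / 2 * r ^+ 2 * Q * K ^+ 2 * (C' * S) ^+ 2 + 54 * r ^+ 2 * K * P * (C' * S) * A +
    27 * r ^+ 2 * Q * K * (C' * S) ^+ 2 =
  (Q * S ^+ 2) * (27 / 2 * r ^+ 2 * K ^+ 2 * C' ^+ 2 + 27 * r ^+ 2 * K * C' ^+ 2) +
  (P * S) * (54 * r ^+ 2 * K * C' * A) by ring.
rewrite e1 e2.
have x1 : 0 <= 27 / 2 * r ^+ 2 * K ^+ 2 * C' ^+ 2 + 27 * r ^+ 2 * K * C' ^+ 2.
  by rewrite addr_ge0// !mulr_ge0// ?sqr_ge0// ?invr_ge0// ?(ltW r0).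
have x2 : 0 <= 54 * r ^+ 2 * K * C' * A by rewrite !mulr_ge0// ?(ltW r0).
have := ler_wpM2r x1 h5; have := ler_wpM2r x2 h4; lra.
Qed.

(** The hole is taken so small that the inner error is below [K^2 r^(-2 a) T^2], which turns 108
    into 109. The mollification scale is [e = s / (2 (a + 1))], so that by [exp1D_le2] averaging at
    most doubles the power [|x - z|^(a-1)] outside the hole. *)
Lemma weighted_bound K b : 1 <= K -> (forall y : V,
  [/\ `|ev (kap R n) y| <= K, `|ev (lap (kap R n)) y| <= K, ev (gsq R n) y <= K &
  `|ev (lap (gsq R n)) y| <= K]) -> 0 < b ->
  exists s e, [/\ 0 < s, s <= b, s <= r & 0 < e] /\ [/\ e <= b, e < r,
    itg (fun x => W z s x ^+ a * (chi z r s x * molc u e x) ^+ 2) &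
    \int[leb R n]_x (W z s x ^+ a * (chi z r s x * molc u e x) ^+ 2) <=
     109 * K ^+ 2 * (r ^- 2) ^+ a * T ^+ 2 * (6 * r) ^+ n].
Proof.
move=> K1 hK b0; have K0 : 0 <= K by exact: le_trans K1.
set E0 := 27 / 2 * r ^+ 2 * K ^+ 2 * (C * 3 ^+ (2 * a + 4)) ^+ 2 +
    54 * r ^+ 2 * K * (C * 3 ^+ (2 * a + 4)) * A +
    27 * r ^+ 2 * K * (C * 3 ^+ (2 * a + 4)) ^+ 2.
have C'0 : 0 <= C * 3 ^+ (2 * a + 4) by rewrite mulr_ge0// exprn_ge0.
have r2 := sqr_ge0 r.
have E00 : 0 <= E0 by rewrite /E0 !addr_ge0// !mulr_ge0// ?sqr_ge0// ?exprn_ge0// ?invr_ge0// ?(ltW r0).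
pose tg := K ^+ 2 * (r ^- 2) ^+ a * T ^+ 2.
have tg0 : 0 < tg.
  by rewrite !mulr_gt0// ?exprn_gt0// ?(lt_le_trans ltr01 K1)// invr_gt0 exprn_gt0.
pose s := Num.min (Num.min b r) (Num.min 1 (tg / (E0 + 1))).
have s0 : 0 < s by rewrite /s !lt_min b0 r0 ltr01 divr_gt0// ltr_wpDl.
have [sb sr s1 stg] : [/\ s <= b, s <= r, s <= 1 & s <= tg / (E0 + 1)].
  by split; rewrite /s !ge_min lexx ?orbT.
pose e := s / (2 * a.+1%:R).
have d0 : 2 <= 2 * a.+1%:R :> R by rewrite ler_peMr// ler1n.
have d00 : 0 < 2 * a.+1%:R :> R by exact: lt_le_trans d0.
have e0 : 0 < e by rewrite divr_gt0.
have es2 : e <= s / 2 by rewrite ler_wpM2l ?(ltW s0)// lef_pV2 ?posrE.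
have es : e <= s by lra.
have er : e < r by lra.
have ball x : en (x - z) <= 3 * r -> en (x - z) + e < 4 * r by lra.
have tri x y : en (y - z) <= en (y - x) + en (x - z) by exact: en_triangle.
have cU := c2_molc e hu.
exists s, e; split=> //; split=> //; first by exact: le_trans sb.
  apply: (@integrable_carleman R n z _ _ _ _ _ _ _ _ _ _ a (3 * r) cU (c2_chi z r s)).
    exact: continuous_W.
  exact: (cutoff_out a s0 sr).
have D0 : 0 <= C * (3 * s) ^+ (2 * a + 4) by rewrite mulr_ge0// exprn_ge0// mulr_ge0// ltW.
have lapE x : en (x - z) <= 3 * r -> \sum_i ((c0 R n)^-1 * e ^- n) *
      (- e^-1 * (- e^-1 * cv u (dd i (dd i (rho0 R n))) e^-1 x)) = molc L e x.
  by move=> xr; exact: (lap_molc hw hu e0 (ball _ xr)).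
apply: le_trans (weighted_estimate s0 sr a0 K1 hK cU A0 (ltW M0) D0 _ _ _ _) _.
- move=> x xr; rewrite lapE//; apply: (molc_bound hL e0 A0).
  by apply: ae_imp hA => y h yx; apply: h; have := ball _ xr; have := tri x y; lra.
- move=> x xs xr; rewrite lapE//.
  have x0 : 0 < en (x - z) by exact: lt_le_trans xs.
  set H := 2 * _; have H0 : 0 <= H.
    by rewrite !mulr_ge0// exprn_ge0// divr_ge0// ltW.
  apply: (molc_bound hL e0 H0).
  apply: ae_imp hAs => y h yx; apply: le_trans (h _) _.
    by have := ball _ xr; have := tri x y; lra.
  rewrite /H mulrCA ler_wpM2l//.
  apply: le_trans (_ : ((1 + e / en (x - z)) * (en (x - z) / r)) ^+ a.-1 <= _).
    rewrite lerXn2r ?nnegrE//.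
    + by rewrite divr_ge0 ?en_ge0// ltW.
    + by rewrite mulr_ge0 ?addr_ge0 ?divr_ge0 ?en_ge0// ltW.
    + rewrite mulrA ler_wpM2r ?invr_ge0 ?(ltW r0)// mulrDl mul1r divfK ?gt_eqF//.
      by have := tri x y; lra.
  rewrite exprMn ler_wpM2r ?exprn_ge0 ?divr_ge0 ?en_ge0 ?(ltW r0)//.
  apply: exp1D_le2; first by rewrite divr_ge0 ?en_ge0// ltW.
  rewrite mulrA ler_pdivrMr//; apply: le_trans (_ : 2^-1 * s <= _); last by rewrite ler_wpM2l.
  have ea : e * (2 * a.+1%:R) = s by rewrite divfK// gt_eqF.
  have : a.-1%:R <= a.+1%:R :> R by rewrite ler_nat (leq_trans (leq_pred _)).
  move=> /(ler_wpM2r (ltW e0)); lra.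
- move=> x xr; apply: (molc_bound hu e0 (ltW M0)).
  apply: ae_imp hut => y h yx; have y4 : en (y - z) < 4 * r.
    by have := ball _ xr; have := tri x y; lra.
  by rewrite h// hM.
- move=> x xr; apply: (molc_bound hu e0 D0).
  apply: ae_imp hut => y h yx; have y3 : en (y - z) <= 3 * s.
    by have := tri x y; lra.
  have y4 : en (y - z) < 4 * r by lra.
  rewrite h//; apply: le_trans (hC y4) _; rewrite ler_wpM2l//.
  by rewrite lerXn2r ?nnegrE ?en_ge0// mulr_ge0// ltW.
rewrite ler_wpM2r ?exprn_ge0 ?mulr_ge0 ?(ltW r0)//.
apply: le_trans (lerD (lexx _) (inner_error_le s0 s1 K0)) _; rewrite -/E0 -/T.
have : s * E0 <= tg.
  apply: le_trans (_ : s * (E0 + 1) <= _); first by rewrite ler_wpM2l ?(ltW s0)// lerDl.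
  by rewrite -ler_pdivlMr// ltr_wpDl.
rewrite /tg; lra.
Qed.

Hypothesis na : (n < a)%N.

(** At distance [p] from [z], average at scale [t = p / (2 (a + 1))]. The average is compared with
    the weighted integral through [|U| <= lam + U^2 / lam], and [lam = T w^a] balances the two
    terms. The volume ratio [(r / t)^n] is the source of [(a + 1)^n] and of the loss of [n] in the
    exponent. *)
Lemma local_decay K K2 x : 1 <= K -> (forall y : V,
  [/\ `|ev (kap R n) y| <= K, `|ev (lap (kap R n)) y| <= K, ev (gsq R n) y <= K &
  `|ev (lap (gsq R n)) y| <= K]) -> (forall y : V, `|ev (rho0 R n) y| <= K2) ->
  en (x - z) <= r ->
  `|ut u x| <= (2 + (c0 R n)^-1 * (436 * K2 * K ^+ 2 * 6 ^+ n) * 2 ^+ n + (c0 R n)^-1 * 2 ^+ n.+1) *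
    a.+1%:R ^+ n * T * (en (x - z) / r) ^+ (a - n).
Proof.
move=> K1 hK hK2 xr; have [x0|x0] := ltP 0 (en (x - z)); last first.
  (* At the centre both sides are 0, the left one by [hC] and the right one because [a - n > 0]. *)
  have xE : en (x - z) = 0 by apply/eqP; rewrite eq_le x0 en_ge0.
  have x4 : en (x - z) < 4 * r by rewrite xE mulr_gt0.
  have := hC x4; rewrite xE mul0r !expr0n addn_eq0 andbF mulr0 subn_eq0 leqNgt na/= mulr0.
  by [].
have cp := c0_gt0 R n; have ci0 : 0 <= (c0 R n)^-1 by rewrite invr_ge0 ltW.
have K20 : 0 <= K2 by exact: le_trans (normr_ge0 _) (hK2 0).
have a1 : 1 <= a.+1%:R :> R by rewrite ler1n.
have rp : 0 <= r by exact: ltW.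
set p := en (x - z) in x0 xr *; set T' := r ^+ 2 * A + M.
pose t := p / (2 * a.+1%:R).
have d0 : 0 < 2 * a.+1%:R :> R by rewrite mulr_gt0.
have t0 : 0 < t by rewrite divr_gt0.
have ta : t * (2 * a.+1%:R) = p by rewrite divfK// gt_eqF.
have tp : t <= p / 4.
  have : 2%:R <= a.+1%:R :> R by rewrite ler_nat ltnS.
  move=> /(ler_wpM2l (ltW t0)); lra.
have at2 : a%:R * (t / p) <= 2^-1.
  rewrite mulrA ler_pdivrMr//; have : a%:R <= a.+1%:R :> R by rewrite ler_nat.
  move=> /(ler_wpM2r (ltW t0)); lra.
have tpr : 0 <= t / p by rewrite divr_ge0 ?ltW.
have tri x' y : en (y - z) <= en (y - x') + en (x' - z) by exact: en_triangle.
pose w := p / r; have w0 : 0 < w by rewrite divr_gt0.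
have w1 : w <= 1 by rewrite ler_pdivrMr// mul1r.
have ptk k : (k <= a)%N -> (p + t) ^+ k <= 2 * p ^+ k.
  move=> ka; have -> : p + t = (1 + t / p) * p by rewrite mulrDl mul1r divfK// gt_eqF.
  rewrite exprMn ler_wpM2r ?exprn_ge0 ?(ltW x0)//; apply: exp1D_le2 => //.
  apply: le_trans at2; rewrite ler_wpM2r// ler_nat.
  by [].
have geo s y : 0 < s -> s <= p / 4 -> en (y - x) <= t ->
    [/\ en (y - z) <= 3 * r, en (y - z) < 4 * r, en (y - z) <= p + t,
    s ^+ 2 * 2 <= nsq (y - z) & nsq (y - z) <= 4 * r ^+ 2 /\ s ^+ 2 <= nsq (y - z)].
  move=> s0 sp yt.
  have y3 : en (y - z) <= 3 * r by have := tri x y; rewrite -/p; lra.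
  have y4 : en (y - z) < 4 * r by lra.
  have yp : p / 2 <= en (y - z).
    have : p <= en (x - y) + en (y - z) by exact: en_triangle.
    rewrite (enB x y); lra.
  have yn : en (y - z) <= p + t by have := tri x y; rewrite -/p; lra.
  have q1 : s ^+ 2 * 2 <= nsq (y - z).
    have : (2 * s) ^+ 2 <= en (y - z) ^+ 2.
      by rewrite lerXn2r ?nnegrE ?en_ge0 ?mulr_ge0 ?(ltW s0)//; lra.
    by rewrite sqr_en exprMn; have := sqr_ge0 s; lra.
  have q2 : nsq (y - z) <= 4 * r ^+ 2.
    have : en (y - z) ^+ 2 <= (2 * r) ^+ 2.
      by rewrite lerXn2r ?nnegrE ?en_ge0 ?mulr_ge0//; lra.
    by rewrite sqr_en exprMn; lra.
  have qs : s ^+ 2 <= nsq (y - z) by have := sqr_ge0 s; lra.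
  by split.
have h1 : `|molc u t x - ut u x| <= (c0 R n)^-1 * 2 ^+ n.+1 * (T' * w ^+ (a - n)).
  pose H := 2 * (A * w ^+ a.-1).
  have H0 : 0 <= H by rewrite !mulr_ge0// exprn_ge0// ltW.
  have x4 : en (x - z) + t < 4 * r by rewrite -/p; lra.
  apply: le_trans (mean_value_bound hu hL hw t0 x4 H0 _) _.
    apply: ae_imp hAs => y h yx; apply: le_trans (h _) _; first by have := tri x y; lra.
    rewrite /H mulrCA ler_wpM2l// /w !expr_div_n mulrA ler_wpM2r ?invr_ge0 ?exprn_ge0//.
    apply: le_trans (ptk _ (leq_pred a)).
    rewrite lerXn2r ?nnegrE ?en_ge0//; last by have := tri x y; rewrite -/p; lra.
    by rewrite addr_ge0// ltW.
  rewrite [2 ^+ n.+1]exprSr -[leRHS]mulrA ler_wpM2l// -!mulrA ler_wpM2l ?exprn_ge0// /H.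
  rewrite ler_wpM2l//.
  have tw : t ^+ 2 <= r ^+ 2 * w ^+ 2.
    have -> : r ^+ 2 * w ^+ 2 = p ^+ 2 by rewrite -exprMn /w mulrC divfK// gt_eqF.
    by rewrite lerXn2r ?nnegrE ?(ltW x0) ?(ltW t0)//; lra.
  apply: le_trans (_ : A * (w ^+ a.-1 * (r ^+ 2 * w ^+ 2)) <= _).
    by rewrite ler_wpM2l// ler_wpM2l// exprn_ge0// ltW.
  have -> : A * (w ^+ a.-1 * (r ^+ 2 * w ^+ 2)) = r ^+ 2 * A * (w ^+ a.-1 * w ^+ 2) by ring.
  apply: ler_pM; [by rewrite mulr_ge0 ?sqr_ge0|by rewrite mulr_ge0 ?exprn_ge0 ?ltW| |].
    by rewrite /T' lerDl ltW.
  rewrite -exprD ler_wiXn2l ?(ltW w0)//.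
  by rewrite (leq_trans (leq_subr _ _))// addn2 -[in leqLHS](prednK a0) leqW.
suff h2 : `|molc u t x| <= (2 + (c0 R n)^-1 * (436 * K2 * K ^+ 2 * 6 ^+ n) * 2 ^+ n) *
    a.+1%:R ^+ n * (T' * w ^+ (a - n)).
  have X0 : 0 <= T' * w ^+ (a - n) by rewrite mulr_ge0 ?exprn_ge0 ?(ltW w0)// ltW.
  have X1 : T' * w ^+ (a - n) <= a.+1%:R ^+ n * (T' * w ^+ (a - n)) by rewrite ler_peMl// exprn_ege1.
  have X2 : 0 <= (c0 R n)^-1 * 2 ^+ n.+1 by rewrite mulr_ge0// exprn_ge0.
  have h3 : `|ut u x| <= `|molc u t x| + `|molc u t x - ut u x|.
    rewrite -[in leLHS](subKr (molc u t x) (ut u x)) (le_trans (ler_normB _ _))//.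
  apply: le_trans h3 _; apply: le_trans (lerD h2 h1) _.
  have := ler_wpM2l X2 X1; rewrite /T -/T' -/w.
  lra.
pose X := T' * w ^+ (a - n).
have X0 : 0 < X by rewrite mulr_gt0// exprn_gt0.
pose N := (c0 R n)^-1 * (2 ^+ n * A).
have N0 : 0 <= N by rewrite mulr_ge0// mulr_ge0// exprn_ge0.
(* With [s] and [e] below [b], the averaging ball, at distance at least [p / 2] from [z], avoids the
   hole, and [molc u e] differs from [ut u] by at most [X]. *)
pose b := Num.min (p / 4) (Num.min 1 (X / (N + 1))).
have b0 : 0 < b by rewrite /b !lt_min ltr01 !divr_gt0// ltr_wpDl.
have [s [e [[s0 sb sr e0] [eb er ig hI]]]] := weighted_bound K1 hK b0.
have [sp e1 eX] : [/\ s <= p / 4, e <= 1 & e <= X / (N + 1)].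
  by split; [apply: le_trans sb _|apply: le_trans eb _|apply: le_trans eb _];
    rewrite /b !ge_min lexx ?orbT.
have ut_mol y : en (y - z) <= 3 * r -> `|molc u e y - ut u y| <= X.
  move=> yr; have y4 : en (y - z) + e < 4 * r by lra.
  apply: le_trans (mean_value_bound hu hL hw e0 y4 A0 _) _.
    apply: ae_imp hA => y' h yx; apply: h; have := tri y y'; lra.
  rewrite mulrA -/N; apply: le_trans (_ : N * e <= _).
    by rewrite ler_wpM2l// expr2 ler_piMl// ltW.
  apply: le_trans (_ : (N + 1) * e <= _); first by rewrite ler_wpM2r ?(ltW e0)// lerDl.
  by rewrite mulrC -ler_pdivlMr// ltr_wpDl.
pose lam := T' * w ^+ a; have lam0 : 0 < lam by rewrite mulr_gt0// exprn_gt0.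
rewrite /T -/T' in hI; set g := (fun x => _) in ig hI.
have g0 y : 0 <= g y.
  by rewrite mulr_ge0 ?sqr_ge0// exprn_ge0// ltW// W_gt0.
have sU := @usupp_rho0 R n.
pose ker y := ev (rho0 R n) (t^-1 *: (y - x)).
have ker0 y : 0 <= ker y by exact: ev_rho0_ge0.
have kerK y : ker y <= K2 by exact: (le_trans (ler_norm (ker y)) (hK2 _)).
pose c2 := lam^-1 * (4 * p ^+ (2 * a)) * K2.
have c20 : 0 <= c2.
  by rewrite /c2 !mulr_ge0// ?invr_ge0 ?exprn_ge0// ltW.
have ptw : {ae leb R n, forall y, `|u y * ker y| <= (X + lam) * ker y + c2 * g y}.
  apply: ae_imp hut => y h; have [yt|yt] := ltP t (en (y - x)).
    rewrite /ker (ker_support sU t0 yt) !mulr0 normr0 add0r.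
    exact: mulr_ge0.
  have [y3 y4 yn q1 [q2 qs]] := geo s y s0 sp yt.
  have chi1' := cutoff_inside s0 sr q1 q2.
  have [Wr _] := W_good s0 qs.
  set U := molc u e y; have gE : U ^+ 2 = nsq (y - z) ^+ a * g y.
    by rewrite /g chi1' mul1r mulrA -exprMn mulrC [nsq _ * _]mulrC Wr expr1n mulr1.
  have U2 : U ^+ 2 <= 4 * p ^+ (2 * a) * g y.
    have -> : 4 * p ^+ (2 * a) = (2 * p ^+ a) ^+ 2 by rewrite mulnC exprM; ring.
    rewrite gE ler_wpM2r// -sqr_en [X in X <= _]exprAC.
    rewrite lerXn2r ?nnegrE ?exprn_ge0 ?en_ge0//; first by rewrite mulr_ge0// exprn_ge0// ltW.
    apply: le_trans (ptk _ (leqnn a)).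
    by rewrite lerXn2r ?nnegrE ?en_ge0// addr_ge0// ltW.
  have yg : `|U| <= lam + lam^-1 * (4 * p ^+ (2 * a) * g y).
    apply: le_trans (_ : lam + lam^-1 * U ^+ 2 <= _); last first.
      by rewrite lerD2l ler_wpM2l// invr_ge0 ltW.
    rewrite -(ler_pM2l lam0) mulrDr mulVKf ?gt_eqF//.
    have := sqr_ge0 (lam - `|U|); have := mulr_ge0 (ltW lam0) (normr_ge0 U).
    rewrite -[U ^+ 2]real_normK ?num_real//; lra.
  rewrite normrM (ger0_norm (ker0 y)) h//.
  have h2 : `|ut u y| <= X + (lam + lam^-1 * (4 * p ^+ (2 * a) * g y)).
    apply: le_trans (lerD (ut_mol _ y3) yg).
    by rewrite [leRHS]addrC -[in leLHS](subKr (molc u e y) (ut u y)) (le_trans (ler_normB _ _)).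
  apply: le_trans (ler_wpM2r (ker0 y) h2) _.
  rewrite addrA mulrDl lerD2l /c2.
  have gg : 0 <= lam^-1 * (4 * p ^+ (2 * a)) * g y.
    apply: mulr_ge0 => //; apply: mulr_ge0; first by rewrite invr_ge0 ltW.
    by apply: mulr_ge0 => //; rewrite exprn_ge0// ltW.
  have := ler_wpM2l gg (kerK y); lra.
have ik : itg ker by apply: integrable_ker => //; rewrite invr_eq0 gt_eqF.
have iu := integrable_cv t^-1 x hu sU.
have cvb : `|cv u (rho0 R n) t^-1 x| <= (X + lam) * (c0 R n * t ^+ n) +
    c2 * (109 * K ^+ 2 * (r ^- 2) ^+ a * T' ^+ 2 * (6 * r) ^+ n).
  apply: le_trans (_ : \int[leb R n]_y `|u y * ker y| <= _).
    apply: le_normr_Rintegral; [exact: measurableT|exact: iu].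
  have i1 := integrable_add (integrable_scale (X + lam) ik) (integrable_scale c2 ig).
  apply: le_trans (ae_le_Rintegral (integrable_norm iu) i1 ptw) _.
  rewrite RintegralD; [|exact: measurableT|exact: integrable_scale|exact: integrable_scale].
  rewrite RintegralZl; [|exact: measurableT|exact: ik].
  rewrite RintegralZl; [|exact: measurableT|exact: ig].
  rewrite Rintegral_rho0//; apply: lerD => //; exact: ler_wpM2l.
have tn0 : 0 < t ^+ n by rewrite exprn_gt0.
have lX : lam <= X.
  apply: ler_wpM2l; first exact: (ltW T0).
  by rewrite ler_wiXn2l ?(ltW w0)// leq_subr.
rewrite molcE normrM normrM (ger0_norm ci0) [`|t ^- n|]ger0_norm ?invr_ge0 ?(ltW tn0)//.
apply: le_trans (_ : (c0 R n)^-1 * (t ^- n * ((X + lam) * (c0 R n * t ^+ n) +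
    c2 * (109 * K ^+ 2 * (r ^- 2) ^+ a * T' ^+ 2 * (6 * r) ^+ n))) <= _).
  by rewrite ler_wpM2l// ler_wpM2l// invr_ge0 ltW.
(* [436 = 4 * 109], where 4 is the square of the factor 2 in [|y - z|^a <= 2 p^a]. *)
have -> : (c0 R n)^-1 * (t ^- n * ((X + lam) * (c0 R n * t ^+ n) +
    c2 * (109 * K ^+ 2 * (r ^- 2) ^+ a * T' ^+ 2 * (6 * r) ^+ n))) =
  (X + lam) + (c0 R n)^-1 * (436 * K2 * K ^+ 2 * 6 ^+ n) *
    ((r / t) ^+ n * (lam^-1 * (T' * (p ^+ 2 / r ^+ 2) ^+ a * T'))).
  have f1 : (6 * r) ^+ n = 6 ^+ n * r ^+ n by rewrite exprMn.
  have f2 : (r / t) ^+ n = r ^+ n / t ^+ n by rewrite expr_div_n.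
  have f3 : (p ^+ 2 / r ^+ 2) ^+ a = p ^+ (2 * a) * (r ^- 2) ^+ a by rewrite exprMn [p ^+ (2 * a)]exprM.
  rewrite /c2 f1 f2 f3; set tn := t ^+ n in tn0 *; set rn := r ^+ n; set sn := 6 ^+ n.
  set P := p ^+ _; set ra := _ ^+ a.
  rewrite mulrDr mulrDr; congr (_ + _).
    by field; rewrite !gt_eqF.
  ring.
have -> : lam^-1 * (T' * (p ^+ 2 / r ^+ 2) ^+ a * T') = T' * w ^+ a.
  have -> : (p ^+ 2 / r ^+ 2) ^+ a = (w ^+ a) ^+ 2 by rewrite -expr_div_n -/w exprAC.
  rewrite /lam; have wa : w ^+ a != 0 by rewrite expf_neq0 ?gt_eqF.
  have T'0 : T' != 0 by rewrite gt_eqF// T0.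
  by field; rewrite wa T'0.
have -> : (r / t) ^+ n * (T' * w ^+ a) = 2 ^+ n * (a.+1%:R ^+ n * X).
  have -> : r / t = 2 * a.+1%:R * w^-1.
    by rewrite /t /w !invf_div; field; rewrite !gt_eqF.
  have wE : w ^+ a = w ^+ (a - n) * w ^+ n by rewrite -exprD subnK// ltnW.
  rewrite /X wE [(_ * w^-1) ^+ n]exprMn [(2 * _) ^+ n]exprMn exprVn.
  by field; rewrite expf_neq0 ?gt_eqF.
have X1 : X <= a.+1%:R ^+ n * X by rewrite ler_peMl ?(ltW X0)// exprn_ege1.
rewrite -/X; lra.
Qed.

End local.
End interior_decay.


(** * Unique continuation *)

Section half_system.
Context (R : realType) (n : nat).
Local Notation V := 'rV[R]_n.
Local Notation itg f := ((leb R n).-integrable setT (EFin \o f)).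
Implicit Types (z x y : V) (u v L Lu Lv : V -> R).

(* One equation of the system on the ball [eball z D], with the nonlinearity
   already replaced by its bound; [ut] is the continuous representative. *)
Definition half_sys z (D : R) u L v (q C M : R) : Prop :=
  [/\ itg u /\ itg L, weq z D u L,
    {ae leb R n, forall y, en (y - z) < D -> `|L y| <= C * `|ut v y| `^ q},
    {ae leb R n, forall y, en (y - z) < D -> u y = ut u y}
    & forall y, en (y - z) < D -> `|ut u y| <= M].

Definition bnd u z (s M : R) := forall x, en (x - z) <= s -> `|ut u x| <= M.

Lemma half_sys_sub z z' D D' u L v q C M : en (z' - z) + D' <= D ->
  half_sys z D u L v q C M -> half_sys z' D' u L v q C M.
Proof.
move=> zD [itgs hw hL hu hM].
have S y : en (y - z') < D' -> en (y - z) < D.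
  have := en_triangle z' y z; lra.
split=> //.
- move=> e x t se t0 xt; apply: hw => //; have := en_triangle z' x z; lra.
- by apply: ae_imp hL => y h /S; exact: h.
- by apply: ae_imp hu => y h /S; exact: h.
- by move=> y /S; exact: hM.
Qed.

Lemma bnd_ge0 u z s M : 0 <= s -> bnd u z s M -> 0 <= M.
Proof. by move=> s0 /(_ z); rewrite subrr en0 => /(_ s0); exact: le_trans. Qed.

Lemma half_sys_Lbound z D u L v q C M s N x : 0 <= q -> 0 <= C ->
  half_sys z D u L v q C M ->
  (forall y, en (y - x) <= s -> `|ut v y| <= N) -> en (x - z) + s < D ->
  {ae leb R n, forall y, en (y - x) <= s -> `|L y| <= C * N `^ q}.
Proof.
move=> q0 C0 [_ _ hL _ _] hN xs; apply: ae_imp hL => y h yx.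
have yD : en (y - z) < D by have := en_triangle x y z; lra.
apply: le_trans (h yD) _; rewrite ler_wpM2l//.
have N0 : 0 <= N by apply: le_trans (hN y yx).
by apply: ge0_ler_powR; rewrite ?nnegrE// hN.
Qed.

Lemma half_sys_molc z D u L v q C M s N x : 0 <= q -> 0 <= C ->
  half_sys z D u L v q C M -> 0 < s ->
  (forall y, en (y - x) <= s -> `|ut v y| <= N) -> en (x - z) + s < D ->
  `|molc u s x - ut u x| <= (c0 R n)^-1 * (2 ^+ n * (C * N `^ q) * s ^+ 2).
Proof.
move=> q0 C0 hs s0 hN xs; have [[iu iL] hw _ _ _] := hs.
apply: (mean_value_bound iu iL hw s0 xs); first by rewrite mulr_ge0// powR_ge0.
exact: (half_sys_Lbound q0 C0 hs hN xs).
Qed.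

(* The improvement step: [u] at scale [s] is a small multiple of [u] at scale
   [18 s], up to terms of higher order. *)
Definition improves z u v (q : R) := forall beta, 0 < beta ->
  exists K d, [/\ 0 <= K, 0 < d & forall s M N, 0 < s -> s <= d ->
    bnd u z (18 * s) M -> bnd v z (18 * s) N ->
    bnd u z s (2^-1 * 18 `^ (- beta) * M + K * (s `^ beta + s ^+ 2 * N `^ q))].

Definition decays u z (b : R) := exists C d, [/\ 0 <= C, 0 < d &
  forall s, 0 < s -> s <= d -> bnd u z s (C * s `^ b)].

Lemma le_decays u z b b' : b' <= b -> decays u z b -> decays u z b'.
Proof.
move=> bb [C [d [C0 d0 H]]]; exists C, (Num.min d 1).
split=> //; first by rewrite lt_min d0 ltr01.
move=> s s0; rewrite le_min => /andP[sd s1] x xs.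
apply: le_trans (H s s0 sd x xs) _; rewrite ler_wpM2l//.
by apply: ger_powR => //; rewrite s0.
Qed.

(** For [beta = q b + 1] the decay of [v] makes the inhomogeneous terms [O(s^beta)]. The coefficient
    [18^(-beta) / 2] then lets a bound [C' s^beta] descend from scale [18 s] to scale [s], by
    induction on the number of factors 18. *)
Lemma improves_decays z D u L v q C M b : 0 < D -> 0 < q -> 0 <= b ->
  half_sys z D u L v q C M -> improves z u v q -> decays v z b -> decays u z (q * b + 1).
Proof.
move=> D0 q0 b0 [_ _ _ _ hM] imp [C1 [d1 [C10 d10 H1]]].
set beta := q * b + 1; have qb : 0 <= q * b by rewrite mulr_ge0// ltW.
have beta0 : 0 < beta by rewrite ltr_wpDl.
have [K [d [K0 d0 H]]] := imp _ beta0.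
have M0 : 0 <= M by have := hM z; rewrite subrr en0 => /(_ D0); exact: le_trans.
pose d2 := Num.min (Num.min d 1) (Num.min (d1 / 18) (D / 2)).
have d20 : 0 < d2 by rewrite /d2 !lt_min d0 ltr01 !divr_gt0.
have [dd d21 dd1 dD] : [/\ d2 <= d, d2 <= 1, d2 <= d1 / 18 & d2 <= D / 2].
  by split; rewrite /d2 !ge_min lexx ?orbT.
pose K' := K * (1 + (C1 * 18 `^ b) `^ q).
have K'0 : 0 <= K' by rewrite mulr_ge0// addr_ge0// powR_ge0.
(* The first summand makes half of [C'] absorb the inhomogeneous terms; the second covers the
   initial scales, from [d2 / 18] to [d2]. *)
pose C' := 2 * K' + M * (d2 / 18) `^ (- beta).
have C'0 : 0 <= C' := addr_ge0 (mulr_ge0 (ler0n R 2) K'0) (mulr_ge0 M0 (powR_ge0 _ _)).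
exists C', d2; split=> //.
have far s : s <= d2 -> d2 <= 18 * s -> bnd u z s (C' * s `^ beta).
  move=> sd ds x xs; have s0 : 0 < s by clear - R n ds d20; lra.
  have xD : en (x - z) < D by clear - R n xs sd dD D0; lra.
  apply: le_trans (hM _ xD) _; apply: le_trans (_ : M * (d2 / 18) `^ (- beta) * s `^ beta <= _).
    rewrite -mulrA ler_peMr// powRN mulrC ler_pdivlMr ?powR_gt0 ?divr_gt0// mul1r.
    by apply: ge0_ler_powR; rewrite ?nnegrE ?(ltW beta0)//; clear - R n ds d20 s0; lra.
  by rewrite ler_wpM2r ?powR_ge0// /C' lerDr mulr_ge0.
suff main m : forall s, 0 < s -> s <= d2 -> d2 <= 18 ^+ m * s -> bnd u z s (C' * s `^ beta).
  move=> s s0 sd; apply: (main (Num.truncn (d2 / s)).+1) => //.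
  rewrite -ler_pdivrMr//; apply: le_trans (_ : (Num.truncn (d2 / s)).+1%:R <= _).
    exact: ltW (truncnS_gt _).
  rewrite -natrX ler_nat; exact: ltnW (ltn_expl _ _).
elim: m => [|m ih] s s0 sd ds.
  by apply: far => //; move: ds; rewrite expr0 mul1r; lra.
have [s18|s18] := leP d2 (18 * s); first exact: far.
have s180 : 0 < 18 * s by rewrite mulr_gt0.
have h18 : d2 <= 18 ^+ m * (18 * s) by rewrite mulrA -exprSr.
have hu := ih _ s180 (ltW s18) h18.
have s18d : 18 * s <= d1 by clear - R n s18 dd1 d10; lra.
have hv := H1 _ s180 s18d.
move=> x xs; apply: le_trans (H s _ _ s0 (le_trans sd dd) hu hv x xs) _.
have e1 : (18 * s) `^ beta = 18 `^ beta * s `^ beta by rewrite powRM// ltW.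
have e2 : 18 `^ (- beta) * 18 `^ beta = 1 :> R by rewrite powRN mulVf// gt_eqF// powR_gt0.
have e3 : s ^+ 2 * (C1 * (18 * s) `^ b) `^ q <= (C1 * 18 `^ b) `^ q * s `^ beta.
  rewrite [(18 * s) `^ b]powRM ?(ltW s0)// mulrA powRM ?powR_ge0//; last first.
    by rewrite mulr_ge0// powR_ge0.
  rewrite mulrCA ler_wpM2l ?powR_ge0// -powRrM [b * q]mulrC -powR_mulrn ?(ltW s0)//.
  rewrite -powRD; last by apply/implyP => _; rewrite gt_eqF.
  by apply: ger_powR; [rewrite s0/=; clear - R n sd d21; lra|rewrite /beta addrC; clear - R n; lra].
have -> : 2^-1 * 18 `^ (- beta) * (C' * (18 * s) `^ beta) = 2^-1 * C' * s `^ beta.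
  rewrite e1; set A := 18 `^ (- beta) in e2 *; set B := 18 `^ beta in e2 *.
  have -> : 2^-1 * A * (C' * (B * s `^ beta)) = 2^-1 * C' * s `^ beta * (A * B) by ring.
  by rewrite e2 mulr1.
have e4 : K * (s `^ beta + s ^+ 2 * (C1 * (18 * s) `^ b) `^ q) <= K' * s `^ beta.
  rewrite /K' -[X in _ <= X]mulrA; apply: ler_wpM2l; first exact: K0.
  rewrite [X in _ <= X]mulrDl mul1r; exact: lerD (lexx _) e3.
have e5 : K' * s `^ beta <= 2^-1 * C' * s `^ beta.
  apply: ler_wpM2r; first exact: powR_ge0.
  have P0 := mulr_ge0 M0 (powR_ge0 (d2 / 18) (- beta)).
  by rewrite /C' mulrDr mulKf ?pnatr_eq0// lerDl mulr_ge0.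
have e6 : 2^-1 * C' * s `^ beta = C' * s `^ beta / 2 by rewrite -mulrA mulrC.
rewrite e6 in e5 *; rewrite [X in _ <= X]splitr.
exact: lerD (lexx _) (le_trans e4 e5).
Qed.

Lemma decays0 z D u L v q C M : 0 < D -> half_sys z D u L v q C M -> decays u z 0.
Proof.
move=> D0 [_ _ _ _ hM]; have M0 : 0 <= M by have := hM z; rewrite subrr en0 => /(_ D0); exact: le_trans.
exists M, (D / 2); split=> //; first by rewrite divr_gt0.
by move=> s s0 sD x xs; rewrite powRr0 mulr1; apply: hM; lra.
Qed.

(** If one of [p], [q] is small, a single exchange may lower the order, but two exchanges lead from
    order [k] to more than [p q k + 1 >= k + 1]. *)
Lemma improves_all z D u Lu v Lv p q C M b : 0 < D -> 0 < p -> 0 < q -> 1 < p * q ->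
  half_sys z D u Lu v q C M -> half_sys z D v Lv u p C M ->
  improves z u v q -> improves z v u p -> decays u z b /\ decays v z b.
Proof.
move=> D0 p0 q0 pq hu hv iu iv.
have Du k : decays u z k%:R /\ decays v z k%:R.
  elim: k => [|k [ihu ihv]]; first by split; [exact: decays0 D0 hu|exact: decays0 D0 hv].
  have k0 : 0 <= k%:R :> R by [].
  have du := improves_decays D0 q0 k0 hu iu ihv.
  have dv := improves_decays D0 p0 k0 hv iv ihu.
  have qk0 : 0 <= q * k%:R + 1 by rewrite addr_ge0// mulr_ge0// ltW.
  have pk0 : 0 <= p * k%:R + 1 by rewrite addr_ge0// mulr_ge0// ltW.
  have du' := improves_decays D0 q0 pk0 hu iu dv.
  have dv' := improves_decays D0 p0 qk0 hv iv du.
  have pqk : k%:R <= p * q * k%:R by rewrite ler_peMl// ltW.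
  split; [apply: le_decays du'|apply: le_decays dv']; rewrite -natr1 mulrDr mulrA.
    by rewrite mulr1 (mulrC q p) lerD2r; lra.
  by rewrite mulr1 lerD2r; lra.
have [k bk] : exists k : nat, b <= k%:R.
  by exists (Num.truncn b).+1; exact: ltW (truncnS_gt _).
by have [du dv] := Du k; split; [exact: le_decays du|exact: le_decays dv].
Qed.

(** Split the average at the level [lam = s^beta]. Above it [|u| <= M (|u| / lam)^eps], and the
    order [n + beta (1 + eps)] of the integral pays for the volume [s^n], for [lam^eps] and for one
    more factor [s^beta]. *)
Lemma improves_of_vanishing z D u L v q C M (eps : R) : 0 < D -> 0 <= q -> 0 <= C -> 0 < eps ->
  half_sys z D u L v q C M ->
  (forall k, 0 < k -> exists2 d, 0 < d & forall r, 0 < r -> r < d ->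
    itg (fun y => `|u y| `^ eps * \1_(eball z r) y) /\
    \int[leb R n]_y (`|u y| `^ eps * \1_(eball z r) y) <= r `^ k) ->
  improves z u v q.
Proof.
move=> D0 q0 C0 eps0 hs hvan beta beta0.
have [[iu iL] hw _ hut hM] := hs.
have M0 : 0 <= M by have := hM z; rewrite subrr en0 => /(_ D0); exact: le_trans.
have [K2 [K20 hK2]] := usupp_bounded (@usupp_rho0 R n).
have cp := c0_gt0 R n; have ci0 : 0 <= (c0 R n)^-1 by rewrite invr_ge0 ltW.
pose k := n%:R + beta * (1 + eps).
have k0 : 0 < k by rewrite ltr_wpDl// mulr_gt0// addr_gt0.
have [d d0 hd] := hvan k k0.
pose K1 := 1 + (c0 R n)^-1 * (K2 * M * 3 `^ k).
have K10 : 0 <= K1 by rewrite addr_ge0// !mulr_ge0// ?powR_ge0// ltW.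
pose KC := (c0 R n)^-1 * (2 ^+ n * C).
have KC0 : 0 <= KC by rewrite !mulr_ge0// exprn_ge0.
exists (K1 + KC), (Num.min (d / 4) (D / 4)); split; first exact: addr_ge0.
  by rewrite lt_min !divr_gt0.
move=> s M' N s0; rewrite le_min => /andP[sd sD] hM' hN x xs.
have s3 : 0 < 3 * s by rewrite mulr_gt0.
have s3d : 3 * s < d by clear - R n sd s0; lra.
have [ig hI] := hd _ s3 s3d.
have tri y : en (y - z) <= en (y - x) + en (x - z) by exact: en_triangle.
have xsD : en (x - z) + s < D by clear - R n xs sD D0; lra.
have hNx y : en (y - x) <= s -> `|ut v y| <= N.
  by move=> yx; apply: hN; have := tri y; clear - R n xs yx s0; lra.
have h1 := half_sys_molc q0 C0 hs s0 hNx xsD.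
have M'0 : 0 <= M' by apply: bnd_ge0 hM'; rewrite mulr_ge0// ltW.
pose lam := s `^ beta; have lam0 : 0 < lam by exact: powR_gt0.
pose ker y := ev (rho0 R n) (s^-1 *: (y - x)).
have ker0 y : 0 <= ker y by exact: ev_rho0_ge0.
have kerK y : ker y <= K2 by exact: (le_trans (ler_norm (ker y)) (hK2 _)).
pose le := lam `^ eps; have le0 : 0 < le by exact: powR_gt0.
set g := (fun y => _) in ig hI.
have g0 y : 0 <= g y by rewrite mulr_ge0 ?powR_ge0.
have sU := @usupp_rho0 R n.
have ptw : {ae leb R n, forall y, `|u y * ker y| <= lam * ker y + K2 * M / le * g y}.
  have K3 : 0 <= K2 * M / le by rewrite !mulr_ge0 ?invr_ge0// ltW.
  apply: ae_imp hut => y h; have [yt|yt] := ltP s (en (y - x)).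
    by rewrite /ker (ker_support sU s0 yt) !mulr0 normr0 add0r mulr_ge0.
  have y3 : en (y - z) < 3 * s by have := tri y; clear - R n yt xs s0; lra.
  have yD : en (y - z) < D by clear - R n y3 sD D0; lra.
  have gE : g y = `|u y| `^ eps.
    by rewrite /g indicE mem_set ?mulr1//; have := y3; rewrite -eballE.
  rewrite normrM (ger0_norm (ker0 y)) gE.
  have [ul|ul] := leP `|u y| lam.
    by rewrite ler_wpDr ?ler_wpM2r// mulr_ge0// powR_ge0.
  have uM : `|u y| <= M by rewrite h// hM.
  apply: le_trans (_ : K2 * M <= _).
    by rewrite mulrC; apply: ler_pM.
  apply: ler_wpDl; first by rewrite mulr_ge0// ltW.
  rewrite -[leLHS]mulr1 -!mulrA ler_wpM2l ?(ltW K20)// ler_wpM2l//.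
  rewrite mulrC ler_pdivlMr// mul1r.
  by apply: ge0_ler_powR; rewrite ?nnegrE ?(ltW eps0) ?(ltW lam0) ?(ltW ul).
have ik : itg ker by apply: integrable_ker => //; rewrite invr_eq0 gt_eqF.
have icv := integrable_cv s^-1 x iu sU.
have cvb : `|cv u (rho0 R n) s^-1 x| <= lam * (c0 R n * s ^+ n) + K2 * M / le * (3 * s) `^ k.
  apply: le_trans (_ : \int[leb R n]_y `|u y * ker y| <= _).
    apply: le_normr_Rintegral; [exact: measurableT|exact: icv].
  have i1 := integrable_add (integrable_scale lam ik) (integrable_scale (K2 * M / le) ig).
  apply: le_trans (ae_le_Rintegral (integrable_norm icv) i1 ptw) _.
  rewrite RintegralD; [|exact: measurableT|exact: integrable_scale|exact: integrable_scale].
  rewrite RintegralZl; [|exact: measurableT|exact: ik].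
  rewrite RintegralZl; [|exact: measurableT|exact: ig].
  rewrite Rintegral_rho0//; apply: lerD => //; apply: ler_wpM2l => //.
  by rewrite !mulr_ge0 ?invr_ge0// ltW.
have sn0 : 0 < s ^+ n by rewrite exprn_gt0.
have e1 : (3 * s) `^ k = 3 `^ k * (s ^+ n * lam * le).
  rewrite powRM ?(ltW s0)//; congr (_ * _).
  rewrite /k powRD; last by apply/implyP => _; rewrite gt_eqF.
  rewrite powR_mulrn ?(ltW s0)// -mulrA; congr (_ * _).
  rewrite mulrDr mulr1 powRD; last by apply/implyP => _; rewrite gt_eqF.
  by rewrite /le /lam -powRrM.
have h2 : `|molc u s x| <= K1 * lam.
  rewrite molcE normrM normrM (ger0_norm ci0) [`|s ^- n|]ger0_norm ?invr_ge0 ?(ltW sn0)//.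
  apply: le_trans (_ : (c0 R n)^-1 * (s ^- n * (lam * (c0 R n * s ^+ n) +
      K2 * M / le * (3 * s) `^ k)) <= _).
    by rewrite ler_wpM2l// ler_wpM2l// invr_ge0 ltW.
  rewrite e1 /K1 le_eqVlt; apply/orP; left; apply/eqP; field.
  by rewrite !gt_eqF.
have h3 : `|ut u x| <= `|molc u s x - ut u x| + `|molc u s x|.
  by rewrite [leRHS]addrC -[in leLHS](subKr (molc u s x) (ut u x)) (le_trans (ler_normB _ _)).
apply: le_trans h3 _; apply: le_trans (lerD h1 h2) _.
have x1 : 0 <= 2^-1 * 18 `^ (- beta) * M' by rewrite !mulr_ge0// powR_ge0.
have N0 := powR_ge0 N q.
have x2 : 0 <= K1 * (s ^+ 2 * N `^ q) by rewrite !mulr_ge0// ?sqr_ge0// ltW.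
have x3 : 0 <= KC * lam by rewrite mulr_ge0// ltW.
rewrite /KC -/lam in x3 *; clear - R n x1 x2 x3; lra.
Qed.

(** [le_expr_expR] at [(a + 1) / 8] bounds [(a + 1)^(n + 1)] by a multiple of [exp ((a + 1) / 8)],
    and [3/4 <= exp (- 1/8)]. The surplus factor [a + 1] makes the quantity small. *)
Lemma polynomial_geometric (e : R) : 0 < e ->
  exists2 a : nat, (n < a)%N & a.+1%:R ^+ n * (3 / 4) ^+ (a - n) <= e.
Proof.
move=> e0; pose m := n.+1; pose h : R := 8^-1.
pose B := m%:R ^+ m * h ^- m * (3 / 4) ^- m.
have B0 : 0 <= B by rewrite !mulr_ge0// ?invr_ge0 ?exprn_ge0// ?mulr_ge0 ?invr_ge0.
pose a := (Num.truncn (B / e) + n.+1)%N.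
have na : (n < a)%N by rewrite /a addnS ltnS leq_addl.
exists a => //.
have aB : B / e <= a.+1%:R.
  apply: le_trans (_ : (Num.truncn (B / e)).+1%:R <= _); first exact: ltW (truncnS_gt _).
  by rewrite ler_nat ltnS /a leq_addr.
have a0 : 0 < a.+1%:R :> R by [].
suff H : a.+1%:R * (a.+1%:R ^+ n * (3 / 4) ^+ (a - n)) <= B.
  rewrite -(ler_pM2l a0); apply: le_trans H _; by rewrite -ler_pdivrMr.
have q0 : 0 < (3 / 4) ^+ m :> R by rewrite exprn_gt0// divr_gt0.
have h0 : 0 < h ^+ m by rewrite exprn_gt0// invr_gt0.
rewrite mulrA -exprS -/m /B ler_pdivlMr// -mulrA -exprD.
have -> : (a - n + m = a.+1)%N by rewrite /m addnS subnK// ltnW.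
rewrite ler_pdivlMr// mulrAC -exprMn.
have hm := le_expr_expR m (_ : 0 <= a.+1%:R * h); rewrite mulr_ge0 ?invr_ge0// in hm.
have {hm} hm := hm isT.
have q34 : (3 / 4) ^+ a.+1 <= expR (- (a.+1%:R * h)).
  rewrite [a.+1%:R * h]mulrC -mulNr expRM_natr lerXn2r ?nnegrE ?expR_ge0 ?divr_ge0//.
  apply: le_trans (expR_ge1Dx _); rewrite /h; lra.
apply: le_trans (ler_pM _ _ hm q34) _; rewrite ?exprn_ge0 ?mulr_ge0 ?invr_ge0 ?divr_ge0//.
by rewrite -mulrA -expRD subrr expR0 mulr1.
Qed.

(* A ball on which the solution vanishes touches [z] from outside: apply the
   weighted estimate at the point at distance [2 s] from [z] on the way to the
   centre of that ball. *)
Lemma improves_of_touching z z0 (rho : R) D u L v q C M : 0 < D -> 0 < q -> 0 <= C -> 0 < rho ->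
  en (z0 - z) = rho -> half_sys z D u L v q C M ->
  (forall y, en (y - z0) < rho -> ut u y = 0 /\ ut v y = 0) -> improves z u v q.
Proof.
move=> D0 q0 C0 rho0' zz hs hz beta beta0.
have [K2 [K20 hK2]] := usupp_bounded (@usupp_rho0 R n).
have [K K1 hK] := cutoff_bounds R n.
have cp := c0_gt0 R n; have ci0 : 0 <= (c0 R n)^-1 by rewrite invr_ge0 ltW.
pose Kn := 2 + (c0 R n)^-1 * (436 * K2 * K ^+ 2 * 6 ^+ n) * 2 ^+ n + (c0 R n)^-1 * 2 ^+ n.+1.
have Kn0 : 0 < Kn.
  have x1 : 0 <= (c0 R n)^-1 * (436 * K2 * K ^+ 2 * 6 ^+ n) * 2 ^+ n.
    apply: mulr_ge0; last by rewrite exprn_ge0.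
    apply: mulr_ge0; first exact: ci0.
    apply: mulr_ge0; last by rewrite exprn_ge0.
    apply: mulr_ge0; last exact: sqr_ge0.
    exact: mulr_ge0 (ler0n R 436) (ltW K20).
  have x2 : 0 <= (c0 R n)^-1 * 2 ^+ n.+1 by rewrite mulr_ge0 ?exprn_ge0.
  rewrite /Kn; lra.
pose e := 2^-1 * 18 `^ (- beta) : R.
have e0 : 0 < e by rewrite mulr_gt0 ?powR_gt0.
(* [a] depends on [beta] but not on [s], [M'] or [N], as [improves] requires of the constants. *)
have [a na ha] := polynomial_geometric (divr_gt0 e0 Kn0).
have a0 : (0 < a)%N by exact: leq_trans na.
have X0 : 0 <= 16 * 2 ^+ a.-1 * C by rewrite !mulr_ge0// exprn_ge0.
exists (e * (16 * 2 ^+ a.-1 * C)), (Num.min (rho / 2) (D / 20)); split.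
- exact: mulr_ge0 (ltW e0) X0.
- by rewrite lt_min !divr_gt0.
move=> s M' N s0; rewrite le_min => /andP[srho sD] hM' hN x xs.
have M'0 : 0 <= M' by apply: bnd_ge0 hM'; rewrite mulr_ge0// ltW.
have N0 := powR_ge0 N q.
set rhs := _ + _; have rhs0 : 0 <= rhs.
  apply: addr_ge0; first exact: (mulr_ge0 (ltW e0) M'0).
  apply: mulr_ge0; first exact: (mulr_ge0 (ltW e0) X0).
  exact: (addr_ge0 (powR_ge0 _ _) (mulr_ge0 (sqr_ge0 _) N0)).
have [M'p|M'p] := ltP 0 M'; last first.
  by apply: le_trans (hM' x _) _; [lra|exact: le_trans rhs0].
(* The ball of radius [2 s] at [zr] lies in the ball of zeros, and the ball of radius [16 s], which
   [local_decay] needs for [r = 4 s], lies within [18 s] of [z]: this is the origin of 18. *)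
pose zr := z + (2 * s / rho) *: (z0 - z).
have zr1 : en (zr - z) = 2 * s.
  by rewrite /zr addrAC subrr add0r enZ zz ger0_norm ?divfK ?gt_eqF// divr_ge0 ?mulr_ge0 ?ltW.
have zr0 : en (zr - z0) = rho - 2 * s.
  have -> : zr - z0 = - (1 - 2 * s / rho) *: (z0 - z).
    by apply/rowP => i; rewrite !mxE; field; rewrite gt_eqF.
  rewrite enZ zz normrN ger0_norm ?mulrBl ?mul1r ?divfK ?gt_eqF// subr_ge0 ler_pdivrMr// mul1r; clear - R n srho; lra.
have h16 : en (zr - z) + 4 * (4 * s) <= D by rewrite zr1; clear - R n sD D0; lra.
have [[iu iL] hw hL hut _] := half_sys_sub h16 hs.
have in18 y : en (y - zr) < 4 * (4 * s) -> en (y - z) <= 18 * s.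
  by have := en_triangle zr y z; rewrite zr1; clear - R n; lra.
have in2 y : en (y - zr) < 2 * s -> ut u y = 0 /\ ut v y = 0.
  by move=> h; apply: hz; have := en_triangle zr y z0; rewrite zr0; clear - R n h; lra.
(* Where [v] is nonzero, [|y - zr| >= 2 s], so the factor [2^(a-1)] turns the constant bound [C N^q]
   into the growth demanded of [L]. In the same way [M' (2 s)^(-2 a - 4)] serves as the constant of
   the high-order vanishing of [u] at [zr]. *)
pose A := 2 ^+ a.-1 * (C * N `^ q).
have A0 : 0 <= A by rewrite !mulr_ge0 ?exprn_ge0.
have CNA : C * N `^ q <= A by rewrite ler_peMl ?mulr_ge0// exprn_ege1// ler1n.
have s40 : 0 < 4 * s by rewrite mulr_gt0.
have LN : {ae leb R n, forall y, en (y - zr) < 4 * (4 * s) -> `|L y| <= C * N `^ q}.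
  apply: ae_imp hL => y h yz; apply: le_trans (h yz) _; rewrite ler_wpM2l//.
  have yN : `|ut v y| <= N by apply: hN; exact: in18.
  have Np : 0 <= N by apply: le_trans yN.
  by apply: ge0_ler_powR; rewrite ?nnegrE ?(ltW q0).
have H := @local_decay R n u L zr (4 * s) A M' (M' * (2 * s) ^- (2 * a + 4)) a s40 A0 M'p _ a0
  iu iL hw _ _ hut _ _ na K K2 x K1 hK hK2 _.
apply: le_trans (H _ _ _ _ _ _) _ => {H}.
- by rewrite mulr_ge0// invr_ge0 exprn_ge0// mulr_ge0// ltW.
- by apply: ae_imp LN => y h yz; apply: le_trans (h yz) CNA.
- apply: ae_imp (ae_and hL LN) => y [h h'] yz; have [y2|y2] := ltP (en (y - zr)) (2 * s).
    have [_ v0] := in2 _ y2; apply: le_trans (h yz) _.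
    rewrite v0 normr0 powR0 ?gt_eqF// mulr0 mulr_ge0// exprn_ge0// divr_ge0 ?en_ge0// ltW//.
  apply: le_trans (h' yz) _; rewrite /A -mulrA mulrCA ler_peMr ?mulr_ge0// -exprMn.
  by rewrite exprn_ege1// mulrA ler_pdivlMr// mul1r; clear - R n y2; lra.
- by move=> y yz; apply: hM'; exact: in18.
- move=> y yz; have [y2|y2] := ltP (en (y - zr)) (2 * s).
    by have [-> _] := in2 _ y2; rewrite normr0 !mulr_ge0 ?invr_ge0 ?exprn_ge0 ?en_ge0 ?mulr_ge0 ?(ltW s0).
  apply: le_trans (hM' _ (in18 _ yz)) _; rewrite -mulrA ler_peMr// mulrC -expr_div_n.
  by rewrite exprn_ege1// ler_pdivlMr ?mulr_gt0// mul1r.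
- have := en_triangle z x zr; rewrite [en (z - zr)]enB zr1; clear - R n xs s0; lra.
(* A point within [s] of [z] is within [3 s] of [zr], to be compared with the radius [4 s]. *)
have x34 : (en (x - zr) / (4 * s)) ^+ (a - n) <= (3 / 4) ^+ (a - n).
  rewrite lerXn2r ?nnegrE ?divr_ge0 ?en_ge0 ?(ltW s40)// ler_pdivrMr//.
  have := en_triangle z x zr; rewrite [en (z - zr)]enB zr1; clear - R n xs s0; lra.
have AM0 : 0 <= (4 * s) ^+ 2 * A + M' := addr_ge0 (mulr_ge0 (sqr_ge0 _) A0) M'0.
rewrite -/Kn; apply: le_trans (_ : Kn * a.+1%:R ^+ n * ((4 * s) ^+ 2 * A + M') * (3 / 4) ^+ (a - n) <= _).
  by rewrite ler_wpM2l// !mulr_ge0 ?exprn_ge0 ?(ltW Kn0).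
apply: le_trans (_ : e * ((4 * s) ^+ 2 * A + M') <= _).
  rewrite ler_pdivlMr// in ha.
  have := ler_wpM2r AM0 ha; clear - R n; lra.
have x5 : 0 <= e * (16 * 2 ^+ a.-1 * C) * s `^ beta.
  exact: (mulr_ge0 (mulr_ge0 (ltW e0) X0) (powR_ge0 _ _)).
rewrite /rhs -/e /A; clear - R n x5; lra.
Qed.

End half_system.


(** * Vanishing near a point where all orders of decay hold *)

Section zero_near.
Context (R : realType) (n : nat).
Local Notation V := 'rV[R]_n.
Implicit Types (z : V) (u L Lu Lv : V -> R).

Lemma powR_le_exp (w s : R) (m : nat) : 0 <= w -> w <= 1 -> m%:R <= s -> w `^ s <= w ^+ m.
Proof.
move=> w0 w1 ms; have [w0'|w0'] := ltP 0 w.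
  by rewrite -powR_mulrn//; apply: ger_powR => //; rewrite w0'.
have -> : w = 0 by apply/eqP; rewrite eq_le w0' w0.
have [s0|s0] := eqVneq s 0; last by rewrite powR0// exprn_ge0.
have -> : m = 0%N by apply/eqP; move: ms; rewrite s0 (lern0 R m).
by rewrite s0 powRr0 expr0.
Qed.

Lemma exp_le_powR (w s : R) (m : nat) : 0 <= w -> w <= 1 -> 0 <= s -> s <= m%:R ->
  w ^+ m <= w `^ s.
Proof.
move=> w0 w1 s0 sm; have [w0'|w0'] := ltP 0 w.
  by rewrite -powR_mulrn//; apply: ger_powR => //; rewrite w0'.
have -> : w = 0 by apply/eqP; rewrite eq_le w0' w0.
case: m sm => [|m] sm; last by rewrite expr0n powR_ge0.
have -> : s = 0 by apply/eqP; rewrite eq_le s0 sm.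
by rewrite powRr0 expr0.
Qed.

Lemma powR_le1 (w s : R) : 0 <= w -> w <= 1 -> 0 <= s -> w `^ s <= 1.
Proof. by move=> w0 w1 s0; have := powR_le_exp (m := 0) w0 w1 s0; rewrite expr0. Qed.

Lemma powR_ge1 (b s : R) : 1 <= b -> 0 <= s -> 1 <= b `^ s.
Proof. by move=> b1 s0; rewrite -[leLHS](powRr0 b); exact: ler_powR. Qed.

(** A positive order of decay forces [ut u z = 0], so the bound by a power of the distance also
    holds at the centre; away from it, the bound [M] is enough. *)
Lemma decays_pointwise (u : V -> R) z (D M : R) (m : nat) : 0 <= M -> 0 < D -> (0 < m)%N ->
  (forall y, en (y - z) < D -> `|ut u y| <= M) -> decays u z m%:R ->
  exists2 C, 0 <= C & forall y, en (y - z) < D -> `|ut u y| <= C * en (y - z) ^+ m.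
Proof.
move=> M0 D0 m0 hM [C [d [C0 d0 H]]].
exists (C + M * d ^- m); first by rewrite addr_ge0 ?mulr_ge0 ?invr_ge0 ?exprn_ge0// ltW.
move=> y yD; have e0 := en_ge0 (y - z); set e := en (y - z) in yD e0 *.
have Md : 0 <= M * d ^- m by rewrite mulr_ge0 ?invr_ge0 ?exprn_ge0// ltW.
have em : 0 <= e ^+ m by rewrite exprn_ge0.
have [ep|ep] := ltP 0 e; last first.
  have eE : e = 0 by apply/eqP; rewrite eq_le ep e0.
  have -> : `|ut u y| = 0.
    apply/eqP; rewrite eq_le normr_ge0 andbT leNgt; apply/negP => up.
    pose s := Num.min (Num.min d 1) (`|ut u y| / (2 * (C + 1))).
    have C1 : 0 < 2 * (C + 1) by rewrite mulr_gt0// ltr_wpDl.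
    have s0 : 0 < s by rewrite /s !lt_min d0 ltr01 divr_gt0.
    have [sd s1 su] : [/\ s <= d, s <= 1 & s <= `|ut u y| / (2 * (C + 1))].
      by split; rewrite /s !ge_min lexx ?orbT.
    have ys : en (y - z) <= s by rewrite -/e eE ltW.
    have := H s s0 sd y ys; rewrite powR_mulrn ?(ltW s0)// => h.
    have h2 : s ^+ m <= s by rewrite -[leRHS]expr1 ler_wiXn2l// ltW.
    have h3 : C * s ^+ m <= C * s by rewrite ler_wpM2l.
    rewrite ler_pdivlMr// in su; lra.
  by rewrite mulr_ge0// addr_ge0.
have [ed|ed] := leP e d.
  have := H e ep ed y (lexx _); rewrite powR_mulrn// => h.
  by apply: le_trans h _; rewrite ler_wpM2r// lerDl.
apply: le_trans (hM _ yD) _; rewrite mulrDl.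
apply: ler_wpDl; first by rewrite mulr_ge0.
rewrite -mulrA ler_peMr// mulrC -expr_div_n exprn_ege1// ler_pdivlMr// mul1r ltW//.
Qed.

(** [local_decay] with [a - 1] the integer part of [q k]. [K] depends neither on [b] nor on [k], and
    [K <= b] ensures that [b] also bounds [v] between the radii [r] and [4 r]. *)
Lemma decay_step z (D : R) u L (v : V -> R) (q C M r : R) : 0 < q -> 0 <= C -> 0 < M -> 0 < r -> 4 * r <= D ->
  half_sys z D u L v q C M -> (forall b, decays u z b) ->
  (forall y, en (y - z) < D -> `|ut v y| <= M) ->
  exists2 K, 1 <= K & forall b k, K <= b -> n%:R <= q * k ->
    (forall x, en (x - z) <= r -> `|ut v x| <= b * (en (x - z) / r) `^ k) ->
    forall x, en (x - z) <= r ->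
      `|ut u x| <= K * (q * k + 2) ^+ n * b `^ q * (en (x - z) / r) `^ (q * k - n%:R).
Proof.
move=> q0 C0 M0 r0 rD hs hdec hvM.
have hs4 : half_sys z (4 * r) u L v q C M.
  by apply: half_sys_sub hs; rewrite subrr en0 add0r.
have [[iu iL] hw hL hut hM] := hs4.
have [K2 [K20 hK2]] := usupp_bounded (@usupp_rho0 R n).
have [K K1 hK] := cutoff_bounds R n.
have [Kn Kn0 hKn] : exists2 Kn, 0 <= Kn & forall (A C' : R) (a : nat), (n < a)%N -> 0 <= A -> 0 <= C' ->
    {ae leb R n, forall y, en (y - z) < 4 * r -> `|L y| <= A} ->
    {ae leb R n, forall y, en (y - z) < 4 * r -> `|L y| <= A * (en (y - z) / r) ^+ a.-1} ->
    (forall y, en (y - z) < 4 * r -> `|ut u y| <= C' * en (y - z) ^+ (2 * a + 4)) ->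
    forall x, en (x - z) <= r ->
    `|ut u x| <= Kn * a.+1%:R ^+ n * (r ^+ 2 * A + M) * (en (x - z) / r) ^+ (a - n).
  eexists; last first.
    move=> A C' a na A0 C'0 hA hAs hC' x xr.
    have a0 : (0 < a)%N by exact: leq_trans na.
    exact: (local_decay r0 A0 M0 C'0 a0 iu iL hw hA hAs hut hM hC' na K1 hK hK2 xr).
  have cp := c0_gt0 R n; have ci0 : 0 <= (c0 R n)^-1 by rewrite invr_ge0 ltW.
  apply: addr_ge0; last by rewrite mulr_ge0// exprn_ge0.
  apply: addr_ge0; first by [].
  apply: mulr_ge0; last by rewrite exprn_ge0.
  apply: mulr_ge0; first exact: ci0.
  apply: mulr_ge0; last by rewrite exprn_ge0.
  apply: mulr_ge0; last exact: sqr_ge0.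
  exact: mulr_ge0 (ler0n R 436) (ltW K20).
have rC0 : 0 <= r ^+ 2 * C by rewrite mulr_ge0// sqr_ge0.
have rCM : 0 <= r ^+ 2 * C + M by rewrite addr_ge0// ltW.
pose K' := 1 + M + Kn * (r ^+ 2 * C + M).
have KM : 0 <= Kn * (r ^+ 2 * C + M) by rewrite mulr_ge0.
exists K'; first by rewrite /K'; clear - R n M0 KM; lra.
move=> b k Kb nqk hv x xr.
have b1 : 1 <= b by apply: le_trans Kb; rewrite /K'; clear - R n M0 KM; lra.
have Mb : M <= b by apply: le_trans Kb; rewrite /K'; clear - R n M0 KM; lra.
have b0 : 0 <= b by exact: le_trans b1.
have bq1 : 1 <= b `^ q by apply: powR_ge1 => //; exact: ltW.
have qk0 : 0 <= q * k by exact: le_trans nqk.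
have k0 : 0 <= k by rewrite -(pmulr_rge0 _ q0).
have w0 y : 0 <= en (y - z) / r by rewrite divr_ge0 ?en_ge0// ltW.
have w1 y : en (y - z) <= r -> en (y - z) / r <= 1 by move=> yr; rewrite ler_pdivrMr// mul1r.
pose t := Num.truncn (q * k); pose a := t.+1.
have tq : t%:R <= q * k by rewrite /t truncn_le.
have na : (n < a)%N by rewrite ltnS /t truncn_ge_nat.
have aq : q * k <= a%:R by exact: ltW (truncnS_gt _).
pose A := C * b `^ q.
have A0 : 0 <= A by rewrite mulr_ge0// powR_ge0.
have vb y : en (y - z) < 4 * r -> `|ut v y| <= b.
  move=> yr; have [h|h] := leP (en (y - z)) r; last by apply: le_trans Mb; apply: hvM; clear - R n yr rD; lra.
  by apply: le_trans (hv y h) _; rewrite ler_piMr// powR_le1// w1.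
have [C' C'0 hC'] : exists2 C', 0 <= C' &
    forall y, en (y - z) < 4 * r -> `|ut u y| <= C' * en (y - z) ^+ (2 * a + 4).
  apply: (@decays_pointwise u z (4 * r) M); rewrite ?mulr_gt0 ?(ltW M0) ?addn_gt0 ?orbT//.
have hA : {ae leb R n, forall y, en (y - z) < 4 * r -> `|L y| <= A}.
  apply: ae_imp hL => y h yr; apply: le_trans (h yr) _; rewrite ler_wpM2l//.
  by apply: ge0_ler_powR; rewrite ?nnegrE ?(ltW q0) ?vb.
have hAs : {ae leb R n, forall y, en (y - z) < 4 * r -> `|L y| <= A * (en (y - z) / r) ^+ a.-1}.
  apply: ae_imp (ae_and hL hA) => y [h h'] yr; have [yr1|yr1] := leP (en (y - z)) r.
    apply: le_trans (h yr) _; rewrite /A -mulrA ler_wpM2l//.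
    apply: le_trans (_ : (b * (en (y - z) / r) `^ k) `^ q <= _).
      by apply: ge0_ler_powR; rewrite ?nnegrE ?(ltW q0) ?mulr_ge0 ?powR_ge0 ?hv.
    rewrite [(b * _) `^ q]powRM ?powR_ge0// ler_wpM2l ?powR_ge0// -powRrM [k * q]mulrC.
    by apply: powR_le_exp => //; exact: w1.
  apply: le_trans (h' yr) _; rewrite ler_peMr// exprn_ege1// ler_pdivlMr// mul1r ltW//.
apply: le_trans (hKn A C' a na A0 C'0 hA hAs hC' x xr) _.
have y1 : (en (x - z) / r) ^+ (a - n) <= (en (x - z) / r) `^ (q * k - n%:R).
  apply: exp_le_powR; rewrite ?w0 ?w1 ?subr_ge0//.
  by rewrite natrB ?lerD2r// ltnW.
have y2 : a.+1%:R ^+ n <= (q * k + 2) ^+ n.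
  have h : a.+1%:R <= q * k + 2.
    have -> : a.+1%:R = t%:R + 2 :> R by rewrite -natrD addn2.
    by rewrite lerD2r.
  apply: lerXn2r; [by rewrite nnegrE; exact: ler0n|by rewrite nnegrE addr_ge0|exact: h].
have y3 : r ^+ 2 * A + M <= (r ^+ 2 * C + M) * b `^ q.
  rewrite [leRHS]mulrDl /A mulrA lerD2l ler_peMr// ltW//.
have y0 : 0 <= r ^+ 2 * A + M := addr_ge0 (mulr_ge0 (sqr_ge0 r) A0) (ltW M0).
apply: ler_pM => //.
- by rewrite !mulr_ge0 ?exprn_ge0.
- by rewrite exprn_ge0.
apply: le_trans (_ : Kn * (q * k + 2) ^+ n * ((r ^+ 2 * C + M) * b `^ q) <= _).
  apply: ler_pM => //; first by rewrite mulr_ge0 ?exprn_ge0.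
  by rewrite ler_wpM2l.
rewrite mulrA [X in X * _ <= _]mulrAC.
rewrite ler_wpM2r ?powR_ge0// ler_wpM2r ?exprn_ge0 ?addr_ge0//.
by rewrite /K' lerDr addr_ge0// ltW.
Qed.

Lemma geometric_unbounded (g : R) (m : nat) : 1 < g -> exists i : nat, m%:R <= g ^+ i.
Proof.
move=> g1; have g10 : 0 < g - 1 by rewrite subr_gt0.
have B i : i%:R * (g - 1) <= g ^+ i.
  elim: i => [|i ih]; first by rewrite mul0r expr0.
  have : 1 <= g ^+ i by rewrite exprn_ege1// ltW.
  move=> /(ler_wpM2l (ltW g10)); rewrite exprS -natr1; lra.
exists (Num.truncn (m%:R / (g - 1))).+1; apply: le_trans (B _).
by rewrite -ler_pdivrMr// ltW// truncnS_gt.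
Qed.

(** The bound is [(Th w^kap)^(g^i)], whose base is at most [1/2], and [g^i] is unbounded. *)
Lemma geometric_halving (v w Th kap g : R) : 0 <= v -> 0 <= w -> 1 <= Th -> 1 <= kap -> 1 < g ->
  w <= 1 -> Th * w <= 2^-1 -> (forall i : nat, v <= Th `^ (g ^+ i) * w `^ (kap * g ^+ i)) -> v = 0.
Proof.
move=> v0 w0 Th1 kap1 g1 w1 Thw H; apply/eqP; rewrite eq_le v0 andbT leNgt; apply/negP => vp.
have Th0 : 0 <= Th by exact: le_trans Th1.
pose m := (Num.truncn v^-1).+1.
have m0 : 0 < m%:R :> R by [].
have vm : v^-1 < m%:R by exact: truncnS_gt.
have [i hi] := geometric_unbounded m g1.
have gi0 : 0 <= g ^+ i by exact: le_trans hi.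
have := H i; rewrite powRrM -powRM ?powR_ge0//; apply/negP; rewrite -ltNge.
have wk : w `^ kap <= w by have := powR_le_exp (m := 1) w0 w1 kap1; rewrite expr1.
have X0 : 0 <= Th * w `^ kap by rewrite mulr_ge0 ?powR_ge0.
have Xh : Th * w `^ kap <= 2^-1 by apply: le_trans Thw; rewrite ler_wpM2l.
apply: le_lt_trans (powR_le_exp X0 _ hi) _; first lra.
apply: le_lt_trans (_ : 2^-1 ^+ m < _).
  by rewrite lerXn2r ?nnegrE ?invr_ge0.
rewrite exprVn -[ltRHS]invrK ltf_pV2 ?posrE ?invr_gt0 ?exprn_gt0//.
apply: lt_trans vm _; rewrite -natrX ltr_nat; exact: ltn_expl.
Qed.

(** Estimates such as [q k + 2 <= (q + 2) (k + 1)] collect the dependence on [k] of both exchanges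
    into one power of [k + 1]. *)
Lemma iteration_constant (K p q g k b : R) : 0 <= K -> 0 < p -> 0 < q -> g = p * q ->
  0 <= k -> 0 <= b -> 0 <= p * (q * k - n%:R) ->
  K * (p * (q * k - n%:R) + 2) ^+ n * (K * (q * k + 2) ^+ n * b `^ q) `^ p <=
  K * (g + 2) ^+ n * (K * (q + 2) ^+ n) `^ p * (k + 1) `^ (n%:R + n%:R * p) * b `^ g.
Proof.
move=> K0 p0 q0 -> k0 b0 pk0.
have [p0' q0'] : 0 <= p /\ 0 <= q by rewrite !ltW.
have n0 : 0 <= n%:R :> R by [].
have k10 : 0 < k + 1 by rewrite ltr_wpDl.
have k10' := ltW k10.
have pq0 : 0 <= p * q by rewrite mulr_ge0.
have qk0 : 0 <= q * k by rewrite mulr_ge0.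
have pqk0 : 0 <= p * q * k by rewrite mulr_ge0.
have pn0 : 0 <= p * n%:R by rewrite mulr_ge0.
have e1 : (p * (q * k - n%:R) + 2) ^+ n <= (p * q + 2) ^+ n * (k + 1) `^ n%:R.
  rewrite powR_mulrn// -exprMn lerXn2r ?nnegrE//; [by rewrite addr_ge0|by rewrite mulr_ge0// addr_ge0|lra].
have X1 : 0 <= K * (q + 2) ^+ n by rewrite mulr_ge0// exprn_ge0// addr_ge0.
have X2 : 0 <= K * (q + 2) ^+ n * (k + 1) `^ n%:R by rewrite mulr_ge0// powR_ge0.
have X3 : (q * k + 2) ^+ n <= (q + 2) ^+ n * (k + 1) `^ n%:R.
  rewrite powR_mulrn// -exprMn lerXn2r ?nnegrE//; [by rewrite addr_ge0|by rewrite mulr_ge0// addr_ge0|lra].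
have X4 : 0 <= K * (q * k + 2) ^+ n by rewrite mulr_ge0// exprn_ge0// addr_ge0.
have e2 : (K * (q * k + 2) ^+ n * b `^ q) `^ p <=
    (K * (q + 2) ^+ n) `^ p * (k + 1) `^ (n%:R * p) * b `^ (p * q).
  rewrite [p * q]mulrC [b `^ (q * p)]powRrM [(k + 1) `^ (_ * p)]powRrM.
  rewrite -[(K * _) `^ p * _]powRM ?powR_ge0// -powRM ?powR_ge0//.
  apply: ge0_ler_powR; rewrite ?nnegrE//; [by rewrite mulr_ge0 ?powR_ge0..|].
  by rewrite ler_wpM2r ?powR_ge0// -mulrA ler_wpM2l.
have Y1 : 0 <= (p * (q * k - n%:R) + 2) ^+ n by rewrite exprn_ge0// addr_ge0.
have h1 := ler_wpM2l K0 e1.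
apply: le_trans (ler_pM (mulr_ge0 K0 Y1) (powR_ge0 _ _) h1 e2) _.
rewrite [(k + 1) `^ (_ + _)]powRD; last by apply/implyP => _; rewrite gt_eqF.
by rewrite le_eqVlt; apply/orP; left; apply/eqP; ring.
Qed.

(** For [Th = b (k + 1)^s H] the recursion becomes a pure power, [Th' <= Th^g]: the condition
    [N + s = s g] absorbs the factor [(k + 1)^N], and [G g^s H <= H^g] absorbs the constants. *)
Lemma iteration_step (b b' G g s k k' H N : R) : 0 <= b -> 0 <= b' -> 0 <= g -> 0 <= k -> 0 <= k' ->
  0 <= s -> 0 <= H -> k' + 1 <= g * (k + 1) -> N + s = s * g -> G * g `^ s * H <= H `^ g ->
  b' <= G * (k + 1) `^ N * b `^ g -> b' * (k' + 1) `^ s * H <= (b * (k + 1) `^ s * H) `^ g.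
Proof.
move=> b0 b'0 g0 k0 k'0 s0 H0 kk sE HE hb.
have k1 : 0 < k + 1 by rewrite ltr_wpDl.
have e4 : (k' + 1) `^ s <= g `^ s * (k + 1) `^ s.
  rewrite -powRM ?(ltW k1)//; apply: ge0_ler_powR; rewrite ?nnegrE ?addr_ge0//.
  by rewrite mulr_ge0// ltW.
apply: le_trans (_ : (G * (k + 1) `^ N * b `^ g) * (g `^ s * (k + 1) `^ s) * H <= _).
  by rewrite ler_wpM2r//; apply: ler_pM => //; exact: powR_ge0.
have -> : G * (k + 1) `^ N * b `^ g * (g `^ s * (k + 1) `^ s) * H =
   (G * g `^ s * H) * (((k + 1) `^ N * (k + 1) `^ s) * b `^ g) by ring.
rewrite -powRD; last by apply/implyP => _; rewrite gt_eqF.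
rewrite sE powRrM -powRM ?powR_ge0//.
apply: le_trans (ler_wpM2r (powR_ge0 _ _) HE) _.
rewrite -powRM ?mulr_ge0 ?powR_ge0// le_eqVlt; apply/orP; left; apply/eqP.
by congr (_ `^ _); ring.
Qed.

Lemma decay_iteration_step (X : Type) (P : X -> Prop) (w U W : X -> R) (p q g K k b : R) :
  (forall x, 0 <= w x) -> 1 <= K -> 0 < p -> 0 < q -> g = p * q ->
  (forall b k, K <= b -> n%:R <= q * k -> (forall x, P x -> W x <= b * w x `^ k) ->
    forall x, P x -> U x <= K * (q * k + 2) ^+ n * b `^ q * w x `^ (q * k - n%:R)) ->
  (forall b k, K <= b -> n%:R <= p * k -> (forall x, P x -> U x <= b * w x `^ k) ->
    forall x, P x -> W x <= K * (p * k + 2) ^+ n * b `^ p * w x `^ (p * k - n%:R)) ->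
  0 <= k -> K <= b -> n%:R <= q * k -> n%:R <= p * (q * k - n%:R) ->
  (forall x, P x -> W x <= b * w x `^ k) ->
  exists b', [/\ K <= b',
    b' <= K * (g + 2) ^+ n * (K * (q + 2) ^+ n) `^ p * (k + 1) `^ (n%:R + n%:R * p) * b `^ g
    & forall x, P x -> W x <= b' * w x `^ (g * k - (p + 1) * n%:R)].
Proof.
move=> w0 K1 p0 q0 gE hU hW k0 Kb nqk npk hb.
have K0 : 0 <= K by exact: le_trans K1.
have b1 : 1 <= b by exact: le_trans Kb.
have b0 : 0 <= b by exact: le_trans b1.
have qk0 : 0 <= q * k by exact: le_trans nqk.
have pk0 : 0 <= p * (q * k - n%:R) by exact: le_trans npk.
have grow (y c s : R) : 0 <= y -> 1 <= c -> 0 <= s -> K <= K * (y + 2) ^+ n * c `^ s.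
  move=> y0 c1 s0; rewrite -mulrA ler_peMr// -[leLHS]mulr1; apply: ler_pM => //.
    by rewrite exprn_ege1// -[leLHS]add0r lerD// ler1n.
  exact: powR_ge1.
have h1 := hU b k Kb nqk hb.
have Kb1 := grow (q * k) b q qk0 b1 (ltW q0).
have h2 := hW _ _ Kb1 npk h1.
exists (K * (p * (q * k - n%:R) + 2) ^+ n * (K * (q * k + 2) ^+ n * b `^ q) `^ p); split.
- exact: (grow _ _ _ pk0 (le_trans K1 Kb1) (ltW p0)).
- exact: (iteration_constant K0 p0 q0 gE k0 b0 pk0).
- move=> x Px; have -> : g * k - (p + 1) * n%:R = p * (q * k - n%:R) - n%:R by rewrite gE; ring.
  exact: h2.
Qed.

(** Only the numbers [w x], [U x] and [W x] matter, so the bookkeeping of exponents and constants is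
    separated from the analysis. Below [w = 1 / (2 Th)] the gain [w^(g^i)] outweighs the constants
    [Th^(g^i)]. *)
Lemma decay_iteration (X : Type) (P : X -> Prop) (w U W : X -> R) (p q K : R) :
  (forall x, 0 <= w x) -> (forall x, P x -> w x <= 1) -> (forall x, 0 <= W x) ->
  1 <= K -> 0 < p -> 0 < q -> 1 < p * q ->
  (forall b k, K <= b -> n%:R <= q * k -> (forall x, P x -> W x <= b * w x `^ k) ->
    forall x, P x -> U x <= K * (q * k + 2) ^+ n * b `^ q * w x `^ (q * k - n%:R)) ->
  (forall b k, K <= b -> n%:R <= p * k -> (forall x, P x -> U x <= b * w x `^ k) ->
    forall x, P x -> W x <= K * (p * k + 2) ^+ n * b `^ p * w x `^ (p * k - n%:R)) ->
  (forall k, 0 <= k -> exists2 b, K <= b & forall x, P x -> W x <= b * w x `^ k) ->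
  exists2 e, 0 < e & forall x, P x -> w x <= e -> W x = 0.
Proof.
move=> w0 w1 W0 K1 p0 q0 pq hU hW hdec.
have K0 : 0 <= K by exact: le_trans K1.
have n0 : 0 <= n%:R :> R by [].
(* The parameters are introduced as variables with a defining equation, so that later tactics treat
   them as atoms. *)
have [g gE] : exists g, g = p * q by exists (p * q).
have g0 : 0 < g by rewrite gE mulr_gt0.
have g1 : 1 < g by rewrite gE.
have g10 : 0 < g - 1 by rewrite subr_gt0.
have [c cE] : exists c, c = (p + 1) * n%:R by exists ((p + 1) * n%:R).
have c0' : 0 <= c by rewrite cE mulr_ge0// addr_ge0// ltW.
(* [d] is the fixed point of the map [k -> g k - c] that a round trip induces on orders; starting
   [kap] above it gives [k i = d + kap g^i]. *)
have [d dd] : exists d, d = c / (g - 1) by exists (c / (g - 1)).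
have d0 : 0 <= d by rewrite dd divr_ge0// ltW.
have dE : g * d - c = d by rewrite dd; field; rewrite gt_eqF.
(* [kap] is large enough for both halves of every round trip to meet their conditions, [n <= q k]
   and [n <= p (q k - n)]. *)
have [kap kapE] : exists kp, kp = 1 + n%:R / q + n%:R / g by exists (1 + n%:R / q + n%:R / g).
have nq0 : 0 <= n%:R / q by rewrite divr_ge0// ltW.
have ng0 : 0 <= n%:R / g by rewrite divr_ge0// ltW.
have kap1 : 1 <= kap by rewrite kapE -addrA lerDl addr_ge0.
have [k kE0] : exists k : nat -> R, forall i, k i = d + kap * g ^+ i.
  by exists (fun i => d + kap * g ^+ i).
have gi1 i : 1 <= g ^+ i by rewrite exprn_ege1// ltW.
have kkap i : kap <= k i.
  by rewrite kE0; apply: ler_wpDl => //; rewrite ler_peMr// (le_trans _ kap1).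
have k0 i : 0 <= k i by apply: le_trans (kkap i); exact: le_trans kap1.
have kS i : k i.+1 = g * k i - c by rewrite !kE0 exprS mulrDr -[in LHS]dE; ring.
have qkn i : n%:R / p <= q * k i - n%:R.
  have h := ler_wpM2l (ltW q0) (kkap i).
  have : q * kap = q + n%:R + n%:R / p by rewrite kapE gE; field; rewrite !gt_eqF.
  lra.
have np0 : 0 <= n%:R / p by rewrite divr_ge0// ltW.
have nqk i : n%:R <= q * k i by have := qkn i; lra.
have npk i : n%:R <= p * (q * k i - n%:R).
  by have := ler_wpM2l (ltW p0) (qkn i); rewrite mulrCA mulfV ?mulr1// gt_eqF.
have [N NE] : exists N, N = n%:R + n%:R * p by exists (n%:R + n%:R * p).
have N0 : 0 <= N by rewrite NE addr_ge0// mulr_ge0// ltW.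
have [G GE] : exists G, G = K * (g + 2) ^+ n * (K * (q + 2) ^+ n) `^ p.
  by exists (K * (g + 2) ^+ n * (K * (q + 2) ^+ n) `^ p).
have G0 : 0 <= G by rewrite GE mulr_ge0 ?powR_ge0// mulr_ge0// exprn_ge0// addr_ge0// ltW.
have [s sd] : exists s, s = N / (g - 1) by exists (N / (g - 1)).
have s0 : 0 <= s by rewrite sd divr_ge0// ltW.
have sE : N + s = s * g by rewrite sd; field; rewrite gt_eqF.
have Gg : 0 <= G * g `^ s by rewrite mulr_ge0 ?powR_ge0.
(* Take [H] with [H^(g - 1) = 1 + G g^s]. *)
have [H H1 HE] : exists2 H, 1 <= H & G * g `^ s * H <= H `^ g.
  pose H0 := 1 + G * g `^ s.
  have H01 : 1 <= H0 by rewrite lerDl.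
  have H1 : 1 <= H0 `^ (g - 1)^-1 by apply: powR_ge1 => //; rewrite invr_ge0 ltW.
  exists (H0 `^ (g - 1)^-1) => //; set H := H0 `^ _ in H1 *.
  have -> : H `^ g = H0 * H.
    rewrite -{1}[g](subrK 1) powRD; last by apply/implyP => _; rewrite gt_eqF// (lt_le_trans _ H1).
    rewrite powRr1 ?(le_trans _ H1)// /H -powRrM mulVf ?gt_eqF// powRr1// (le_trans _ H01)//.
  by rewrite ler_wpM2r ?(le_trans _ H1)// /H0 lerDr.
have Hp : 0 <= H by exact: le_trans H1.
have [b0 Kb0 hb0] := hdec (k 0%N) (k0 0%N).
have ks1 i : 1 <= (k i + 1) `^ s by apply: powR_ge1 => //; rewrite lerDr.
have [Th ThE] : exists Th, Th = b0 * (k 0%N + 1) `^ s * H by exists (b0 * (k 0%N + 1) `^ s * H).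
have Th1 : 1 <= Th.
  have b01 : 1 <= b0 by exact: le_trans Kb0.
  by rewrite ThE -[leLHS]mulr1; apply: ler_pM => //; rewrite -[leLHS]mulr1; apply: ler_pM.
have main i : exists b, [/\ K <= b, forall x, P x -> W x <= b * w x `^ k i
    & b * (k i + 1) `^ s * H <= Th `^ (g ^+ i)].
  elim: i => [|i [b [Kb hb hTh]]].
    exists b0; split; [exact: Kb0|exact: hb0|].
    by rewrite expr0 powRr1 -?ThE// (le_trans _ Th1).
  have [b' [Kb' b'le hb']] :=
    decay_iteration_step w0 K1 p0 q0 gE hU hW (k0 i) Kb (nqk i) (npk i) hb.
  have kg : k i.+1 + 1 <= g * (k i + 1) by rewrite kS mulrDr mulr1; clear - R n c0' g1; lra.
  rewrite -GE -NE in b'le; rewrite -cE -kS in hb'.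
  exists b'; split; [exact: Kb'|exact: hb'|].
  have b00 := le_trans K0 Kb.
  apply: (le_trans (iteration_step b00 (le_trans K0 Kb') (ltW g0) (k0 i) (k0 i.+1) s0 Hp kg sE HE b'le)).
  rewrite exprSr powRrM.
  have bk0 : 0 <= b * (k i + 1) `^ s * H := mulr_ge0 (mulr_ge0 b00 (powR_ge0 _ _)) Hp.
  by apply: ge0_ler_powR; rewrite ?nnegrE ?(ltW g0) ?powR_ge0.
have Th0 : 0 < Th by exact: lt_le_trans Th1.
exists (2 * Th)^-1; first by rewrite invr_gt0 mulr_gt0.
move=> x Px xw; have xTh : Th * w x <= 2^-1.
  by rewrite mulrC -ler_pdivlMr// -invfM.
apply: (@geometric_halving _ (w x) Th kap g) => //; first exact: w1.
move=> i; have [b [Kb hb hTh]] := main i.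
have b00 := le_trans K0 Kb.
apply: le_trans (hb x Px) _; apply: ler_pM; rewrite ?powR_ge0//.
  apply: le_trans hTh; rewrite -mulrA ler_peMr//.
  by rewrite -[leLHS]mulr1; apply: ler_pM.
have [wp|wp] := ltP 0 (w x).
  apply: ger_powR; first by rewrite wp w1.
  by rewrite kE0 lerDr.
have -> : w x = 0 by apply/eqP; rewrite eq_le wp w0.
rewrite powR0 ?powR_ge0// gt_eqF// (lt_le_trans _ (kkap i))//; clear - R n kap1; lra.
Qed.

(** Each round trip returns to [v], so it is [v] that is shown to vanish; the same lemma with the
    two equations exchanged treats [u]. *)
Lemma zero_near z (D : R) u Lu (v : V -> R) Lv (p q C M : R) :
  0 < D -> 0 < p -> 0 < q -> 1 < p * q -> 0 <= C -> 0 < M ->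
  half_sys z D u Lu v q C M -> half_sys z D v Lv u p C M ->
  (forall b, decays u z b) -> (forall b, decays v z b) ->
  exists2 rho, 0 < rho & forall x, en (x - z) <= rho -> ut v x = 0.
Proof.
move=> D0 p0 q0 pq C0 M0 hu hv du dv.
have [_ _ _ _ huM] := hu; have [_ _ _ _ hvM] := hv.
have [r r0 rE] : exists2 r, 0 < r & 4 * r = D by exists (D / 4); [rewrite divr_gt0|lra].
have rD : 4 * r <= D by rewrite rE.
have [Ku Ku1 hKu] := decay_step q0 C0 M0 r0 rD hu du hvM.
have [Kv Kv1 hKv] := decay_step p0 C0 M0 r0 rD hv dv huM.
have [K [K1 KKu KKv]] : exists K, [/\ 1 <= K, Ku <= K & Kv <= K] by exists (Ku + Kv); split; lra.
have K0 : 0 <= K by exact: le_trans K1.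
have w0 y : 0 <= en (y - z) / r by rewrite divr_ge0 ?en_ge0// ltW.
have w1 y : en (y - z) <= r -> en (y - z) / r <= 1 by move=> yr; rewrite ler_pdivrMr// mul1r.
have [] := @decay_iteration V (fun x => en (x - z) <= r) (fun x => en (x - z) / r)
  (fun x => `|ut u x|) (fun x => `|ut v x|) p q K w0 w1 (fun x => normr_ge0 _) K1 p0 q0 pq.
- move=> b k Kb nk h x xr.
  apply: le_trans (hKu b k (le_trans KKu Kb) nk h x xr) _.
  have qk0 : 0 <= q * k + 2 by rewrite addr_ge0// (le_trans _ nk).
  by rewrite ler_wpM2r ?powR_ge0// ler_wpM2r ?powR_ge0// ler_wpM2r// exprn_ge0.
- move=> b k Kb nk h x xr.
  apply: le_trans (hKv b k (le_trans KKv Kb) nk h x xr) _.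
  have pk0 : 0 <= p * k + 2 by rewrite addr_ge0// (le_trans _ nk).
  by rewrite ler_wpM2r ?powR_ge0// ler_wpM2r ?powR_ge0// ler_wpM2r// exprn_ge0.
- move=> k k0; have [C1 C10 hC1] := decays_pointwise (ltW M0) D0 (ltn0Sn (Num.truncn k)) hvM (dv _).
  exists (K + C1 * r ^+ (Num.truncn k).+1); first by rewrite lerDl mulr_ge0// exprn_ge0// ltW.
  move=> x xr; have xD : en (x - z) < D by lra.
  apply: le_trans (hC1 x xD) _.
  have -> : C1 * en (x - z) ^+ (Num.truncn k).+1 = C1 * r ^+ (Num.truncn k).+1 * (en (x - z) / r) ^+ (Num.truncn k).+1.
    by rewrite -mulrA -exprMn [r * _]mulrC divfK// gt_eqF.
  apply: ler_pM; rewrite ?mulr_ge0 ?exprn_ge0 ?(ltW r0) ?w0//; first by rewrite lerDr.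
  by apply: exp_le_powR; rewrite ?w0 ?w1 ?k0// ltW// truncnS_gt.
move=> e e0 he; exists (Num.min r (e * r)); first by rewrite lt_min r0 mulr_gt0.
move=> x; rewrite le_min => /andP[xr xe]; apply/eqP; rewrite -normr_eq0; apply/eqP; apply: he => //.
by rewrite ler_pdivrMr.
Qed.

End zero_near.


(** * Restriction of the weak solution to a cube *)

Section restriction.
Context d (T : measurableType d) (R : realType) (mu : {measure set T -> \bar R}).
Implicit Types (D : set T).

Lemma Rintegral_restrict D (f g : T -> R) : (forall x, D x -> f x = g x) ->
  (forall x, ~ D x -> g x = 0) -> \int[mu]_(x in D) f x = \int[mu]_x g x.
Proof.
move=> fg g0; rewrite /Rintegral integral_mkcond; congr fine; apply: eq_integral => x _.
rewrite patchE; case: ifPn => [|/negP h]; first by rewrite inE => Dx; rewrite fg.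
by rewrite g0// => Dx; apply: h; rewrite inE.
Qed.

Lemma integrable_of_norm1 (f : T -> R) : measurable_fun setT f -> finite_norm mu 1%:E f ->
  mu.-integrable setT (EFin \o f).
Proof.
move=> mf hf; apply/integrableP; split; first exact/measurable_EFinP.
by move: hf; rewrite /finite_norm Lnorm1.
Qed.

Lemma integrable_of_powR (f : T -> R) : measurable_fun setT f -> (forall x, 0 <= f x) ->
  (\int[mu]_x (f x)%:E < +oo)%E -> mu.-integrable setT (EFin \o f).
Proof.
move=> mf f0 hf; apply/integrableP; split; first exact/measurable_EFinP.
by under eq_integral do rewrite gee0_abs ?lee_fin//.
Qed.

Lemma measurable_norm_powR (f : T -> R) (m : R) : measurable_fun setT f ->
  measurable_fun setT (fun x => `|f x| `^ m).
Proof.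
move=> mf; apply: (measurableT_comp (measurable_powR m)).
exact: (measurableT_comp (@normr_measurable R setT)).
Qed.

Lemma integrable_powR_of_norm (f : T -> R) (m : R) : measurable_fun setT f -> 0 < m ->
  finite_norm mu m%:E f -> mu.-integrable setT (EFin \o (fun x => `|f x| `^ m)).
Proof.
move=> mf m0 hf; apply: integrable_of_powR; first exact: measurable_norm_powR.
  by move=> x; exact: powR_ge0.
have := @poweR_Lnorm _ _ _ mu (EFin \o f) m; rewrite gt_eqF// => /(_ isT).
have -> : (\int[mu]_x `|(EFin \o f) x| `^ m = \int[mu]_x (`|f x| `^ m)%:E)%E.
  by apply: eq_integral => x _ /=; rewrite ?poweR_EFin.
move=> <-; have := hf; rewrite /finite_norm => h.
by rewrite poweR_lty.
Qed.

Lemma integrable_powR_add (f g : T -> R) (m : R) : 0 < m ->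
  measurable_fun setT f -> measurable_fun setT g ->
  mu.-integrable setT (EFin \o (fun x => `|f x| `^ m)) ->
  mu.-integrable setT (EFin \o (fun x => `|g x| `^ m)) ->
  mu.-integrable setT (EFin \o (fun x => `|f x + g x| `^ m)).
Proof.
move=> m0 mf mg hf hg.
have h := integrable_scale (2 `^ m) (integrable_add hf hg).
apply: integrable_dominated h _; first by apply: measurable_norm_powR; exact: measurable_funD.
move=> x; rewrite ger0_norm ?powR_ge0//.
have H (a b : R) : 0 <= a -> a <= b -> (a + b) `^ m <= 2 `^ m * b `^ m.
  move=> a0 ab; have b0 := le_trans a0 ab.
  rewrite -powRM//; apply: ge0_ler_powR; rewrite ?nnegrE ?(ltW m0) ?addr_ge0 ?mulr_ge0//; lra.
apply: le_trans (_ : (`|f x| + `|g x|) `^ m <= _).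
  by apply: ge0_ler_powR; rewrite ?nnegrE ?(ltW m0) ?addr_ge0// ler_normD.
have p2 := powR_ge0 (2 : R) m.
have [fg|/ltW fg] := leP `|f x| `|g x|.
  apply: le_trans (H _ _ _ fg) _ => //.
  by rewrite ler_wpM2l// lerDr powR_ge0.
rewrite addrC; apply: le_trans (H _ _ _ fg) _ => //.
by rewrite ler_wpM2l// lerDl powR_ge0.
Qed.

Lemma integrable_powR_bigsum (I : Type) (s : seq I) (f : I -> T -> R) (m : R) : 0 < m ->
  (forall i, measurable_fun setT (f i)) ->
  (forall i, mu.-integrable setT (EFin \o (fun x => `|f i x| `^ m))) ->
  mu.-integrable setT (EFin \o (fun x => `|\sum_(i <- s) f i x| `^ m)).
Proof.
move=> m0 mf hf; elim: s => [|i s ih].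
  have -> : EFin \o (fun x => `|\sum_(i <- [::]) f i x| `^ m) = cst 0%E.
    by apply/funext => x /=; rewrite big_nil normr0 powR0// gt_eqF.
  exact: integrable0.
under eq_fun do rewrite big_cons.
by apply: integrable_powR_add => //; exact: measurable_sum.
Qed.

End restriction.

Section chart.
Context (R : realType) (n : nat).
Local Notation V := 'rV[R]_n.
Local Notation itg f := ((leb R n).-integrable setT (EFin \o f)).
Variables (Omega : set V) (z : V) (r : R).
Hypotheses (n0 : (0 < n)%N) (r0 : 0 < r) (oO : open Omega) (cO : cube z r `<=` Omega).
Local Notation K := (cube z r).

Lemma Lloc_measurable (m : R) (w : V -> R) : Lloc Omega m w ->
  measurable_fun (setT : set (Rn R n)) (w \_ K).
Proof.
move=> [mw _].
have mK : measurable (K : set (Rn R n)) := measurable_cube z r.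
apply: (measurable_restrictT _ mK).1.
exact: (measurable_funS (open_measurable_row oO) cO mw).
Qed.

Lemma Lloc_integrable (w : V -> R) : Lloc Omega 1 w -> itg (w \_ K).
Proof.
move=> hw; apply: integrable_of_norm1; first exact: (Lloc_measurable hw).
by have [_] := hw; apply; [exact: compact_cube|exact: cO].
Qed.

Lemma Lloc_powR (m : R) (w : V -> R) : 0 < m -> Lloc Omega m w ->
  itg (fun y => `|(w \_ K) y| `^ m).
Proof.
move=> m0 hw; apply: (integrable_powR_of_norm _ m0); first exact: (Lloc_measurable hw).
by have [_] := hw; apply; [exact: compact_cube|exact: cO].
Qed.

(** The weak formulation is only ever tested with these rescaled kernels. *)
Lemma test_function_sc (e : sexp R n) x (t : R) : usupp e -> 0 < t -> en (x - z) + t < r ->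
  test_function Omega (sc e t^-1 x).
Proof.
move=> se t0 xt.
have cl : closed [set y | en (y - x) <= t].
  have -> : [set y : V | en (y - x) <= t] = (fun y => en (y - x)) @^-1` [set s | s <= t] by [].
  by apply: closed_comp; [move=> y _; exact: continuous_en_sub|exact: closed_le].
have sub : closure [set y | sc e t^-1 x y != 0] `<=` [set y | en (y - x) <= t].
  rewrite [X in _ `<=` X]((closure_id _).1 cl); apply: closureS => y /= y0.
  by rewrite leNgt; apply/negP => ty; move/eqP: y0; apply; exact: ker_support.
have subK : [set y | en (y - x) <= t] `<=` K.
  move=> y /= yt; apply: en_le_cube; have := en_triangle x y z; lra.
split; first exact: smooth_sc.
  apply: (@subclosed_compact _ _ K); [exact: closed_closure|exact: compact_cube|].
  exact: subset_trans sub subK.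
exact: subset_trans sub (subset_trans subK cO).
Qed.

Lemma weak_deriv_cv (u w : V -> R) i (e : sexp R n) x (t : R) : weak_deriv Omega [:: i; i] u w ->
  usupp e -> 0 < t -> en (x - z) + t < r ->
  cv (u \_ K) (dd i (dd i e)) t^-1 x = t ^+ 2 * cv (w \_ K) e t^-1 x.
Proof.
move=> [hu _ hw] se t0 xt; have := hw _ (test_function_sc se t0 xt).
have out e' y : usupp e' -> ~ K y -> ev e' (t^-1 *: (y - x)) = 0.
  move=> se' nK; apply: ker_support => //; rewrite ltNge; apply/negP => yx; apply: nK.
  apply: en_le_cube; have := en_triangle x y z; lra.
have restr (f : V -> R) e' : usupp e' ->
    \int[leb R n]_(y in Omega) (f y * ev e' (t^-1 *: (y - x))) = cv (f \_ K) e' t^-1 x.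
  move=> se'; apply: Rintegral_restrict => y.
    move=> Oy; rewrite patchE; case: ifPn => // /negP nK.
    by rewrite out ?mulr0// => Ky; apply: nK; rewrite inE.
  move=> nO; rewrite patchE; case: ifPn => [|_]; last by rewrite mul0r.
  by rewrite inE => /cO.
rewrite pderiv_sc /= sqrrN expr1n mul1r.
have -> : \int[leb R n]_(y in Omega) (w y * sc e t^-1 x y) = cv (w \_ K) e t^-1 x by exact: restr.
move=> <-.
have se2 : usupp (dd i (dd i e)) by do 2!apply: usupp_dd.
have restr2 : \int[leb R n]_(y in Omega) (u y * (t^-1 ^+ 2 * sc (dd i (dd i e)) t^-1 x y)) =
    \int[leb R n]_(y in Omega) (t^-1 ^+ 2 * u y * ev (dd i (dd i e)) (t^-1 *: (y - x))).
  by apply: eq_Rintegral => y _; rewrite mulrCA mulrA.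
rewrite restr2 (restr (fun y => t^-1 ^+ 2 * u y))//.
have -> : cv ((fun y => t^-1 ^+ 2 * u y) \_ K) (dd i (dd i e)) t^-1 x =
    \int[leb R n]_y (t^-1 ^+ 2 * ((u \_ K) y * ev (dd i (dd i e)) (t^-1 *: (y - x)))).
  by apply: eq_Rintegral => y _; rewrite !patchE /=; case: ifPn => _; rewrite /= ?mul0r ?mulr0 ?mulrA.
rewrite RintegralZl; [|exact: measurableT|exact: (integrable_cv t^-1 x (Lloc_integrable hu) se2)].
by rewrite exprVn mulVKf ?expf_neq0 ?gt_eqF.
Qed.

Lemma weq_weak_deriv (u : V -> R) (w : 'I_n -> V -> R) : (forall i, weak_deriv Omega [:: i; i] u (w i)) ->
  weq z r (u \_ K) (fun x => \sum_i (w i \_ K) x).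
Proof.
move=> hw e x t se t0 xt.
have hu : itg (u \_ K).
  by have [h _ _] := hw (Ordinal n0); exact: Lloc_integrable.
have hwi i : itg (w i \_ K) by have [_ h _] := hw i; exact: Lloc_integrable.
rewrite cv_lap// (eq_bigr (fun i => t ^+ 2 * cv (w i \_ K) e t^-1 x)); last first.
  by move=> i _; exact: weak_deriv_cv.
rewrite -big_distrr/=; congr (_ * _).
transitivity (\int[leb R n]_y (\sum_i ((w i \_ K) y * ev e (t^-1 *: (y - x))))).
  by rewrite Rintegral_sum// => i; exact: integrable_cv.
by apply: eq_Rintegral => y _; rewrite big_distrl.
Qed.

(** The second weak derivatives lie in [L^m] locally, so the mollifications converge at rate [O(t)]
    by [mol_increment_power]. The resulting bound precedes any use of the nonlinearity, whose growth
    condition is only available for bounded values. *)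
Lemma sobolev_bounded (m : R) (u : V -> R) : n%:R < m -> sobolev_loc Omega 2 m u ->
  itg (u \_ K) /\ exists2 M, 0 < M &
    (forall y, en (y - z) < r / 2 -> `|ut (u \_ K) y| <= M) /\
    {ae leb R n, forall y, en (y - z) < r / 2 -> (u \_ K) y = ut (u \_ K) y}.
Proof.
move=> nm [_ hs].
have n1 : 1 <= n%:R :> R by rewrite ler1n.
have m1 : 1 <= m by exact: le_trans (ltW nm).
have m0 : 0 < m by exact: lt_le_trans m1.
have H i : exists w, weak_deriv Omega [:: i; i] u w /\ Lloc Omega m w by exact: hs.
have [w hw] := choice H.
have hu : itg (u \_ K).
  by have [[h _ _] _] := hw (Ordinal n0); exact: Lloc_integrable.
split=> //.
have hwi i : itg (w i \_ K) by have [[_ h _] _] := hw i; exact: Lloc_integrable.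
have hq := weq_weak_deriv (fun i => (hw i).1).
have hL : itg (fun x => \sum_i (w i \_ K) x) by exact: integrable_sum.
have hLm : itg (fun x => `|\sum_i (w i \_ K) x| `^ m).
  apply: (integrable_powR_bigsum _ m0) => i; first exact: (Lloc_measurable (hw i).2).
  exact: (Lloc_powR m0 (hw i).2).
pose t0 := Num.min 1 (r / 2).
have r20 : 0 < r / 2 by rewrite divr_gt0.
have t00 : 0 < t0 by rewrite lt_min ltr01.
pose C := 2 ^+ n + \int[leb R n]_y (`|\sum_i (w i \_ K) y| `^ m).
have C0 : 0 <= C.
  by rewrite addr_ge0 ?exprn_ge0//; apply: Rintegral_ge0 => x _; exact: powR_ge0.
have hmol x s t : en (x - z) < r / 2 -> 0 < s -> s <= t -> t <= t0 ->
    `|mol (u \_ K) t x - mol (u \_ K) s x| <= C * t.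
  move=> xr s0 st; rewrite le_min => /andP[t1 tr].
  apply: (mol_increment_power hu hL m1 (ltW nm) hLm hq s0 st t1); lra.
have [M M0 hM] := ut_bounded hu C0 t00 hmol.
exists M => //; split; first exact: hM.
have := ut_ae_eq hu C0 t00 hmol; apply: ae_imp => y h yr; apply: h.
by rewrite eballE.
Qed.

(** The nonlinearity takes the unknown of its own equation first, so the second equation is covered
    by [g] with its arguments exchanged. *)
Lemma half_sys_chart (q : R) (F : V -> R * R -> R) (u v : V -> R) (C M : R) (w : 'I_n -> V -> R) :
  0 < q -> itg (u \_ K) ->
  (forall i, weak_deriv Omega [:: i; i] u (w i)) ->
  {ae leb R n, forall x, Omega x -> \sum_i w i x + F x (u x, v x) = 0} ->
  {ae leb R n, forall x, K x -> `|u x| <= M -> `|v x| <= M -> `|F x (u x, v x)| <= C * `|v x| `^ q} ->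
  {ae leb R n, forall y, en (y - z) < r / 2 -> (u \_ K) y = ut (u \_ K) y} ->
  {ae leb R n, forall y, en (y - z) < r / 2 -> (v \_ K) y = ut (v \_ K) y} ->
  (forall y, en (y - z) < r / 2 -> `|ut (u \_ K) y| <= M) ->
  (forall y, en (y - z) < r / 2 -> `|ut (v \_ K) y| <= M) ->
  half_sys z (r / 2) (u \_ K) (fun x => \sum_i (w i \_ K) x) (v \_ K) q C M.
Proof.
move=> q0 hu hw hF hC hut hvt hM hM'.
have hwi i : itg (w i \_ K) by have [_ h _] := hw i; exact: Lloc_integrable.
have inK y : en (y - z) < r / 2 -> K y by move=> h; apply: en_le_cube; have := r0; lra.
have patchK (f : V -> R) y : K y -> (f \_ K) y = f y by move=> Ky; rewrite patchE mem_set.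
split=> //.
- by split; [exact: hu|exact: integrable_sum].
- have hq := weq_weak_deriv hw.
  by move=> e x t se t0 xt; apply: hq => //; have := r0; lra.
- apply: ae_imp (ae_and (ae_and hF hC) (ae_and hut hvt)) => y [[h1 h2] [h3 h4]] yr.
  have Ky := inK y yr.
  have h3' := h3 yr; have h4' := h4 yr; rewrite patchK// in h3'; rewrite patchK// in h4'.
  have uM : `|u y| <= M by rewrite h3' hM.
  have vM : `|v y| <= M by rewrite h4' hM'.
  have -> : \sum_i (w i \_ K) y = - F y (u y, v y).
    have := h1 (cO Ky); move/eqP; rewrite addr_eq0 => /eqP <-.
    by apply: eq_bigr => i _; rewrite patchK.
  by rewrite normrN -h4' h2.
Qed.

End chart.

Section charts.
Context (R : realType) (n : nat).
Local Notation V := 'rV[R]_n.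
Local Notation itg f := ((leb R n).-integrable setT (EFin \o f)).

(** [ut] and the half systems ask for functions integrable on the whole space: [u'] and [v'] play
    that role and agree with [u] and [v] near [z]. In [chart_exists] they are the solutions cut off
    by a cube. *)
Definition chart (u v : V -> R) (p q : R) (z : V) (D : R) u' Lu v' Lv (C M : R) : Prop :=
  [/\ 0 <= C, 0 < M, half_sys z D u' Lu v' q C M, half_sys z D v' Lv u' p C M
    & forall y : V, en (y - z) < D -> u' y = u y /\ v' y = v y].

Lemma chart_exists (Omega : set V) (p q m : R) (f g : V -> R * R -> R) (u v : V -> R) z :
  (0 < n)%N -> open Omega -> 0 < p -> 0 < q -> n%:R < m ->
  (forall (K1 : set V) (K2 : set (R * R)),
    compact K1 -> K1 `<=` Omega -> compact K2 ->
    exists2 C : R, 0 < C &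
      {ae leb R n, forall x, K1 x -> forall u v : R, K2 (u, v) ->
        `|f x (u, v)| <= C * `|v| `^ q /\ `|g x (u, v)| <= C * `|u| `^ p}) ->
  sobolev_loc Omega 2 m u -> sobolev_loc Omega 2 m v -> strong_solution Omega f g u v ->
  Omega z -> exists D u' Lu v' Lv C M, [/\ 0 < D, (forall y, en (y - z) < D -> Omega y) &
    chart u v p q z D u' Lu v' Lv C M].
Proof.
move=> n0 oO p0 q0 nm hfg hu hv [Lu [Lv [[wu [hwu LuE]] [wv [hwv LvE]] hf hg]]] Oz.
have [r r0 cO] : exists2 r, 0 < r & cube z r `<=` Omega.
  have /nbhs_ballP[e /= e0 eO] : nbhs z Omega by exact: open_nbhs_nbhs.
  exists (e / 2); first by rewrite divr_gt0.
  move=> y yc; apply: eO; apply/ball_rowP => // i.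
  have := yc i; lra.
have [iu [Mu Mu0 [hMu hut]]] := sobolev_bounded n0 r0 oO cO nm hu.
have [iv [Mv Mv0 [hMv hvt]]] := sobolev_bounded n0 r0 oO cO nm hv.
pose M := Mu + Mv; have M0 : 0 < M by rewrite addr_gt0.
(* The a priori bound [M] selects the compact square on which the growth condition is invoked. *)
pose I := [set` `[- M, M]] : set R.
have cI : compact I by exact: segment_compact.
have [C C0 hC] := hfg (cube z r) (I `*` I) (@compact_cube R n z r) cO (compact_setX cI cI).
have inI a b : `|a| <= M -> `|b| <= M -> (I `*` I) (a, b).
  by move=> ha hb; split; rewrite /I /= in_itv /= -ler_norml.
exists (r / 2), (u \_ (cube z r)), (fun x => \sum_i (wu i \_ (cube z r)) x),
  (v \_ (cube z r)), (fun x => \sum_i (wv i \_ (cube z r)) x), C, M.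
split.
- by rewrite divr_gt0.
- by move=> y yr; apply: cO; apply: en_le_cube; lra.
split; [exact: ltW|exact: M0| | |].
- apply: (half_sys_chart n0 r0 oO cO q0 iu hwu (F := f)) => //.
  + by apply: ae_imp hf => x h Ox; rewrite -LuE h.
  + by apply: ae_imp hC => x h Kx ux vx; have [] := h Kx _ _ (inI _ _ ux vx).
  + by move=> y yr; apply: le_trans (hMu y yr) _; rewrite lerDl ltW.
  + by move=> y yr; apply: le_trans (hMv y yr) _; rewrite lerDr ltW.
- apply: (half_sys_chart n0 r0 oO cO p0 iv hwv (F := fun x z => g x (z.2, z.1))) => //.
  + by apply: ae_imp hg => x h Ox; rewrite -LvE h.
  + by apply: ae_imp hC => x h Kx vx ux; have [] := h Kx _ _ (inI _ _ ux vx).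
  + by move=> y yr; apply: le_trans (hMv y yr) _; rewrite lerDr ltW.
  + by move=> y yr; apply: le_trans (hMu y yr) _; rewrite lerDl ltW.
- move=> y yr; have Ky : cube z r y by apply: en_le_cube; lra.
  by rewrite !patchE !mem_set.
Qed.

End charts.


(** * From local to global vanishing *)

Section local_to_global.
Context (R : realType) (n : nat).
Local Notation V := 'rV[R]_n.

Lemma rational_near (x : V) (s : R) : 0 < s -> exists a : 'rV[rat]_n,
  en (x - map_mx ratr a) <= s.
Proof.
move=> s0; pose e := s / n.+1%:R.
have e0 : 0 < e by rewrite divr_gt0.
have H (i : 'I_n) : exists a : rat, `|x ord0 i - ratr a| <= e.
  have : x ord0 i - e < x ord0 i + e by lra.
  move=> /rat_in_itvoo[a]; rewrite in_itv/= => /andP[h1 h2]; exists a.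
  by rewrite ler_norml; apply/andP; split; lra.
have [a ha] := choice H; exists (\row_i a i).
apply: le_trans (_ : n%:R * e <= _).
  by apply: en_le_coord; [exact: ltW|move=> i; rewrite !mxE].
rewrite /e mulrA ler_pdivrMr// mulrC ler_wpM2l ?ltW// ltr_nat//.
Qed.

(** Every point has a rational ball around it inside its good ball. There are countably many
    rational balls, and each one on which [P] holds almost everywhere contributes one null set. *)
Lemma ae_of_local (Omega : set V) (P : V -> Prop) :
  (forall x, Omega x -> exists2 r, 0 < r & {ae leb R n, forall y, en (y - x) < r -> P y}) ->
  {ae leb R n, forall x, Omega x -> P x}.
Proof.
move=> H.
pose good (ak : 'rV[rat]_n * nat) := {ae leb R n, forall y : V,
  en (y - map_mx ratr ak.1) < ak.2.+1%:R^-1 -> P y}.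
pose N (i : nat) : set V := if unpickle i is Some ak then
  if pselect (good ak) then [set y | ~ (en (y - map_mx ratr ak.1) < ak.2.+1%:R^-1 -> P y)]
  else set0 else set0.
have negl : (leb R n).-negligible (\bigcup_i N i).
  apply: negligible_bigcup => i; rewrite /N; case: unpickle => [ak|]; last exact: negligible_set0.
  by case: (pselect (good ak)) => h; [exact: h|exact: negligible_set0].
apply: negligibleS negl => x /= /not_implyP[Ox nP].
have [r r0 hr] := H x Ox.
pose k := Num.truncn (2 / r).
have kr : k.+1%:R^-1 < r / 2.
  rewrite -[ltRHS]invf_div ltf_pV2 ?posrE ?divr_gt0//; exact: truncnS_gt.
have k0 : 0 < k.+1%:R^-1 :> R by rewrite invr_gt0.
have k20 : 0 < k.+1%:R^-1 / 2 :> R by rewrite divr_gt0.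
have [a ha] := rational_near x k20.
exists (pickle (a, k)) => //; rewrite /N pickleK.
case: (pselect (good (a, k))) => [hg|[]].
  move=> h; apply: nP; apply: h => /=; apply: le_lt_trans ha _.
  by rewrite ltr_pdivrMr// ltr_pMr// ltr1n.
apply: ae_imp hr => y h /= ya; apply: h.
have := en_triangle (map_mx ratr a) y x; rewrite (enB (map_mx ratr a) x).
move: ya kr ha k0; move: (k.+1%:R^-1) => e; lra.
Qed.

End local_to_global.

Section unique_continuation.
Context (R : realType) (n : nat).
Local Notation V := 'rV[R]_n.
Local Notation itg f := ((leb R n).-integrable setT (EFin \o f)).
Variables (u v : V -> R) (p q : R).
Hypotheses (p0 : 0 < p) (q0 : 0 < q) (pq : 1 < p * q).

(** Vanishing is asked almost everywhere near the point, as [u] and [v] matter only up to null sets;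
    with a whole ball in the definition the set is open. *)
Definition zero_set : set V := [set x | exists2 r, 0 < r &
  {ae leb R n, forall y, en (y - x) < r -> u y = 0 /\ v y = 0}].

Lemma zero_set_ball x r : {ae leb R n, forall y, en (y - x) < r -> u y = 0 /\ v y = 0} ->
  forall y, en (y - x) < r -> zero_set y.
Proof.
move=> h y yr; exists (r - en (y - x)); first by rewrite subr_gt0.
by apply: ae_imp h => w h wy; apply: h; have := en_triangle y w x; lra.
Qed.

Lemma open_zero_set : open zero_set.
Proof.
rewrite openE => x [r r0 h]; rewrite /interior.
by apply: filterS (eball_nbhs x r0) => y yr; exact: (zero_set_ball h).
Qed.

(** Taking [c = 1] suffices. As the bound is an inequality of extended reals, it also yields the
    integrability of [|u'|^eps] on small balls. *)
Lemma vanishing_chart w (D : R) (u' : V -> R) (eps : R) : 0 < D ->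
  measurable_fun (setT : set (Rn R n)) u' ->
  (forall y, en (y - w) < D -> u' y = u y) ->
  (forall k : R, 0 < k -> forall c : R, 0 < c -> \forall r \near 0^'+,
      (\int[leb R n]_(x in eball w r) (`|u x| `^ eps)%:E <= (c * r `^ k)%:E)%E) ->
  forall k, 0 < k -> exists2 d, 0 < d & forall r, 0 < r -> r < d ->
    itg (fun y => `|u' y| `^ eps * \1_(eball w r) y) /\
    \int[leb R n]_y (`|u' y| `^ eps * \1_(eball w r) y) <= r `^ k.
Proof.
move=> D0 mu' uu' hv k k0; have [d /= d0 hd] := hv k k0 1 ltr01.
exists (Num.min d D); first by rewrite lt_min d0.
move=> r r0; rewrite lt_min => /andP[rd rD].
have := hd r; rewrite /= sub0r normrN gtr0_norm// => /(_ rd r0); rewrite mul1r => hr.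
set F := (fun y => _); have F0 y : 0 <= F y by rewrite /F mulr_ge0 ?powR_ge0.
have mB : measurable (eball w r : set (Rn R n)) := open_measurable_row (@open_eball R n w r).
have mF : measurable_fun (setT : set (Rn R n)) F.
  by apply: measurable_funM; [exact: measurable_norm_powR|exact: measurable_indic].
have FE : (\int[leb R n]_y (F y)%:E = \int[leb R n]_(x in eball w r) (`|u x| `^ eps)%:E)%E.
  rewrite [RHS]integral_mkcond; apply: eq_integral => y _.
  rewrite /F patchE indicE; case: ifPn => yr; last by rewrite mulr0.
  have yD : en (y - w) < D.
    by move: yr; rewrite inE eballE => /lt_trans; apply.
  by rewrite mulr1 uu'.
have Ffin : (\int[leb R n]_y (F y)%:E < +oo)%E.
  by rewrite FE; apply: le_lt_trans hr _; rewrite ltry.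
split; first exact: (integrable_of_powR mF F0 Ffin).
have I0 : (0 <= \int[leb R n]_y (F y)%:E)%E by apply: integral_ge0 => y _; rewrite lee_fin.
by rewrite /Rintegral -lee_fin fineK ?FE// ge0_fin_numE -?FE.
Qed.

Lemma zero_of_improves w (D : R) u' Lu v' Lv C M : 0 < D ->
  chart u v p q w D u' Lu v' Lv C M ->
  improves w u' v' q -> improves w v' u' p -> zero_set w.
Proof.
move=> D0 [C0 M0 hu hv uv] iu iv.
have dec b := improves_all b D0 p0 q0 pq hu hv iu iv.
have qp : 1 < q * p by rewrite mulrC.
have [r1 r10 z1] := zero_near D0 p0 q0 pq C0 M0 hu hv (fun b => (dec b).1) (fun b => (dec b).2).
have [r2 r20 z2] := zero_near D0 q0 p0 qp C0 M0 hv hu (fun b => (dec b).2) (fun b => (dec b).1).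
exists (Num.min D (Num.min r1 r2)); first by rewrite !lt_min D0 r10.
have [_ _ _ hut _] := hu; have [_ _ _ hvt _] := hv.
apply: ae_imp (ae_and hut hvt) => y [h1 h2]; rewrite !lt_min => /and3P[yD y1 y2].
have [<- <-] := uv y yD.
by rewrite h1// h2// z1 ?z2// ltW.
Qed.

Lemma chart_sub w w' (D D' : R) u' Lu v' Lv C M : en (w' - w) + D' <= D ->
  chart u v p q w D u' Lu v' Lv C M -> chart u v p q w' D' u' Lu v' Lv C M.
Proof.
move=> ww [C0 M0 hu hv uv]; split => //; [exact: half_sys_sub hu|exact: half_sys_sub hv|].
by move=> y yD; apply: uv; have := en_triangle w' y w; lra.
Qed.

(** Otherwise choose [y] in the zero set close to [x], and let [w] be a point of the complement
    nearest to [y]. The open ball at [y] of radius [|w - y|] consists of zeros and touches [w], so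
    [improves_of_touching] puts [w] into the zero set, a contradiction. The radius [D / 8] keeps
    everything inside the chart of [x]. *)
Lemma zero_set_closed x (D : R) u' Lu v' Lv C M : 0 < D ->
  chart u v p q x D u' Lu v' Lv C M -> closure zero_set x -> zero_set x.
Proof.
move=> D0 hc cx; have [//|nx] := pselect (zero_set x); exfalso.
have D8 : 0 < D / 8 by rewrite divr_gt0.
have [y [Zy yx]] := cx _ (eball_nbhs x D8).
rewrite /= in yx.
pose E : set V := [set w | en (w - y) <= en (x - y)] `&` ~` zero_set.
have cE : compact E.
  apply: (@subclosed_compact _ _ (cube y (en (x - y)))); [|exact: compact_cube|].
    apply: closedI; last by apply: open_closedC; exact: open_zero_set.
    have -> : [set w : V | en (w - y) <= en (x - y)] = (fun w => en (w - y)) @^-1` [set s | s <= en (x - y)] by [].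
    by apply: closed_comp; [move=> w _; exact: continuous_en_sub|exact: closed_le].
  by move=> w [/= h _]; exact: en_le_cube.
have E0 : E !=set0 by exists x; split => //=.
have [w] := @EVT_min_rV R n (fun w => en (w - y)) E E0 cE (continuous_subspaceT (@continuous_en_sub R n y)).
rewrite inE => -[/= wx nw] hmin.
set rho := en (w - y) in wx hmin.
have rho0 : 0 < rho.
  have [r r0 hr] := Zy.
  rewrite ltNge; apply/negP => h; apply: nw; apply: (zero_set_ball hr).
  exact: le_lt_trans r0.
have inZ w' : en (w' - y) < rho -> zero_set w'.
  move=> h; apply: contrapT => nz; have : w' \in E.
    by rewrite inE; split => //=; apply: ltW; exact: lt_le_trans wx.
  by move=> /hmin; rewrite leNgt h.
have xy : en (x - y) < D / 8 by rewrite enB.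
have wD : en (w - x) + D / 2 <= D.
  by have := en_triangle y w x; rewrite -/rho; lra.
have [C0 M0 hu hv uv] := hc; have [[iu _] _ _ _ _] := hu; have [[iv _] _ _ _ _] := hv.
have zut w' : en (w' - y) < rho -> ut u' w' = 0 /\ ut v' w' = 0.
  move=> h; have [r r0 hr] := inZ w' h.
  have w'D : en (w' - x) < D / 2 by have := en_triangle y w' x; lra.
  pose s := Num.min (r / 2) (D / 4).
  have s0 : 0 < s by rewrite lt_min !divr_gt0.
  have [sr sD] : s <= r / 2 /\ s <= D / 4 by split; rewrite /s ge_min lexx ?orbT.
  have loc a : en (a - w') <= s -> en (a - w') < r /\ en (a - x) < D.
    by move=> ha; have := en_triangle w' a x; split; lra.
  split; apply: (ut_eq0 _ s0) => //; apply: ae_imp hr => a ha /loc[ar aD].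
    by have [-> _] := uv a aD; have [] := ha ar.
  by have [_ ->] := uv a aD; have [] := ha ar.
have hc' := chart_sub wD hc; have [_ _ hu' hv' _] := hc'.
have D2 : 0 < D / 2 by rewrite divr_gt0.
have yw : en (y - w) = rho by rewrite enB.
apply: nw; apply: (zero_of_improves D2 hc').
  exact: (improves_of_touching D2 q0 C0 rho0 yw hu' zut).
apply: (improves_of_touching D2 p0 C0 rho0 yw hv') => w' /zut[]; by split.
Qed.

End unique_continuation.

Unset Implicit Arguments.

Theorem theorem1p2 (R : realType) (N : nat) (hN : (0 < N)%N)
  (Omega : set 'rV[R]_N) (hOmega : is_domain Omega)
  (p q : R) (hp : 0 < p) (hq : 0 < q) (hpq : 1 < p * q)
  (f g : 'rV[R]_N -> R * R -> R)
  (hf : caratheodory_fun Omega f) (hg : caratheodory_fun Omega g)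
  (hfg : forall (K1 : set 'rV[R]_N) (K2 : set (R * R)),
    compact K1 -> K1 `<=` Omega -> compact K2 ->
    exists2 C : R, 0 < C &
      {ae leb R N, forall x, K1 x -> forall u v : R, K2 (u, v) ->
        `|f x (u, v)| <= C * `|v| `^ q /\ `|g x (u, v)| <= C * `|u| `^ p})
  (m : R) (hm : N%:R < m)
  (u v : 'rV[R]_N -> R)
  (hu : sobolev_loc Omega 2 m u) (hv : sobolev_loc Omega 2 m v)
  (huv : strong_solution Omega f g u v)
  (x0 : 'rV[R]_N) (hx0 : Omega x0)
  (hu0 : vanishes_infinite_order x0 u) (hv0 : vanishes_infinite_order x0 v) :
  {ae leb R N, forall x, Omega x -> u x = 0} /\
  {ae leb R N, forall x, Omega x -> v x = 0}.
Proof.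
have [oO cO _] := hOmega.
have ch z (Oz : Omega z) := chart_exists hN oO hp hq hm hfg hu hv huv Oz.
have Z0 : zero_set u v x0.
  have [D [u' [Lu [v' [Lv [C [M [D0 _ hc]]]]]]]] := ch x0 hx0.
  have [C0 M0 hu' hv' uv] := hc.
  have [[iu _] _ _ _ _] := hu'; have [[iv _] _ _ _ _] := hv'.
  have mu : measurable_fun (setT : set (Rn R N)) u' by apply/measurable_EFinP; exact: (measurable_int _ iu).
  have mv : measurable_fun (setT : set (Rn R N)) v' by apply/measurable_EFinP; exact: (measurable_int _ iv).
  have [e1 e10 h1] := hu0; have [e2 e20 h2] := hv0.
  apply: (zero_of_improves hp hq hpq D0 hc).
    apply: (improves_of_vanishing D0 (ltW hq) C0 e10 hu').
    by apply: (vanishing_chart D0 mu _ h1) => y yD; have [] := uv y yD.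
  apply: (improves_of_vanishing D0 (ltW hp) C0 e20 hv').
  by apply: (vanishing_chart D0 mv _ h2) => y yD; have [] := uv y yD.
(* Connectedness is used in the form that a nonempty subset which is relatively open and relatively
   closed is everything. The closed set is the closure of the zero set, whose points in [Omega]
   belong to it by [zero_set_closed]. *)
have ZO : Omega `&` zero_set u v = Omega.
  apply: cO; first by exists x0.
    by exists (zero_set u v) => //; exact: open_zero_set.
  exists (closure (zero_set u v)); first exact: closed_closure.
  apply/seteqP; split => x [Ox Zx]; split => //; first exact: subset_closure.
  have [D [u' [Lu [v' [Lv [C [M [D0 _ hc]]]]]]]] := ch x Ox.
  exact: (zero_set_closed hp hq hpq D0 hc Zx).
have Z x : Omega x -> zero_set u v x by rewrite -{1}ZO => -[].
split; apply: ae_of_local => x /Z[r r0 h]; exists r => //; apply: ae_imp h => y h yr;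
  by have [] := h yr.
Qed.
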